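(* Let $d,n_S,n_U\ge1$, $\sigma>0$, $r>0$, $\rho>0$, $\delta\in(0,1)$. Let $X_S\in\mathbb{R}^{n_S\times d}$ be fixed with $\hat\Sigma_S:=X_S^\top X_S/n_S$ invertible, and let $\mathbf{y}_S=X_S\boldsymbol{\beta}^*+\mathbf{z}$, $\mathbf{z}\sim\mathcal{N}(0,\sigma^2I_{n_S})$, $\boldsymbol{\beta}^*\in\mathcal{B}:=\{\boldsymbol{\beta}:\|\boldsymbol{\beta}\|_2\le r\}$. Let $p_T$ be a mean-zero $\rho^2$-subgaussian distribution on $\mathbb{R}^d$ with second-moment matrix $\Sigma_T=\mathbb{E}_{p_T}[\mathbf{x}\mathbf{x}^\top]$, and let $X_U\in\mathbb{R}^{n_U\times d}$ have i.i.d. rows drawn from $p_T$, independent of everything else; put $\hat\Sigma_U:=X_U^\top X_U/n_U$. Let $\hat C$ be (the $C$-component of) an optimal solution of $$\min_{C\in\mathbb{R}^{d\times d},\,\tau\in\mathbb{R}}\ r^2\tau+\frac{\sigma^2}{n_S}\operatorname{Tr}\big(C\hat\Sigma_S^{-1}C^\top\hat\Sigma_U\big)\quad\text{s.t.}\quad (C-I)^\top\hat\Sigma_U(C-I)\preceq\tau I,$$ and let $\hat{\boldsymbol{\beta}}(\mathbf{y}_S):=\hat C\hat\Sigma_S^{-1}X_S^\top\mathbf{y}_S/n_S$. Define $L_{\mathcal{B}}(\hat{\boldsymbol{\beta}}):=\max_{\boldsymbol{\beta}^*\in\mathcal{B}}\mathbb{E}_{\mathbf{z}}\|\Sigma_T^{1/2}(\hat{\boldsymbol{\beta}}(\mathbf{y}_S)-\boldsymbol{\beta}^*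 )\|_2^2$, $R_L(\mathcal{B}):=\inf_{A\in\mathbb{R}^{d\times n_S}}L_{\mathcal{B}}(\mathbf{y}_S\mapsto A\mathbf{y}_S)$ and $R_N(\mathcal{B}):=\inf_{\hat{\boldsymbol{\beta}}\text{ measurable}}L_{\mathcal{B}}(\hat{\boldsymbol{\beta}})$. Suppose $n_U\ge c_0\,\rho^4(d+\log(1/\delta))$ for a sufficiently large absolute constant $c_0$. Then, with probability at least $1-\delta$ over $X_U$ (for the fixed $X_S$), $$L_{\mathcal{B}}(\hat{\boldsymbol{\beta}})\le\Big(1+O\Big(\sqrt{\tfrac{\rho^4(d+\log(1/\delta))}{n_U}}\Big)\Big)R_L(\mathcal{B}),$$ and if in addition $\Sigma_T$ commutes with $\hat\Sigma_S$ or $\Sigma_T$ has rank $1$, $$L_{\mathcal{B}}(\hat{\boldsymbol{\beta}})\le\Big(1.25+O\Big(\sqrt{\tfrac{\rho^4(d+\log(1/\delta))}{n_U}}\Big)\Big)R_N(\mathcal{B}),$$ where $O(\cdot)$ hides absolute constants.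
   Context: A mean-zero distribution $p$ on $\mathbb{R}^d$ with second-moment matrix $\Sigma$ is called $\rho^2$-subgaussian if, writing $\mathbf{x}=\Sigma^{1/2}\bar{\mathbf{x}}$ for $\mathbf{x}\sim p$ (the whitened vector $\bar{\mathbf{x}}$), for every unit vector $\mathbf{v}$ and every $s\in\mathbb{R}$ one has $\mathbb{E}[e^{s\,\mathbf{v}^\top(\bar{\mathbf{x}}-\mathbb{E}\bar{\mathbf{x}})}]\le e^{s^2\rho^2/2}$. *)

(* Defs.v *)
From HB Require Import structures.
From mathcomp Require Import all_boot all_order all_algebra.
From mathcomp Require Import all_classical all_reals all_analysis.
Set Implicit Arguments. Unset Strict Implicit. Unset Printing Implicit Defensive.
Import Order.TTheory GRing.Theory Num.Theory.
Import numFieldNormedType.Exports.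
Local Open Scope classical_set_scope.
Local Open Scope ring_scope.

Section Defs.
Variable R : realType.

Definition l2norm n (v : 'cV[R]_n) : R := Num.sqrt (\sum_i v i 0 ^+ 2).

Definition qform n (A : 'M[R]_n) (v : 'cV[R]_n) : R := (v^T *m A *m v) 0 0.

Definition loewner_le n (A B : 'M[R]_n) : Prop := forall v, qform A v <= qform B v.

Definition psd n (A : 'M[R]_n) : Prop := A^T = A /\ forall v, 0 <= qform A v.

Definition msqrt n (A : 'M[R]_n) : 'M[R]_n :=
  xget 0 [set S : 'M[R]_n | psd S /\ S *m S = A].

Definition tcol n (t : n.-tuple R) : 'cV[R]_n := \col_j tnth t j.

Definition emp_cov n d (X : 'M[R]_(n, d)) : 'M[R]_d := n%:R^-1 *: (X^T *m X).

Definition prog_obj d (nS : nat) (sigma r : R) (SS SU : 'M[R]_d)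
  (C : 'M[R]_d) (tau : R) : R :=
  r ^+ 2 * tau + sigma ^+ 2 / nS%:R * \tr (C *m invmx SS *m C^T *m SU).

Definition prog_feasible d (SU : 'M[R]_d) (C : 'M[R]_d) (tau : R) : Prop :=
  loewner_le ((C - 1%:M)^T *m SU *m (C - 1%:M)) (tau%:M).

Definition prog_optimal d nS sigma r (SS SU : 'M[R]_d) (C : 'M[R]_d) (tau : R) : Prop :=
  prog_feasible SU C tau /\
  forall C' tau', prog_feasible SU C' tau' ->
    prog_obj nS sigma r SS SU C tau <= prog_obj nS sigma r SS SU C' tau'.

Definition measurable_estimator nS d (g : 'cV[R]_nS -> 'cV[R]_d) : Prop :=
  forall k, measurable_fun [set: nS.-tuple R] (fun t => g (tcol t) k 0).

Definition iid_gaussian_noise dO (O : measurableType dO) (Q : probability O R)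
  nS (sigma : R) (z : 'I_nS -> O -> R) : Prop :=
  (forall j, measurable_fun [set: O] (z j)) /\
  (forall j (A : set R), measurable A -> Q (z j @^-1` A) = normal_prob 0 sigma A) /\
  (forall A : 'I_nS -> set R, (forall j, measurable (A j)) ->
     Q (\bigcap_j (z j @^-1` A j)) = \big[*%E/1%E]_j Q (z j @^-1` A j)).

Definition iid_sample dO (O : measurableType dO) (P : probability O R)
  d (p : probability (d.-tuple R) R) n (x : 'I_n -> O -> d.-tuple R) : Prop :=
  (forall i, measurable_fun [set: O] (x i)) /\
  (forall i (A : set (d.-tuple R)), measurable A -> P (x i @^-1` A) = p A) /\
  (forall A : 'I_n -> set (d.-tuple R), (forall i, measurable (A i)) ->
     P (\bigcap_i (x i @^-1` A i)) = \big[*%E/1%E]_i P (x i @^-1` A i)).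

Definition mean_zero_with_second_moment d (p : probability (d.-tuple R) R)
  (Sigma : 'M[R]_d) : Prop :=
  (forall i, (\int[p]_x (tnth x i)%:E = 0)%E) /\
  (forall i j, (\int[p]_x (tnth x i * tnth x j)%:E = (Sigma i j)%:E)%E).

Definition subgaussian d (p : probability (d.-tuple R) R) (Sigma : 'M[R]_d)
  (rho : R) : Prop :=
  exists (xbar : d.-tuple R -> 'cV[R]_d) (m : 'cV[R]_d),
    (forall k, measurable_fun [set: d.-tuple R] (fun x => xbar x k 0)) /\
    {ae p, forall x, tcol x = msqrt Sigma *m xbar x} /\
    (forall k, (\int[p]_x (xbar x k 0)%:E = (m k 0)%:E)%E) /\
    (forall (v : 'cV[R]_d) (s : R), l2norm v = 1 ->
       (\int[p]_x (expR (s * (v^T *m (xbar x - m)) 0 0))%:E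
          <= (expR (s ^+ 2 * rho ^+ 2 / 2))%:E)%E).

Definition risk dO (O : measurableType dO) (Q : probability O R) nS d
  (z : 'I_nS -> O -> R) (XS : 'M[R]_(nS, d)) (ST : 'M[R]_d)
  (g : 'cV[R]_nS -> 'cV[R]_d) (beta : 'cV[R]_d) : \bar R :=
  (\int[Q]_w ((l2norm (msqrt ST *m (g (XS *m beta + \col_j z j w) - beta))) ^+ 2)%:E)%E.

Definition LB dO (O : measurableType dO) (Q : probability O R) nS d
  (z : 'I_nS -> O -> R) (XS : 'M[R]_(nS, d)) (ST : 'M[R]_d) (r : R)
  (g : 'cV[R]_nS -> 'cV[R]_d) : \bar R :=
  ereal_sup [set risk Q z XS ST g beta | beta in [set beta | l2norm beta <= r]].

Definition RL dO (O : measurableType dO) (Q : probability O R) nS d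
  (z : 'I_nS -> O -> R) (XS : 'M[R]_(nS, d)) (ST : 'M[R]_d) (r : R) : \bar R :=
  ereal_inf [set LB Q z XS ST r (fun y => A *m y) | A in [set: 'M[R]_(d, nS)]].

Definition RN dO (O : measurableType dO) (Q : probability O R) nS d
  (z : 'I_nS -> O -> R) (XS : 'M[R]_(nS, d)) (ST : 'M[R]_d) (r : R) : \bar R :=
  ereal_inf [set LB Q z XS ST r g | g in [set g | measurable_estimator g]].

End Defs.

(* Main.v *)
(** The noise is spherical Gaussian, so a linear rule [y |-> A y] has risk
    [|ST^(1/2) (A XS - I) beta|^2 + sigma^2 tr (A^T ST A)], and the program is
    the worst case of this risk over the ball, for the rules
    [A = C SS^-1 XS^T / nS], which have the least noise among all [A] with
    [A XS = C].  A Chernoff bound for squared subgaussian variables and a net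
    argument give [(1 - u) ST <= SU <= (1 + u) ST] with probability [1 - delta],
    for [u] of order [eps]; then replacing [ST] by [SU] in the program costs a
    factor [(1 + u) / (1 - u)], which yields the first inequality.

    For the second one, a bounded normal mean [|theta| <= b] has Bayes risk at
    least [4/5 * b^2 / (1 + b^2)] for some prior on at most five points: two
    points when [b^2 <= 4/5], and otherwise one of a finite table of priors whose
    Bayes risks are bounded below by a verified midpoint rule.  In the commuting
    case a product of such priors along the common eigenvectors, with the radii
    [b_i] given by water filling, matches up to the factor [4/5] the value of the
    program at a feasible point of the same water-filling form.  In the rank one
    case, [ST = u u^T], one prior along [V (r^2 I + V)^-1 u] does so, where
    [V = sigma^2 / nS * SS^-1]. *)
Require Import Defs.
From Stdlib Require Import NArith.
From HB Require Import structures.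
From mathcomp Require Import all_boot all_order all_algebra.
From mathcomp Require Import complex.
From mathcomp Require Import all_classical all_reals all_analysis.
From mathcomp Require Import measurable_realfun.
From mathcomp Require Import ring lra zify.
Import Order.TTheory GRing.Theory Num.Theory.
Import numFieldNormedType.Exports.
Local Open Scope classical_set_scope.
Local Open Scope ring_scope.
Set Implicit Arguments. Unset Strict Implicit. Unset Printing Implicit Defensive.

(** * Image measures and independence *)

(** The constant 5/4 is the inverse of the 4/5 in [bounded_normal_mean]. There [b ^ 2 / (1 + b ^ 2)]
    is the worst-case risk of the best linear rule on [[-b, b]], and 4/5 is so near the largest
    possible constant that every prior must be almost least favourable. Hence the fine table, and a
    certificate in exact integer arithmetic with all roundings on the safe side.

    The noise is given by its marginal laws and independence only. Risks under different means are
    compared through a shift formula for the joint law, and the law of a linear form is recovered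
    from that formula instead of from convolutions.

    Both [ST] and [SU] may be singular. Whitening uses a pseudo-inverse of [msqrt ST], and the
    sample rows must be shown to lie in its range almost surely. The program is minimised in the
    variable [msqrt SU *m C], because with a singular [SU] its sublevel sets in [C] are unbounded.
    Existence of the optimum matters, as the hypothesis on [Chat] is conditional on it. *)

Section weighted_law.
Import HBNNSimple.
Local Open Scope ereal_scope.
Context d (O : measurableType d) (R : realType) (P : {measure set O -> \bar R}).
Context d' (T : measurableType d').
Variables (X : O -> T) (g : O -> R).
Hypothesis mX : measurable_fun [set: O] X.
Hypothesis mg : measurable_fun [set: O] g.
Hypothesis g0 : forall x, (0 <= g x)%R.

(** The image under [X] of the measure with density [g]. One construction covers laws ([g = 1]), the
    normal law ([X] the identity) and likelihood-ratio tilts. *)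
Definition weighted_law (A : set T) : \bar R := \int[P]_(x in X @^-1` A) (g x)%:E.

Let wlaw0 : weighted_law set0 = 0.
Proof. by rewrite /weighted_law preimage_set0 integral_set0. Qed.

Let wlaw_ge0 A : 0 <= weighted_law A.
Proof. by apply: integral_ge0 => x _; rewrite lee_fin. Qed.

Let wlaw_sigma_additive : semi_sigma_additive weighted_law.
Proof.
move=> F mF tF mUF; rewrite /weighted_law preimage_bigcup ge0_integral_bigcup//.
- by apply: is_cvg_nneseries => n _ _; exact: wlaw_ge0.
- by move=> k; rewrite -[_ @^-1` _]setTI; exact: mX.
- exact/measurable_funTS/measurable_EFinP.
- by move=> x _; rewrite lee_fin.
- by apply/trivIsetP => i j _ _ ij; rewrite -preimage_setI; move/trivIsetP : tF => -> //; rewrite preimage_set0.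
Qed.

Let wlaw_mixin := isMeasure.Build _ _ _ weighted_law wlaw0 wlaw_ge0 wlaw_sigma_additive.
Definition weighted_law_measure : {measure set T -> \bar R} :=
  HB.pack_for {measure set T -> \bar R} weighted_law wlaw_mixin.

Lemma weighted_law_indic (A : set T) : measurable A ->
  \int[weighted_law_measure]_y (\1_A y : R)%:E = \int[P]_x ((\1_A (X x) : R)%:E * (g x)%:E).
Proof.
move=> mA; rewrite integral_indic// setIT -[LHS]/(weighted_law A) /weighted_law integral_mkcond.
by apply: eq_integral => x _; rewrite /patch indicE -[x \in _]/(`[<A (X x)>]) -[X x \in A]/(`[<A (X x)>]); case: ifP => _; rewrite ?mul1e ?mul0e.
Qed.

Lemma weighted_law_step (I : Type) (s : seq I) (c : I -> R) (A : I -> set T) :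
  (forall i, (0 <= c i)%R) -> (forall i, measurable (A i)) ->
  \int[weighted_law_measure]_y (\sum_(i <- s) (c i)%:E * (\1_(A i) y : R)%:E) =
  \int[P]_x ((\sum_(i <- s) (c i)%:E * (\1_(A i) (X x) : R)%:E) * (g x)%:E).
Proof.
move=> c0 mA.
have mI i : measurable_fun [set: O] (fun x => (\1_(A i) (X x) : R)%:E).
  by apply/measurable_EFinP/(measurableT_comp _ mX)/measurable_indic.
rewrite ge0_integral_sum//; last 2 first.
- by move=> i; apply: measurable_funeM; exact/measurable_EFinP/measurable_indic.
- by move=> i y _; rewrite mule_ge0 ?lee_fin.
transitivity (\int[P]_x (\sum_(i <- s) (c i)%:E * ((\1_(A i) (X x) : R)%:E * (g x)%:E))); last first.
  apply: eq_integral => x _; rewrite ge0_sume_distrl; last by move=> i _; rewrite mule_ge0 ?lee_fin.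
  by apply: eq_bigr => i _; rewrite muleA.
rewrite ge0_integral_sum//; last 2 first.
- by move=> i; apply: measurable_funeM; apply: emeasurable_funM => //; exact/measurable_EFinP.
- by move=> i y _; rewrite mule_ge0 ?mule_ge0 ?lee_fin.
apply: eq_bigr => i _; rewrite ge0_integralZl//; last 2 first.
- by apply/measurable_EFinP; exact: measurable_indic.
- by rewrite lee_fin.
rewrite ge0_integralZl//; last 3 first.
- by apply: emeasurable_funM => //; exact/measurable_EFinP.
- by move=> y _; rewrite mule_ge0 ?lee_fin.
- by rewrite lee_fin.
by rewrite weighted_law_indic.
Qed.

Lemma integral_weighted_law (f : T -> \bar R) :
  measurable_fun [set: T] f -> (forall x, 0 <= f x) ->
  \int[weighted_law_measure]_y f y = \int[P]_x (f (X x) * (g x)%:E).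
Proof.
move=> mf f0; pose f_ := nnsfun_approx measurableT mf.
have f_cvg y : (f_ n y)%:E @[n --> \oo] --> f y by exact: cvg_nnsfun_approx.
have nd_f_ x m n : (m <= n)%N -> (f_ m x <= f_ n x)%R.
  by move=> mn; exact/lefP/nd_nnsfun_approx.
have mfX n : measurable_fun [set: O] (fun x => (f_ n (X x))%:E).
  by apply/measurable_EFinP/(measurableT_comp _ mX).
have L : \int[weighted_law_measure]_y (f_ n y)%:E @[n --> \oo] -->
    \int[weighted_law_measure]_y f y.
  have -> : \int[weighted_law_measure]_y f y =
      \int[weighted_law_measure]_y (limn (fun n => (f_ n y)%:E)).
    by apply: eq_integral => y _; apply/esym/cvg_lim.
  apply: cvg_monotone_convergence => //.
  - by move=> n; exact/measurable_EFinP.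
  - by move=> n y _; rewrite lee_fin.
  - by move=> y _ m n mn; rewrite lee_fin nd_f_.
have Rr : \int[P]_x ((f_ n (X x))%:E * (g x)%:E) @[n --> \oo] --> \int[P]_x (f (X x) * (g x)%:E).
  have -> : \int[P]_x (f (X x) * (g x)%:E) =
      \int[P]_x (limn (fun n => (f_ n (X x))%:E * (g x)%:E)).
    by apply: eq_integral => x _; apply/esym/cvg_lim => //; exact: cvgeZr.
  apply: cvg_monotone_convergence => //.
  - by move=> n; apply: emeasurable_funM => //; exact/measurable_EFinP.
  - by move=> n y _; rewrite mule_ge0// lee_fin.
  - by move=> y _ m n mn; rewrite lee_wpmul2r ?lee_fin ?nd_f_.
apply: (cvg_unique _ L) => //; rewrite (_ : (fun n => _) =
  (fun n => \int[P]_x ((f_ n (X x))%:E * (g x)%:E)))//.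
apply/funext => n.
under eq_integral do rewrite (nnsfun_approxE measurableT mf).
under [RHS]eq_integral do rewrite (nnsfun_approxE measurableT mf).
(* The dyadic levels and the cap [n], taken where [f] is at least [n], are merged into one sum whose
   last index is the cap, so that [weighted_law_step] applies. *)
have E (y : T) : (approx setT f n y)%:E =
  \sum_(i < (n * 2 ^ n).+1) (if (i < n * 2 ^ n)%N then (i%:R * 2 ^- n)%R else n%:R)%:E *
  (\1_(if (i < n * 2 ^ n)%N then dyadic_approx setT f n i else integer_approx setT f n) y : R)%:E.
  rewrite big_ord_recr/= ltnn EFinD EFinM; congr (_ + _).
  by rewrite -sumEFin; apply: eq_bigr => i _; rewrite ltn_ord EFinM.
under eq_integral do rewrite E.
under [RHS]eq_integral do rewrite E.
apply: weighted_law_step => i; first by case: ifP => _; rewrite ?mulr_ge0 ?invr_ge0 ?exprn_ge0.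
case: ifP => ik; first by rewrite /dyadic_approx ik -preimage_comp; apply: (mf measurableT); apply/measurable_image_EFin; exact: measurable_itv.
exact: emeasurable_fun_c_infty.
Qed.

End weighted_law.

Lemma integral_prob_cst d (O : measurableType d) (R : realType) (P : probability O R)
    (r : \bar R) : (\int[P]_w r = r)%E.
Proof.
have PT : P setT = 1%E by exact: probability_setT.
by rewrite -[LHS]/(\int[P]_(w in setT) cst r w)%E integral_cst// [X in (_ * X)%E]PT mule1.
Qed.

Lemma integral_indic_comp d (O : measurableType d) (T : Type) (R : realType)
    (P : {measure set O -> \bar R}) (X : O -> T) (A : set T) :
  measurable (X @^-1` A) -> (\int[P]_w (\1_A (X w) : R)%:E = P (X @^-1` A))%E.
Proof.
move=> mXA; rewrite -[LHS]/(\int[P]_w (\1_(X @^-1` A) w : R)%:E)%E.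
by rewrite integral_indic// setIT.
Qed.

Lemma integral_same_law d (O : measurableType d) d' (T : measurableType d') (R : realType)
    (P : {measure set O -> \bar R}) (mu : {measure set T -> \bar R}) (X : O -> T)
    (f : T -> \bar R) :
  measurable_fun [set: O] X -> (forall A, measurable A -> P (X @^-1` A) = mu A) ->
  measurable_fun [set: T] f -> (forall x, 0 <= f x)%E ->
  (\int[P]_w f (X w) = \int[mu]_x f x)%E.
Proof.
move=> mX lawX mf f0.
transitivity (\int[weighted_law_measure P mX (measurable_cst (1%R : R)) (fun=> ler01)]_x f x)%E.
  rewrite integral_weighted_law//; first by apply: eq_integral => x _; rewrite mule1.
apply: eq_measure_integral => A mA _; rewrite -lawX// -[LHS]/(\int[P]_(x in X @^-1` A) cst 1%E x)%E integral_cst ?mul1e//.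
by rewrite -[_ @^-1` _]setTI; exact: mX.
Qed.

Section normal_law.
Local Open Scope ereal_scope.
Context (R : realType) (m s : R).

Let measurable_idR : measurable_fun [set: measurableTypeR R] (@id R).
Proof. exact: measurable_id. Qed.

Lemma integral_normal_law d (O : measurableType d) (P : {measure set O -> \bar R})
    (X : O -> R) (f : R -> \bar R) :
  measurable_fun [set: O] X ->
  (forall A, measurable A -> P (X @^-1` A) = normal_prob m s A) ->
  measurable_fun [set: R] f -> (forall x, 0 <= f x) ->
  \int[P]_w f (X w) = \int[lebesgue_measure]_x (f x * (normal_pdf m s x)%:E).
Proof.
move=> mX lawX mf f0.
rewrite (@integral_same_law _ _ _ _ _ _ (weighted_law_measure lebesgue_measure
  measurable_idR (measurable_normal_pdf m s) (normal_pdf_ge0 m s)))//.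
exact: integral_weighted_law.
Qed.

End normal_law.

(** * Expectations of products of independent variables *)

Section product_rule.
Local Open Scope ereal_scope.
Context d (O : measurableType d) (R : realType) (P : probability O R).
Context d' (T : measurableType d') (n : nat) (z : 'I_n -> O -> T).
Hypothesis mz : forall j, measurable_fun [set: O] (z j).
Hypothesis indep : forall A : 'I_n -> set T, (forall j, measurable (A j)) ->
  P (\bigcap_j (z j @^-1` A j)) = \big[*%E/1%E]_j P (z j @^-1` A j).

Let good (h : 'I_n -> T -> R) := forall j, [/\ measurable_fun [set: T] (h j),
  forall x, (0 <= h j x)%R & \int[P]_w (h j (z j w))%:E < +oo].

Let prod_rule (h : 'I_n -> T -> R) :=
  \int[P]_w (\prod_j h j (z j w))%R%:E = \big[*%E/1%E]_j \int[P]_w (h j (z j w))%:E.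

Let good_indic (h : 'I_n -> T -> R) (j0 : 'I_n) (B : set T) : measurable B -> good h ->
  good (fun j => if j == j0 then \1_B else h j).
Proof.
move=> mB gh j; case: eqP => [->|_]; last exact: gh.
split => //.
apply: (@le_lt_trans _ _ (\int[P]_w cst 1 w)); last first.
  by rewrite integral_cst// mul1e (le_lt_trans (probability_le1 P measurableT)) ?ltry.
apply: ge0_le_integral => //.
- by apply/measurable_EFinP/(measurableT_comp _ (mz j0))/measurable_indic.
- by move=> w _; rewrite lee_fin indicE; case: (_ \in _).
Qed.

(** Induction on the number [k] of coordinates that may be general functions, the remaining ones
    being indicators; [k = 0] is independence itself. *)
Let prod_rule_ind (k : nat) (h : 'I_n -> T -> R) : good h ->
  (forall j : 'I_n, (k <= j)%N -> exists2 A, measurable A & h j = \1_A) -> prod_rule h.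
Proof.
elim: k h => [|k IH] h gh hk.
  have [A AP] : {A : 'I_n -> set T & forall j, measurable (A j) /\ h j = \1_(A j)}.
    by apply: (@choice _ _ (fun j A => measurable A /\ h j = \1_A)) => j; have [A] := hk j (leq0n _); exists A.
  have mA j : measurable (z j @^-1` A j) by rewrite -[_ @^-1` _]setTI; apply: mz => //; exact: (AP j).1.
  have -> : prod_rule h = (P (\bigcap_j (z j @^-1` A j)) = \big[*%E/1%E]_j P (z j @^-1` A j)).
    rewrite /prod_rule; congr (_ = _); last first.
      apply: eq_bigr => j _; rewrite (AP j).2.
      exact: integral_indic_comp.
    have mI : measurable (\bigcap_j (z j @^-1` A j)).
      by apply: fin_bigcap_measurable => //; exact: finite_finset.
    rewrite -[in RHS](setIT (\bigcap_j _)) -integral_indic//.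
    apply: eq_integral => w _; congr EFin; rewrite indicE.
    case: (boolP (w \in _)) => [/set_mem H|/negP H].
      rewrite big1// => j _; rewrite (AP j).2 indicE mem_set//; exact: (H j).
    have [j Hj] : exists j, ~ A j (z j w).
      by apply/existsNP => H'; apply: H; apply/mem_set => j _; exact: H'.
    by rewrite (bigD1 j)//= (AP j).2 indicE memNset// mul0r.
  by apply: indep => j; exact: (AP j).1.
have [kn|nk] := ltnP k n; last first.
  by apply: IH => // j kj; have := leq_ltn_trans kj (ltn_ord j); rewrite ltnNge nk.
pose j0 := Ordinal kn.
pose upd B j := if j == j0 then \1_B else h j : T -> R.
pose G w := (\prod_(j < n | j != j0) h j (z j w))%R.
pose c := (\prod_(j < n | j != j0) fine (\int[P]_w (h j (z j w))%:E))%R.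
have int0 j : 0 <= \int[P]_w (h j (z j w))%:E.
  by apply: integral_ge0 => w _; rewrite lee_fin; have [_ -> _] := gh j.
have intE j : (fine (\int[P]_w (h j (z j w))%:E))%:E = \int[P]_w (h j (z j w))%:E.
  by rewrite fineK// ge0_fin_numE//; have [] := gh j.
have mG : measurable_fun [set: O] G.
  rewrite /G; under eq_fun do rewrite -big_filter.
  apply: measurable_prod => j _; apply: (measurableT_comp _ (mz j)); by have [] := gh j.
have G0 w : (0 <= G w)%R by apply: prodr_ge0 => j _; have [_ -> _] := gh j.
have c0 : (0 <= c)%R by apply: prodr_ge0 => j _; rewrite fine_ge0.
have cE : c%:E = \big[*%E/1]_(j < n | j != j0) \int[P]_w (h j (z j w))%:E.
  rewrite /c; apply: (big_rec2 (fun x y => x%:E = y)) => // j x y _ <-.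
  by rewrite EFinM intE.
have updG B w : (\prod_j upd B j (z j w) = \1_B (z j0 w) * G w)%R.
  rewrite (bigD1 j0)//= /upd eqxx; congr (_ * _)%R.
  by apply: eq_bigr => j /negPf ->.
(* With an indicator in place of [h j0] the induction hypothesis applies. It says that two measures
   on [T] agree on every [B], hence they give [h j0] the same integral. *)
have m12 B : measurable B ->
    weighted_law P (z j0) G B = weighted_law P (z j0) (cst c) B.
  move=> mB.
  have mzB : measurable (z j0 @^-1` B) by rewrite -[_ @^-1` _]setTI; exact: mz.
  have -> : weighted_law P (z j0) G B = \int[P]_w (\prod_j upd B j (z j w))%R%:E.
    rewrite /weighted_law integral_mkcond; apply: eq_integral => w _.
    rewrite updG /patch indicE -[w \in _]/(`[<B (z j0 w)>]) -[z j0 w \in B]/(`[<B (z j0 w)>]).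
    by case: ifP; rewrite ?mul1r ?mul0r.
  rewrite IH; last 2 first.
  - exact: good_indic.
  - move=> j kj; rewrite /upd; have [_|jj0] := eqVneq j j0; first by exists B.
    by apply: hk; rewrite ltn_neqAle kj andbT eq_sym.
  rewrite (bigD1 j0)//= {1}/upd eqxx -[RHS]/(\int[P]_(x in z j0 @^-1` B) cst c%:E x) integral_cst// muleC cE.
  congr (_ * _); first by apply: eq_bigr => j /negPf jj0; rewrite /upd jj0.
  exact: integral_indic_comp.
have [mh h0 hfin] := gh j0.
have mh' : measurable_fun [set: T] (EFin \o h j0) by exact/measurable_EFinP.
have h0' x : 0 <= (EFin \o h j0) x by rewrite lee_fin.
have := integral_weighted_law P (mz j0) mG G0 mh' h0'.
have -> : \int[weighted_law_measure P (mz j0) mG G0]_y (EFin \o h j0) y =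
    \int[weighted_law_measure P (mz j0) (measurable_cst c) (fun=> c0)]_y (EFin \o h j0) y.
  by apply: eq_measure_integral => B mB _; exact: m12.
rewrite integral_weighted_law//= ge0_integralZr//; last 2 first.
- exact/measurable_EFinP/(measurableT_comp _ (mz j0)).
- by move=> w _; rewrite lee_fin.
rewrite /prod_rule => H.
rewrite (bigD1 j0)//= -cE H; apply: eq_integral => w _.
by rewrite -EFinM (bigD1 j0).
Qed.

Lemma expectation_prod (f : 'I_n -> T -> R) :
  (forall j, measurable_fun [set: T] (f j)) -> (forall j x, (0 <= f j x)%R) ->
  (forall j, \int[P]_w (f j (z j w))%:E < +oo) ->
  \int[P]_w (\prod_j f j (z j w))%R%:E = \big[*%E/1%E]_j \int[P]_w (f j (z j w))%:E.
Proof.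
move=> mf f0 ffin; apply: (@prod_rule_ind n) => [j|j]; first by split.
by rewrite leqNgt ltn_ord.
Qed.

End product_rule.

(** * Gaussian noise *)

Section lebesgue_shift.
Local Open Scope ereal_scope.
Context (R : realType).

Lemma integral_lebesgue_shift (f : R -> \bar R) (b : R) :
  measurable_fun [set: R] f -> (forall x, 0 <= f x) ->
  \int[lebesgue_measure]_x f (x + b)%R = \int[lebesgue_measure]_x f x.
Proof.
move=> mf f0.
have mb : measurable_fun [set: measurableTypeR R] (fun x : R => (x + b)%R : measurableTypeR R).
  exact: measurable_funD.
apply: (integral_same_law mb) => // A mA; apply/esym.
apply: (@lebesgue_measure_unique R (pushforward lebesgue_measure
  (fun x : R => (x + b)%R : measurableTypeR R))) => //= _ [[u v]] _ <-.
rewrite /pushforward.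
have -> : (fun x : R => (x + b)%R) @^-1` `]u, v]%classic = `](u - b)%R, (v - b)%R]%classic.
  by apply/seteqP; split => x /=; rewrite !in_itv/= ltrBlDr lerBrDr.
rewrite !lebesgue_measure_itv/= !lte_fin ltrD2r; case: ifP => // _.
by rewrite -!EFinB; congr EFin; lra.
Qed.

End lebesgue_shift.

Section normal_pdf_facts.
Context (R : realType).
Implicit Types s x b : R.

Lemma normal_pdf_shift s x b : s != 0 ->
  normal_pdf 0 s (x - b) = normal_pdf 0 s x * expR ((b * x - b ^+ 2 / 2) / s ^+ 2).
Proof.
move=> s0; rewrite !normal_pdfE// -mulrA /normal_fun -expRD; congr (_ * expR _).
by rewrite -mulr_natr; field.
Qed.

Lemma normal_pdf01 x : normal_pdf 0 1 x = normal_peak 1 * expR (- x ^+ 2 / 2).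
Proof. by rewrite normal_pdfE ?oner_neq0// /normal_fun subr0 expr1n. Qed.

(** Completing the square turns the integrand into the density of N(t, 1). *)
Lemma integral_expR_normal_pdf (t : R) :
  (\int[lebesgue_measure]_x (expR (t * x - t ^+ 2 / 2) * normal_pdf 0 1 x)%:E = 1)%E.
Proof.
rewrite -(@integral_normal_pdf R t 1); apply: eq_integral => x _; congr EFin.
rewrite normal_pdf01 normal_pdfE ?oner_neq0// /normal_fun expr1n mulrCA -expRD.
by congr (_ * expR _); field.
Qed.

End normal_pdf_facts.

Section gaussian_shift.
Local Open Scope ereal_scope.
Context d (O : measurableType d) (R : realType) (Q : probability O R).

Lemma normal_shift (X : O -> R) (s b : R) (f : R -> \bar R) : (s != 0)%R ->
  measurable_fun [set: O] X ->
  (forall A, measurable A -> Q (X @^-1` A) = normal_prob 0 s A) ->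
  measurable_fun [set: R] f -> (forall x, 0 <= f x) ->
  \int[Q]_w f (X w + b)%R = \int[Q]_w (f (X w) * (expR ((b * X w - b ^+ 2 / 2) / s ^+ 2))%:E).
Proof.
move=> s0 mX lawX mf f0.
have mb : measurable_fun [set: R] (fun x : R => x + b)%R by exact: measurable_funD.
have mfb : measurable_fun [set: R] (fun x => f (x + b)%R) by exact: (measurableT_comp mf mb).
rewrite (integral_normal_law mX lawX mfb)//.
have mexp : measurable_fun [set: R] (fun x : R => expR ((b * x - b ^+ 2 / 2) / s ^+ 2)).
  apply: measurableT_comp => //; apply: measurable_funM => //.
  by apply: measurable_funB => //; exact: measurable_funM.
have mg : measurable_fun [set: R] (fun x : R => f x * (expR ((b * x - b ^+ 2 / 2) / s ^+ 2))%:E).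
  by apply: emeasurable_funM => //; exact/measurable_EFinP.
rewrite (integral_normal_law mX lawX mg); last by move=> x; rewrite mule_ge0// lee_fin expR_ge0.
have mp : measurable_fun [set: R] (fun x => (normal_pdf 0 s x)%:E).
  by apply/measurable_EFinP; exact: measurable_normal_pdf.
rewrite -(@integral_lebesgue_shift R (fun x => f x * _ * _) b); last 2 first.
- exact: emeasurable_funM.
- by move=> x; rewrite !mule_ge0// lee_fin ?expR_ge0 ?normal_pdf_ge0.
apply: eq_integral => x _; rewrite -muleA; congr (_ * _); rewrite -EFinM; congr EFin.
by rewrite -{1}(addrK b x) normal_pdf_shift// mulrC.
Qed.

Context (n : nat) (sigma : R) (z : 'I_n -> O -> R).
Hypothesis sigma0 : (0 < sigma)%R.
Hypothesis zQ : iid_gaussian_noise Q sigma z.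

Definition noise_tuple (b : 'I_n -> R) (w : O) : n.-tuple R := [tuple (z j w + b j)%R | j < n].

Lemma measurable_noise_tuple b : measurable_fun [set: O] (noise_tuple b).
Proof.
apply/measurable_fun_tnthP => j; rewrite (_ : _ \o _ = fun w => z j w + b j)%R.
  by apply: measurable_funD => //; exact: zQ.1.
by apply/funext => w /=; rewrite tnth_mktuple.
Qed.

Lemma measurable_tuple_box (A : 'I_n -> set R) : (forall j, measurable (A j)) ->
  measurable [set t : n.-tuple R | forall j, A j (tnth t j)].
Proof.
move=> mA; rewrite (_ : mkset _ = \bigcap_(j in [set: 'I_n]) ((fun t : n.-tuple R => tnth t j) @^-1` A j)).
  apply: fin_bigcap_measurable; first exact: finite_finset.
  by move=> j _; rewrite -[_ @^-1` _]setTI; exact: measurable_tnth.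
by apply/seteqP; split => t /= H j; [move=> _|]; exact: H.
Qed.

(** Boxes are stable under intersection and generate the product sigma-algebra. *)
Lemma box_measure_unique (m1 m2 : {measure set (n.-tuple R) -> \bar R}) :
  (forall A : 'I_n -> set R, (forall j, measurable (A j)) ->
    m1 [set t | forall j, A j (tnth t j)] = m2 [set t | forall j, A j (tnth t j)]) ->
  m1 setT < +oo ->
  forall B, measurable B -> m1 B = m2 B.
Proof.
move=> m12 m1oo B mB.
pose G := [set B : set (n.-tuple R) | exists2 A : 'I_n -> set R, (forall j, measurable (A j)) &
  B = [set t | forall j, A j (tnth t j)]].
have GT : G setT.
  by exists (fun=> setT) => //; apply/seteqP; split.
apply: (measure_unique G (fun=> setT)) => //.
- apply/seteqP; split => C.
    apply: smallest_sub; first exact: smallest_sigma_algebra.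
    apply: (big_ind (fun X => X `<=` <<s G>>)) => //.
      by move=> X Y XG YG t [/XG|/YG].
    move=> i _ D [A mA <-]; apply: sub_sigma_algebra.
    exists (fun j => if j == i then A else setT) => [j|]; first by case: ifP.
    rewrite setTI; apply/seteqP; split => t /=.
      by move=> Ai j; case: eqP => // ->.
    by move=> /(_ i); rewrite eqxx.
  apply: smallest_sub; first exact: sigma_algebra_measurable.
  by move=> D [A mA ->]; exact: measurable_tuple_box.
- move=> _ _ [A mA ->] [A' mA' ->]; exists (fun j => A j `&` A' j) => [j|]; first exact: measurableI.
  by apply/seteqP; split => t /=; [move=> [H H'] j; split|move=> H; split => j; have [] := H j].
- by rewrite bigcup_const//; exists 0%N.
- by move=> _ [A mA ->]; exact: m12.
Qed.

(** Both sides integrate [F] against a measure on tuples, and two such measures need only be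
    compared on boxes. There independence factors them into one-dimensional shifts, so no joint
    density is introduced. *)
Lemma cameron_martin (b : 'I_n -> R) (F : n.-tuple R -> \bar R) :
  measurable_fun [set: n.-tuple R] F -> (forall t, 0 <= F t) ->
  \int[Q]_w F (noise_tuple b w) =
  \int[Q]_w (F (noise_tuple (cst 0%R) w) *
    (expR (\sum_j (b j * z j w - b j ^+ 2 / 2) / sigma ^+ 2))%:E).
Proof.
move=> mF F0; have s0 : sigma != 0%R by rewrite gt_eqF.
pose L w := expR (\sum_j (b j * z j w - b j ^+ 2 / 2) / sigma ^+ 2).
have mL : measurable_fun [set: O] L.
  apply: measurableT_comp => //; apply: measurable_sum => j; apply: measurable_funM => //.
  by apply: measurable_funB => //; apply: measurable_funM => //; exact: zQ.1.
have L0 w : (0 <= L w)%R by exact: expR_ge0.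
rewrite -(integral_weighted_law Q (measurable_noise_tuple (cst 0%R)) mL L0 mF F0).
apply: integral_same_law => // B mB; first exact: measurable_noise_tuple.
have m1 : measurable_fun [set: O] (cst (1%R : R)) by exact: measurable_cst.
transitivity (weighted_law_measure Q (measurable_noise_tuple b) m1 (fun=> ler01) B).
  rewrite -[RHS]/(\int[Q]_(x in noise_tuple b @^-1` B) cst 1 x) integral_cst ?mul1e//.
  by rewrite -[_ @^-1` _]setTI; exact: measurable_noise_tuple.
apply: box_measure_unique => //; last first.
  rewrite -[ltLHS]/(\int[Q]_(x in noise_tuple b @^-1` setT) cst 1 x) integral_cst ?mul1e//; last first.
    by rewrite -[_ @^-1` _]setTI; exact: measurable_noise_tuple.
  by rewrite preimage_setT (le_lt_trans (probability_le1 Q measurableT)) ?ltry.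
move=> A mA; pose l j x : R := expR ((b j * x - b j ^+ 2 / 2) / sigma ^+ 2).
have mz j : measurable_fun [set: O] (z j) by exact: zQ.1.
have ml j : measurable_fun [set: R] (l j).
  apply: measurableT_comp => //; apply: measurable_funM => //.
  by apply: measurable_funB => //; exact: measurable_funM.
have mI j : measurable_fun [set: R] (\1_(A j) : R -> R) by exact: measurable_indic.
have shift1 j : \int[Q]_w (\1_(A j) (z j w) * l j (z j w))%:E = \int[Q]_w (\1_(A j) (z j w + b j)%R : R)%:E.
  rewrite (@normal_shift (z j) sigma (b j) (fun x => (\1_(A j) x)%:E))//.
  - by move=> B' mB'; exact: (zQ.2.1 j B' mB').
  - exact/measurable_EFinP.
have mzb j : measurable ((fun w => z j w + b j)%R @^-1` A j).
  by rewrite -[_ @^-1` _]setTI; apply: measurable_funD.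
rewrite -[LHS]/(\int[Q]_(x in noise_tuple b @^-1` [set t | forall j, A j (tnth t j)]) cst 1 x).
rewrite integral_cst ?mul1e; last first.
  by rewrite -[_ @^-1` _]setTI; apply: measurable_noise_tuple => //; exact: measurable_tuple_box.
pose A' j := [set x : R | A j (x + b j)%R].
have mA' j : measurable (A' j).
  rewrite (_ : A' j = (fun x => x + b j)%R @^-1` A j)// -[_ @^-1` _]setTI.
  by apply: measurable_funD.
have -> : noise_tuple b @^-1` [set t | forall j, A j (tnth t j)] = \bigcap_j (z j @^-1` A' j).
  apply/seteqP; split => w /= H j; last by rewrite tnth_mktuple; exact: H.
  by move=> _; have := H j; rewrite tnth_mktuple.
transitivity (\big[*%E/1%E]_j Q (z j @^-1` A' j)); first exact: (zQ.2.2 _ mA').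
rewrite -[RHS]/(\int[Q]_(x in noise_tuple (cst 0%R) @^-1` [set t | forall j, A j (tnth t j)]) (L x)%:E).
have -> : \int[Q]_(x in noise_tuple (cst 0%R) @^-1` [set t | forall j, A j (tnth t j)]) (L x)%:E =
   \int[Q]_w (\prod_j (\1_(A j) (z j w) * l j (z j w)))%:E.
  rewrite integral_mkcond; apply: eq_integral => w _; rewrite big_split/= /patch.
  have -> : (\prod_j l j (z j w))%R = L w by rewrite /L expR_sum.
  case: ifPn => [/set_mem/= H|/negP H].
    rewrite big1 ?mul1r// => j _; rewrite indicE mem_set//.
    by have := H j; rewrite tnth_mktuple addr0.
  have [j Hj] : exists j, ~ A j (z j w).
    apply/existsNP => H'; apply: H; apply/mem_set => j /=.
    by rewrite tnth_mktuple addr0.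
  by rewrite (bigD1 j)//= indicE memNset// !mul0r.
rewrite (@expectation_prod _ _ _ _ _ _ _ z mz zQ.2.2 (fun j x => \1_(A j) x * l j x)%R).
- apply: eq_bigr => j _; rewrite shift1.
  by rewrite -integral_indic_comp//; exact: mzb.
- by move=> j; exact: measurable_funM.
- by move=> j x; rewrite mulr_ge0// expR_ge0.
- move=> j; rewrite shift1 integral_indic_comp; last exact: mzb.
  by rewrite (le_lt_trans (probability_le1 Q (mzb j)))// ltry.
Qed.

End gaussian_shift.

(** * The standard normal law recovered from its shift formula *)

Section gaussian_from_shift.
Local Open Scope ereal_scope.
Context d (O : measurableType d) (R : realType) (Q : probability O R) (T : O -> R).
Hypothesis mT : measurable_fun [set: O] T.
Hypothesis shiftT : forall (s : R) (f : R -> \bar R), measurable_fun [set: R] f ->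
  (forall x, 0 <= f x) ->
  \int[Q]_w f (T w + s)%R = \int[Q]_w (f (T w) * (expR (s * T w - s ^+ 2 / 2))%:E).

Let e (t : R) : R := expR (t ^+ 2 / 2).
Let me : measurable_fun [set: R] e.
Proof.
by apply: measurableT_comp => //; apply: measurable_funM => //; exact: measurable_funX.
Qed.
Let p (t : R) : R := normal_pdf 0 1 t.
Let mp : measurable_fun [set: R] p. Proof. exact: measurable_normal_pdf. Qed.
Let p0 t : (0 <= p t)%R. Proof. exact: normal_pdf_ge0. Qed.
Let e0 t : (0 <= e t)%R. Proof. exact: expR_ge0. Qed.
Let pe t : (p t * e t = normal_peak 1)%R.
Proof. by rewrite /p /e normal_pdf01 -mulrA -expRD mulNr addNr expR0 mulr1. Qed.
Let pN t : p (- t)%R = p t.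
Proof. by rewrite /p !normal_pdf01 sqrrN. Qed.

(* With [mu] the law of [T], the measure [expR (t ^+ 2 / 2) dmu] is translation
   invariant, hence a multiple of Lebesgue measure. *)
Let J_shift (s : R) (f : R -> \bar R) : measurable_fun [set: R] f -> (forall x, 0 <= f x) ->
  \int[Q]_w (f (T w + s)%R * (e (T w))%:E) = \int[Q]_w (f (T w) * (e (T w))%:E).
Proof.
move=> mf f0.
have := @shiftT s (fun t => f t * (e (t - s))%:E); rewrite /=.
under eq_integral do rewrite addrK.
move=> ->; last 2 first.
- apply: emeasurable_funM => //; apply/measurable_EFinP; apply: (measurableT_comp me).
  exact: measurable_funB.
- by move=> x; rewrite mule_ge0// lee_fin.
apply: eq_integral => w _; rewrite -muleA -EFinM -expRD; congr (_ * (expR _)%:E).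
by field.
Qed.

(** Insert the unit mass [p (y - T)] integrated over [y], exchange the integrals, and move [T] by
    [y] with [J_shift]. What is left is [p (- T) * e (T) = c] times a Lebesgue integral of [f], and
    [c] cancels because [c * h = f * e]. *)
Lemma standard_normal_of_shift (h : R -> \bar R) :
  measurable_fun [set: R] h -> (forall x, 0 <= h x) ->
  \int[Q]_w h (T w) = \int[lebesgue_measure]_x (h x * (normal_pdf 0 1 x)%:E).
Proof.
move=> mh h0; pose f t := h t * (p t)%:E.
have mf : measurable_fun [set: R] f by apply: emeasurable_funM => //; exact/measurable_EFinP.
have f0 t : 0 <= f t by rewrite mule_ge0// lee_fin.
pose c : R := normal_peak 1.
have c0 : (0 < c)%R by apply: normal_peak_gt0; rewrite oner_neq0.
have mTf (g : R -> \bar R) : measurable_fun [set: R] g -> measurable_fun [set: O] (g \o T).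
  by move=> mg; exact: (measurableT_comp mg mT).
pose lam := @lebesgue_measure R.
have mT1 : measurable_fun [set: O * measurableTypeR R] (fun u => T u.1).
  exact: (measurableT_comp mT measurable_fst).
have m2 : measurable_fun [set: O * measurableTypeR R] (fun u => (u.2 : R)) by exact: measurable_snd.
have ep (g : R -> R) : measurable_fun [set: R] g -> measurable_fun [set: R] (EFin \o g).
  by move=> mg; exact/measurable_EFinP.
have S1 : \int[Q]_w \int[lam]_y (f (T w) * (e (T w))%:E * (p (y - T w))%:E) =
          \int[lam]_y \int[Q]_w (f (T w) * (e (T w))%:E * (p (y - T w))%:E).
  apply: (@fubini_tonelli _ _ _ _ _ Q lam (fun u => f (T u.1) * (e (T u.1))%:E * (p (u.2 - T u.1))%:E)).
    apply: emeasurable_funM; first apply: emeasurable_funM.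
    - exact: (measurableT_comp mf mT1).
    - exact: (measurableT_comp (ep _ me) mT1).
    - apply: (measurableT_comp (ep _ mp)); exact: measurable_funB.
  by move=> u; rewrite !mule_ge0// lee_fin.
have S2 : \int[Q]_w \int[lam]_y (f (y + T w)%R * (p (- T w)%R * e (T w))%:E) =
          \int[lam]_y \int[Q]_w (f (y + T w)%R * (p (- T w)%R * e (T w))%:E).
  apply: (@fubini_tonelli _ _ _ _ _ Q lam (fun u => f (u.2 + T u.1)%R * (p (- T u.1)%R * e (T u.1))%:E)).
    apply: emeasurable_funM.
    - by apply: (measurableT_comp mf); exact: measurable_funD.
    - apply/measurable_EFinP; apply: measurable_funM.
        by apply: (measurableT_comp mp); exact: measurableT_comp mT1.
      exact: (measurableT_comp me mT1).
  by move=> u; rewrite mule_ge0// lee_fin mulr_ge0.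
suff K : c%:E * \int[Q]_w h (T w) = c%:E * \int[lam]_x f x.
  have c1 : (c^-1)%:E * c%:E = 1 by rewrite -EFinM mulVf// gt_eqF.
  by rewrite -[LHS]mul1e -c1 -muleA K muleA c1 mul1e.
have lhsE : c%:E * \int[Q]_w h (T w) = \int[Q]_w (f (T w) * (e (T w))%:E).
  rewrite -ge0_integralZl//; last 2 first.
  - exact: mTf.
  - by rewrite lee_fin ltW.
  by apply: eq_integral => w _; rewrite /f -muleA -EFinM pe muleC.
have intp b : \int[lam]_y (p (y - b))%:E = 1.
  rewrite (@integral_lebesgue_shift _ (EFin \o p) (- b)%R); first exact: integral_normal_pdf.
    exact: ep.
  by move=> y; rewrite lee_fin.
have lhs2 : \int[Q]_w (f (T w) * (e (T w))%:E) =
    \int[Q]_w \int[lam]_y (f (T w) * (e (T w))%:E * (p (y - T w))%:E).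
  apply: eq_integral => w _; rewrite ge0_integralZl//.
  - by rewrite intp mule1.
  - apply: ep; apply: (measurableT_comp mp); exact: measurable_funB.
  - by move=> y _; rewrite lee_fin.
  - by rewrite mule_ge0// lee_fin.
have mid : \int[lam]_y \int[Q]_w (f (T w) * (e (T w))%:E * (p (y - T w))%:E) =
    \int[lam]_y \int[Q]_w (f (y + T w)%R * (p (- T w)%R * e (T w))%:E).
  apply: eq_integral => y _.
  have mg : measurable_fun [set: R] (fun t => f t * (p (y - t))%:E).
    apply: emeasurable_funM => //; apply: ep; apply: (measurableT_comp mp); exact: measurable_funB.
  have g0 t : 0 <= f t * (p (y - t))%:E by rewrite mule_ge0// lee_fin.
  transitivity (\int[Q]_w (f (T w) * (p (y - T w))%:E * (e (T w))%:E)).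
    by apply: eq_integral => w _; rewrite muleAC.
  rewrite -(J_shift y mg g0); apply: eq_integral => w _.
  rewrite EFinM muleA; congr (f _ * (p _)%:E * _); first by rewrite addrC.
  by rewrite opprD addrCA subrr addr0.
rewrite lhsE lhs2 S1 mid -S2.
have shiftf b : \int[lam]_y f (y + b)%R = \int[lam]_y f y by exact: integral_lebesgue_shift.
rewrite -[RHS](integral_prob_cst Q); apply: eq_integral => w _; rewrite pN pe.
have mfT : measurable_fun [set: measurableTypeR R] (fun y : R => f (y + T w)%R).
  by apply: (measurableT_comp mf); exact: measurable_funD.
have c0' : 0 <= c%:E by rewrite lee_fin ltW.
by rewrite (ge0_integralZr _ _ _ _ c0')// shiftf muleC.
Qed.

End gaussian_from_shift.

(** Both sides vanish at [u = 1] and their slopes there are [- m] and [- 1], so the inequality can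
    hold on both sides of 1 only for [m = 1]. The point [u = (1 + m) / 2] refutes any other positive
    [m]. *)
Lemma eq_of_scaled_le (R : realFieldType) (m : R) :
  (forall u : R, 0 < u -> (u ^- 2 - 1) * m / 2 >= 1 - u) -> m = 1.
Proof.
move=> H; apply/eqP; rewrite eq_le; apply/andP; split; rewrite leNgt; apply/negP => m1.
- pose u := (1 + m) / 2; have u1 : 1 < u by rewrite /u; lra.
  have u0 : 0 < u by lra.
  have := H u u0; rewrite (_ : (u ^- 2 - 1) * m / 2 = (1 - u) * ((1 + u) * m / (2 * u ^+ 2))); last by field; rewrite gt_eqF.
  apply/negP; rewrite -ltNge gtr_nMr ?subr_lt0//.
  have k : 2 * u ^+ 2 < (1 + u) * m by rewrite /u; nra.
  by rewrite ltr_pdivlMr ?mul1r// mulr_gt0 ?exprn_gt0.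
- have [m0|m0] := leP m 0.
    have h2 : 0 < 1 / 2 :> R by rewrite divr_gt0.
    by have := H _ h2; rewrite (_ : (1 / 2 : R) ^- 2 = 4); [lra|field].
  pose u := (1 + m) / 2; have u1 : u < 1 by rewrite /u; lra.
  have u0 : 0 < u by rewrite /u; lra.
  have := H u u0; rewrite (_ : (u ^- 2 - 1) * m / 2 = (1 - u) * ((1 + u) * m / (2 * u ^+ 2))); last by field; rewrite gt_eqF.
  apply/negP; rewrite -ltNge gtr_pMr ?subr_gt0//.
  have k : (1 + u) * m < 2 * u ^+ 2 by rewrite /u; nra.
  by rewrite ltr_pdivrMr ?mul1r// mulr_gt0 ?exprn_gt0.
Qed.

Section standard_normal_moments.
Local Open Scope ereal_scope.
Context d (O : measurableType d) (R : realType) (Q : probability O R) (T : O -> R).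
Hypothesis mT : measurable_fun [set: O] T.
Hypothesis lawT : forall h : R -> \bar R, measurable_fun [set: R] h -> (forall x, 0 <= h x) ->
  \int[Q]_w h (T w) = \int[lebesgue_measure]_x (h x * (normal_pdf 0 1 x)%:E).

(** The density of N(0, u^2) relative to N(0, 1), so that its mean under [T] is 1. *)
Let G (u : R) (x : R) : R := u^-1 * expR (- ((u ^- 2 - 1) * x ^+ 2 / 2)).

Let mG u : measurable_fun [set: R] (G u).
Proof.
apply: measurable_funM => //; apply: measurableT_comp => //; apply: measurableT_comp => //.
by apply: measurable_funM => //; apply: measurable_funM => //; exact: measurable_funX.
Qed.

Let EG u : (0 < u)%R -> \int[Q]_w (G u (T w))%:E = 1.
Proof.
move=> u0; rewrite (lawT (h := EFin \o G u)); last 2 first.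
- exact/measurable_EFinP.
- by move=> x; rewrite lee_fin mulr_ge0 ?expR_ge0 ?invr_ge0 ?ltW.
rewrite -(integral_normal_pdf 0 u); apply: eq_integral => x _.
rewrite -EFinM; congr EFin; rewrite normal_pdf01 normal_pdfE ?gt_eqF// /G /normal_peak.
rewrite mulrACA -expRD /normal_fun subr0 expr1n mul1r; congr (_ * expR _)%R.
  rewrite -mulrnAr [in RHS]sqrtrM ?sqr_ge0// sqrtr_sqr gtr0_norm//.
  by rewrite invfM mulrC.
by rewrite -mulr_natr; field; rewrite gt_eqF.
Qed.

Let integrable_exp u : (0 < u)%R -> Q.-integrable setT (fun w => (G u (T w))%:E).
Proof.
move=> u0; apply/integrableP; split; first by apply/measurable_EFinP; exact: (measurableT_comp (mG u) mT).
under eq_integral do rewrite gee0_abs ?lee_fin ?mulr_ge0 ?expR_ge0 ?invr_ge0 ?(ltW u0)//.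
by rewrite EG// ltry.
Qed.

Let mT2 : measurable_fun [set: O] (fun w => T w ^+ 2)%R.
Proof. exact: measurable_funX. Qed.

Let integrable_sqr : Q.-integrable setT (fun w => (T w ^+ 2)%:E).
Proof.
(* [6 * G 2 x] equals [3 * expR (3 / 8 * x ^ 2)], which dominates [x ^ 2]. *)
have := @integrable_exp 2%R (ltr0Sn _ _) => /(integrableZl measurableT 6%R).
apply: le_integrable => //; first exact/measurable_EFinP.
move=> w _; rewrite /= lee_fin ger0_norm ?sqr_ge0// ger0_norm; last first.
  by rewrite !mulr_ge0// expR_ge0.
have := expR_ge1Dx (- ((2 ^- 2 - 1) * T w ^+ 2 / 2) : R)%R; rewrite /G.
have := sqr_ge0 (T w); lra.
Qed.

Let integrable_id : Q.-integrable setT (fun w => (T w)%:E).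
Proof.
have I1 : Q.-integrable setT (cst (1 : \bar R)) by exact: finite_measure_integrable_cst.
have := integrableD measurableT I1 integrable_sqr.
apply: le_integrable => //; first exact/measurable_EFinP.
move=> w _; rewrite /= lee_fin [leRHS]ger0_norm ?addr_ge0 ?sqr_ge0//.
rewrite ler_norml; have := sqr_ge0 (T w - 1); have := sqr_ge0 (T w + 1); nra.
Qed.

Let m1 := fine (\int[Q]_w (T w)%:E).
Let m2 := fine (\int[Q]_w (T w ^+ 2)%:E).

Let int_quad (a b c : R) :
  \int[Q]_w (a + b * T w + c * T w ^+ 2)%:E = (a + b * m1 + c * m2)%:E.
Proof.
have I1 : Q.-integrable setT (cst a%:E) by exact: finite_measure_integrable_cst.
have Ib := integrableZl measurableT b integrable_id.
have Ic := integrableZl measurableT c integrable_sqr.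
under eq_integral do rewrite !EFinD (EFinM b) (EFinM c).
rewrite integralD//; last exact: integrableD.
rewrite integralD// integralZl// integralZl// integral_prob_cst.
rewrite !EFinD (EFinM b) (EFinM c) /m1 /m2 !fineK//; exact: integrable_fin_num.
Qed.

Let quad_le (a b c : R) (f : R -> R) (l : R) : measurable_fun [set: R] f ->
  (forall x, a + b * x + c * x ^+ 2 <= f x)%R -> Q.-integrable setT (fun w => (f (T w))%:E) ->
  \int[Q]_w (f (T w))%:E = l%:E -> (a + b * m1 + c * m2 <= l)%R.
Proof.
move=> mf le_f If fl; rewrite -lee_fin -int_quad -fl.
apply: le_integral => //.
- have I1 : Q.-integrable setT (cst a%:E) by exact: finite_measure_integrable_cst.
  have Ib := integrableZl measurableT b integrable_id.
  have Ic := integrableZl measurableT c integrable_sqr.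
  have := integrableD measurableT (integrableD measurableT I1 Ib) Ic.
  by apply: eq_integrable => // w _.
- by move=> w _; rewrite lee_fin.
Qed.

(** The moment is found without integrating [x ^ 2]: the bound [1 + y <= expR y] under the mean of
    [G u] gives a one-sided estimate for each [u > 0], and [eq_of_scaled_le] combines them. The
    first moment is treated alike, with exponential tilts instead of [G u]. *)
Let m2E : m2 = 1%R.
Proof.
apply: eq_of_scaled_le => u u0.
have := @quad_le u^-1 0 (- (u^-1 * ((u ^- 2 - 1) / 2))) (G u) 1 (mG u) _ (integrable_exp u0) (EG u0).
rewrite mul0r addr0 => H.
have {}H : (u^-1 + - (u^-1 * ((u ^- 2 - 1) / 2)) * m2 <= 1)%R.
  apply: H => x; rewrite mul0r addr0 /G.
  rewrite [leLHS](_ : _ = u^-1 * (1 - (u ^- 2 - 1) * x ^+ 2 / 2))%R; last by ring.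
  apply: ler_wpM2l; first by rewrite invr_ge0 ltW.
  by have := expR_ge1Dx (- ((u ^- 2 - 1) * x ^+ 2 / 2))%R; lra.
move: H; rewrite -(ler_pM2l u0) => H.
have E : (u * (u^-1 + - (u^-1 * ((u ^- 2 - 1) / 2)) * m2) = 1 - (u ^- 2 - 1) * m2 / 2)%R.
  by field; rewrite gt_eqF.
by move: H; rewrite E; lra.
Qed.

Let m1E : m1 = 0%R.
Proof.
have H b : (b * m1 <= b ^+ 2 / 2)%R.
  pose f (x : R) : R := expR (b * x - b ^+ 2 / 2).
  have mf : measurable_fun [set: R] f.
    by apply: measurableT_comp => //; apply: measurable_funB => //; exact: measurable_funM.
  have f0 x : (0 <= f x)%R by exact: expR_ge0.
  have Ef : \int[Q]_w (f (T w))%:E = 1.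
    rewrite (lawT (h := EFin \o f)); last 2 first.
    - exact/measurable_EFinP.
    - by move=> x; rewrite lee_fin.
    rewrite -(integral_normal_pdf 0 1) -[RHS](@integral_lebesgue_shift _ _ (- b)%R); last 2 first.
    - by apply/measurable_EFinP; exact: measurable_normal_pdf.
    - by move=> x; rewrite lee_fin normal_pdf_ge0.
    apply: eq_integral => x _; rewrite normal_pdf_shift ?oner_neq0// expr1n divr1.
    by rewrite -EFinM mulrC.
  have If : Q.-integrable setT (fun w => (f (T w))%:E).
    apply/integrableP; split; first by apply/measurable_EFinP; exact: (measurableT_comp mf mT).
    by under eq_integral do rewrite gee0_abs ?lee_fin//; rewrite Ef ltry.
  have := @quad_le (1 - b ^+ 2 / 2) b 0 f 1 mf _ If Ef; rewrite mul0r addr0 => Q'.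
  suff : (1 - b ^+ 2 / 2 + b * m1 <= 1)%R by lra.
  apply: Q' => x; rewrite mul0r addr0; have := expR_ge1Dx (b * x - b ^+ 2 / 2)%R; rewrite /f; lra.
apply/eqP; rewrite eq_le; apply/andP; split; rewrite leNgt; apply/negP => m0.
  have := H m1; nra.
have := H m1; nra.
Qed.

Lemma standard_normal_quad (b c : R) : \int[Q]_w ((b + c * T w) ^+ 2)%:E = (b ^+ 2 + c ^+ 2)%:E.
Proof.
transitivity (\int[Q]_w (b ^+ 2 + (2 * b * c) * T w + c ^+ 2 * T w ^+ 2)%:E).
  by apply: eq_integral => w _; congr EFin; ring.
by rewrite int_quad m1E m2E mulr0 addr0 mulr1.
Qed.

End standard_normal_moments.

Section linear_form.
Local Open Scope ereal_scope.
Context d (O : measurableType d) (R : realType) (Q : probability O R).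
Context (n : nat) (sigma : R) (z : 'I_n -> O -> R).
Hypothesis sigma0 : (0 < sigma)%R.
Hypothesis zQ : iid_gaussian_noise Q sigma z.

Lemma measurable_linear_form (a : 'I_n -> R) : measurable_fun [set: O] (fun w => \sum_j a j * z j w)%R.
Proof. by apply: measurable_sum => j; apply: measurable_funM => //; exact: zQ.1. Qed.

Definition unit_form (a : 'I_n -> R) (w : O) : R :=
  ((\sum_j a j * z j w) / (sigma * Num.sqrt (\sum_j a j ^+ 2)))%R.

Lemma measurable_unit_form a : measurable_fun [set: O] (unit_form a).
Proof. by apply: measurable_funM => //; exact: measurable_linear_form. Qed.

(** Moving each [z j] by [t * sigma * a j / s] moves [unit_form] by [t], so the Cameron-Martin
    formula becomes the shift property that characterises the standard normal law. *)
Lemma unit_form_normal (a : 'I_n -> R) (h : R -> \bar R) : (0 < \sum_j a j ^+ 2)%R ->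
  measurable_fun [set: R] h -> (forall x, 0 <= h x) ->
  \int[Q]_w h (unit_form a w) = \int[lebesgue_measure]_x (h x * (normal_pdf 0 1 x)%:E).
Proof.
move=> a0 mh h0; set N := (\sum_j a j ^+ 2)%R in a0 *; pose s := Num.sqrt N.
have s0 : (0 < s)%R by rewrite sqrtr_gt0.
have sN : (s ^+ 2 = N)%R by rewrite sqr_sqrtr// ltW.
apply: standard_normal_of_shift => //; first exact: measurable_unit_form.
move=> t f mf f0.
pose F (u : n.-tuple R) := f ((\sum_j a j * tnth u j) / (sigma * s))%R.
have mF : measurable_fun [set: n.-tuple R] F.
  apply: (measurableT_comp mf); apply: measurable_funM => //.
  by apply: measurable_sum => j; apply: measurable_funM => //; exact: measurable_tnth.
have := cameron_martin sigma0 zQ (fun j => t * sigma * a j / s)%R mF (fun u => f0 _).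
have FE b w : F (noise_tuple z b w) = f ((\sum_j a j * (z j w + b j)) / (sigma * s))%R.
  by rewrite /F; congr (f (_ / _)%R); apply: eq_bigr => j _; rewrite tnth_mktuple.
under eq_integral do rewrite FE.
under [X in _ = X]eq_integral do rewrite FE.
move=> H; transitivity (\int[Q]_w f ((\sum_j a j * (z j w + t * sigma * a j / s)) / (sigma * s))%R).
  apply: eq_integral => w _; congr f; rewrite /unit_form -/N -/s.
  under [in RHS]eq_bigr do rewrite mulrDr.
  rewrite big_split/= [in RHS]mulrDl; congr (_ + _)%R.
  rewrite (eq_bigr (fun j => (t * sigma / s) * a j ^+ 2)%R); last by move=> j _; field; rewrite gt_eqF.
  by rewrite -mulr_sumr -/N -sN; field; rewrite !gt_eqF.
rewrite {}H; apply: eq_integral => w _; congr (f _ * (expR _)%:E).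
  rewrite /unit_form -/N -/s; congr (_ / _)%R; apply: eq_bigr => j _; by rewrite addr0.
rewrite (eq_bigr (fun j => t / (sigma * s) * (a j * z j w) - t ^+ 2 / (2 * N) * a j ^+ 2)%R); last first.
  by move=> j _; rewrite -sN; field; rewrite !gt_eqF.
rewrite sumrB -!mulr_sumr -/N /unit_form -/N -/s; field.
by rewrite !gt_eqF.
Qed.

Lemma linear_form_second_moment (a : 'I_n -> R) (b : R) :
  \int[Q]_w ((b + \sum_j a j * z j w) ^+ 2)%:E = (b ^+ 2 + sigma ^+ 2 * \sum_j a j ^+ 2)%:E.
Proof.
have [a0|] := ltP 0%R (\sum_j a j ^+ 2)%R; last first.
  rewrite le_eqVlt ltNge sumr_ge0 ?orbF; last by move=> j _; exact: sqr_ge0.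
  move=> /eqP a0; rewrite a0 mulr0 addr0.
  have aj j : a j = 0%R.
    move/eqP: a0; rewrite psumr_eq0; last by move=> i _; exact: sqr_ge0.
    by move=> /allP/(_ j (mem_index_enum j)); rewrite sqrf_eq0 => /eqP.
  rewrite -[RHS](integral_prob_cst Q); apply: eq_integral => w _.
  by rewrite big1 ?addr0// => j _; rewrite aj mul0r.
set N := (\sum_j a j ^+ 2)%R in a0 *; pose s := Num.sqrt N.
have s0 : (0 < s)%R by rewrite sqrtr_gt0.
have sN : (s ^+ 2 = N)%R by rewrite sqr_sqrtr// ltW.
transitivity (\int[Q]_w ((b + sigma * s * unit_form a w) ^+ 2)%:E).
  apply: eq_integral => w _; congr (((b + _) ^+ 2)%R)%:E.
  by rewrite /unit_form -/N -/s; field; rewrite !gt_eqF.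
rewrite (standard_normal_quad (measurable_unit_form a))//; last first.
  by move=> h mh h0; exact: unit_form_normal.
by rewrite exprMn sN.
Qed.

End linear_form.

(** * The bounded normal mean *)

Lemma double_amgm (R : realDomainType) (x y z : R) :
  0 <= x -> 0 <= y -> z ^+ 2 <= x * y -> z *+ 2 <= x + y.
Proof.
move=> x0 y0 zxy; have [z0|z0] := ltP z 0.
  by apply: (@le_trans _ _ 0); [rewrite mulrn_wle0// ltW|rewrite addr_ge0].
rewrite -(@ler_pXn2r _ 2) ?nnegrE ?addr_ge0 ?mulrn_wge0//.
rewrite -mulr_natr; have := sqr_ge0 (x - y); nra.
Qed.

(** Midpoint log-convexity of exponential sums. Expanded over pairs of indices, it is [double_amgm]
    pair by pair. *)
Lemma sum_expR_logconvex (R : realType) (I : finType) (c s : I -> R) (m u : R) :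
  (forall i, 0 <= c i) ->
  (\sum_i c i * expR (s i * m)) ^+ 2 <=
  (\sum_i c i * expR (s i * (m + u))) * (\sum_i c i * expR (s i * (m - u))).
Proof.
move=> c0; pose p i := c i * expR (s i * (m + u)).
pose q i := c i * expR (s i * (m - u)); pose r i := c i * expR (s i * m).
have p0 i : 0 <= p i by rewrite mulr_ge0 ?expR_ge0.
have q0 i : 0 <= q i by rewrite mulr_ge0 ?expR_ge0.
have pq i : p i * q i = r i ^+ 2.
  rewrite /p /q /r mulrACA -expRD expr2 mulrACA -expRD; congr (_ * expR _); ring.
rewrite -(@ler_pMn2r _ 2)// expr2 [in leRHS]mulr2n.
rewrite !mulr2n !big_distrlr/=.
rewrite [X in _ <= _ + X]exchange_big/= -!big_split/=; apply: ler_sum => i _.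
rewrite -!big_split/=; apply: ler_sum => j _.
rewrite -/(r i) -/(r j) -/(p i) -/(p j) -/(q i) -/(q j) -mulr2n; apply: double_amgm; rewrite ?mulr_ge0//.
by rewrite exprMn -!pq; lra.
Qed.

Lemma fact_double_ge n : (2 ^ n * n`! <= (2 * n)`!)%N.
Proof.
elim: n => // n IH; rewrite mulnS addSn add1n !factS expnS.
rewrite (_ : 2 * 2 ^ n * (n.+1 * n`!) = (2 * n).+2 * (2 ^ n * n`!))%N; last first.
  by rewrite -[(2 * n).+2]/(2 + 2 * n)%N -mulnS mulnACA.
by rewrite leq_mul// (leq_trans IH)// leq_pmull.
Qed.

(** Term by term comparison of power series, by [(2m)! >= 2^m * m!]. Partial sums of even length are
    used since the odd terms cancel on the left. *)
Lemma cosh_le_gauss (R : realType) (t : R) :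
  (expR t + expR (- t)) / 2 <= expR (t ^+ 2 / 2).
Proof.
have Sle m : (series (exp_coeff t) (2 * m)%N + series (exp_coeff (- t)) (2 * m)%N) / 2 <=
    series (exp_coeff (t ^+ 2 / 2)) m.
  elim: m => [|m IH]; first by rewrite muln0 /series/= !big_geq// addr0 mul0r.
  rewrite mulnS !addSn add0n /series/= !big_nat_recr//= -/(series _ _) -/(series _ _) -/(series _ _).
  have ec (x : R) k : exp_coeff x k = x ^+ k / k`!%:R by rewrite exp_coeffE mulrC.
  rewrite !ec [t ^+ (2 * m).+1]exprS [(- t) ^+ (2 * m).+1]exprS !exprM !sqrrN.
  have F : (t ^+ 2) ^+ m / (2 * m)`!%:R <= (t ^+ 2 / 2) ^+ m / m`!%:R.
    rewrite expr_div_n -[leRHS]mulrA -invfM; apply: ler_wpM2l; first by rewrite exprn_ge0 ?sqr_ge0.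
    rewrite lef_pV2 ?posrE ?mulr_gt0 ?exprn_gt0 ?ltr0n ?fact_gt0//.
    by rewrite -natrX -natrM ler_nat fact_double_ge.
  move: IH F; rewrite /series/= => IH F; lra.
have cE (x : R) : series (exp_coeff x) @ \oo --> expR x by exact: is_cvg_series_exp_coeff.
have c2 (x : R) : (series (exp_coeff x) (2 * m)%N) @[m --> \oo] --> expR x.
  apply: cvg_comp (cE x); exact: cvg_mulnl.
have cl : ((series (exp_coeff t) (2 * m)%N + series (exp_coeff (- t)) (2 * m)%N) / 2) @[m --> \oo]
    --> (expR t + expR (- t)) / 2.
  by apply: cvgM; [exact: cvgD|exact: cvg_cst].
apply: (ler_cvg_to cl (cE (t ^+ 2 / 2))); exact: nearW.
Qed.

Section bayes_risk_density.
Variables (R : realType) (n : nat) (w th : 'I_n -> R).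
Hypothesis w0 : forall i, 0 <= w i.

Definition lik (i : 'I_n) (x : R) : R := w i * expR (th i * x - th i ^+ 2 / 2).

Definition pmom k (x : R) : R := \sum_i lik i x * th i ^+ k.

(** Posterior variance times the marginal density relative to N(0, 1); its mean under N(0, 1) is the
    Bayes risk for squared error. *)
Definition bayes_dens (x : R) : R := pmom 2 x - pmom 1 x ^+ 2 / pmom 0 x.

Definition gauss_dens (x : R) : R := expR (- x ^+ 2 / 2) * bayes_dens x.

Lemma lik_ge0 i x : 0 <= lik i x.
Proof. by rewrite mulr_ge0 ?expR_ge0. Qed.

Lemma pmom0_gt0 x : 0 < \sum_i w i -> 0 < pmom 0 x.
Proof.
move=> W; rewrite lt0r sumr_ge0 ?andbT; last by move=> i _; rewrite mulr1 lik_ge0.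
apply/eqP => /eqP; rewrite psumr_eq0 => [/allP H|i _]; last by rewrite mulr1 lik_ge0.
move: W; rewrite big1 ?ltxx// => i _; have := H i (mem_index_enum i).
by rewrite mulr1 mulf_eq0 expR_eq0 orbF => /eqP.
Qed.

Hypothesis W : 0 < \sum_i w i.

Lemma quad_lik x t : \sum_i lik i x * (t - th i) ^+ 2 =
  bayes_dens x + pmom 0 x * (t - pmom 1 x / pmom 0 x) ^+ 2.
Proof.
have f0 : pmom 0 x != 0 by rewrite gt_eqF ?pmom0_gt0.
have -> : \sum_i lik i x * (t - th i) ^+ 2 = t ^+ 2 * pmom 0 x - t *+ 2 * pmom 1 x + pmom 2 x.
  rewrite /pmom !mulr_sumr -sumrB -big_split/=; apply: eq_bigr => i _.
  by rewrite !expr1 expr0; ring.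
by rewrite /bayes_dens; field.
Qed.

Lemma bayes_dens_le x t : bayes_dens x <= \sum_i lik i x * (t - th i) ^+ 2.
Proof. by rewrite quad_lik lerDl mulr_ge0 ?sqr_ge0// ltW ?pmom0_gt0. Qed.

Lemma bayes_densE x : bayes_dens x =
  \sum_i lik i x * (pmom 1 x / pmom 0 x - th i) ^+ 2.
Proof. by rewrite quad_lik subrr expr0n mulr0 addr0. Qed.

Lemma bayes_dens_ge0 x : 0 <= bayes_dens x.
Proof. by rewrite bayes_densE sumr_ge0// => i _; rewrite mulr_ge0 ?sqr_ge0 ?lik_ge0. Qed.

(** Lagrange's identity: the numerator [pmom 2 * pmom 0 - pmom 1 ^ 2] is, up to a factor 2, an
    exponential sum over pairs with nonnegative coefficients [cN], hence log-convex. *)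
Let cN (p : 'I_n * 'I_n) := w p.1 * w p.2 * (th p.1 - th p.2) ^+ 2 *
  expR (- th p.1 ^+ 2 / 2 - th p.2 ^+ 2 / 2).
Let sN (p : 'I_n * 'I_n) := th p.1 + th p.2.

Let numE x : (bayes_dens x * pmom 0 x) *+ 2 = \sum_p cN p * expR (sN p * x).
Proof.
have f0 : pmom 0 x != 0 by rewrite gt_eqF ?pmom0_gt0.
have -> : bayes_dens x * pmom 0 x = pmom 2 x * pmom 0 x - pmom 1 x * pmom 1 x.
  by rewrite /bayes_dens; field.
rewrite mulr2n {1}(mulrC (pmom 2 x)).
rewrite addrACA -opprD /pmom !big_distrlr/= -!big_split/= -sumrB.
rewrite -(pair_bigA _ (fun i j => cN (i, j) * expR (sN (i, j) * x)))/=.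
apply: eq_bigr => i _; rewrite -!big_split/= -sumrB; apply: eq_bigr => j _.
have -> : cN (i, j) * expR (sN (i, j) * x) = lik i x * lik j x * (th i - th j) ^+ 2.
  rewrite /cN /sN /lik/=.
  have -> : w i * expR (th i * x - th i ^+ 2 / 2) * (w j * expR (th j * x - th j ^+ 2 / 2))
    = w i * w j * (expR (- th i ^+ 2 / 2 - th j ^+ 2 / 2) * expR ((th i + th j) * x)).
    by rewrite mulrACA -!expRD; congr (_ * expR _); ring.
  ring.
by rewrite !expr1 !expr0; ring.
Qed.

(** This takes the place of a derivative bound in the midpoint rule. The integrand is a Gaussian
    times a log-convex numerator over [pmom 0], and [pmom 0 (m + u) * pmom 0 (m - u)] exceeds
    [pmom 0 m ^ 2] by at most [expR (u ^ 2 * tau ^ 2)], by [cosh_le_gauss]. So the geometric mean of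
    the values at [m + u] and [m - u] is bounded below. *)
Lemma gauss_dens_midpoint (tau m u : R) : (forall i, `|th i| <= tau) ->
  gauss_dens m * expR (- (u ^+ 2 * (1 + tau ^+ 2) / 2)) *+ 2 <=
  gauss_dens (m + u) + gauss_dens (m - u).
Proof.
move=> thtau.
have f0 x : 0 < pmom 0 x by exact: pmom0_gt0.
have N0 x : 0 <= bayes_dens x * pmom 0 x by rewrite mulr_ge0 ?bayes_dens_ge0// ltW.
have NN : (bayes_dens m * pmom 0 m) ^+ 2 <=
    (bayes_dens (m + u) * pmom 0 (m + u)) * (bayes_dens (m - u) * pmom 0 (m - u)).
  have c0 p : 0 <= cN p.
    by apply: mulr_ge0; [apply: mulr_ge0; [exact: mulr_ge0|exact: sqr_ge0]|exact: expR_ge0].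
  have := sum_expR_logconvex sN m u c0; rewrite -!numE.
  by move: (_ * pmom 0 m) (_ * pmom 0 (m + u)) (_ * pmom 0 (m - u)) => x y z; nra.
have FF : pmom 0 (m + u) * pmom 0 (m - u) <= (pmom 0 m) ^+ 2 * expR (u ^+ 2 * tau ^+ 2).
  apply: (@le_trans _ _ (((pmom 0 (m + u) + pmom 0 (m - u)) / 2) ^+ 2)).
    have := sqr_ge0 (pmom 0 (m + u) - pmom 0 (m - u)); nra.
  rewrite (_ : u ^+ 2 * tau ^+ 2 = 2%:R * (u ^+ 2 * tau ^+ 2 / 2)); last by field.
  rewrite expRM_natl -exprMn ler_pXn2r ?nnegrE ?divr_ge0 ?mulr_ge0 ?expR_ge0 ?addr_ge0 ?(ltW (f0 _))//.
  rewrite /pmom -big_split/= mulr_suml mulr_suml; apply: ler_sum => i _.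
  rewrite !mulr1 /lik.
  have -> : w i * expR (th i * (m + u) - th i ^+ 2 / 2) + w i * expR (th i * (m - u) - th i ^+ 2 / 2)
     = w i * expR (th i * m - th i ^+ 2 / 2) * (expR (th i * u) + expR (- (th i * u))).
    by rewrite -mulrDr -[RHS]mulrA [in RHS]mulrDr -!expRD; congr (_ * (expR _ + expR _)); ring.
  rewrite -mulrA ler_wpM2l ?mulr_ge0 ?expR_ge0//.
  apply: (le_trans (cosh_le_gauss _)); rewrite ler_expR ler_pM2r ?invr_gt0//.
  rewrite exprMn mulrC ler_wpM2l ?sqr_ge0// -real_normK ?num_real//.
  by rewrite ler_pXn2r ?nnegrE// (le_trans _ (thtau i)).
apply: double_amgm; rewrite ?mulr_ge0 ?expR_ge0 ?bayes_dens_ge0//.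
rewrite /gauss_dens; set E := expR (- (u ^+ 2 * (1 + tau ^+ 2) / 2)).
have E2 : expR (- (m + u) ^+ 2 / 2) * expR (- (m - u) ^+ 2 / 2) =
   (expR (- m ^+ 2 / 2) * E) ^+ 2 * expR (u ^+ 2 * tau ^+ 2).
  by rewrite /E -[in RHS]expRD -[in RHS]expRM_natl -!expRD; congr expR; field.
rewrite mulrACA E2 [leLHS](_ : _ = (expR (- m ^+ 2 / 2) * E) ^+ 2 * bayes_dens m ^+ 2); last by ring.
rewrite -[leRHS]mulrA ler_wpM2l ?sqr_ge0//.
set ee := expR _ in FF *; set a := bayes_dens (m + u); set b := bayes_dens (m - u).
rewrite -(ler_pM2r (exprn_gt0 2 (f0 m))) -exprMn.
apply: (le_trans NN); rewrite mulrACA -/a -/b mulrC.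
rewrite [leRHS](_ : _ = (pmom 0 m ^+ 2 * ee) * (a * b)); last by ring.
by rewrite ler_wpM2r ?mulr_ge0 ?bayes_dens_ge0.
Qed.

End bayes_risk_density.

(** * A midpoint rule from below *)

Section midpoint_rule.
Local Open Scope ereal_scope.
Context (R : realType).
Local Notation lam := (@lebesgue_measure R).

Lemma integral_lebesgue_reflect (f : R -> \bar R) (c : R) :
  measurable_fun [set: R] f -> (forall x, 0 <= f x) ->
  \int[lam]_x f (c - x)%R = \int[lam]_x f x.
Proof.
move=> mf f0.
have mN : measurable_fun [set: measurableTypeR R] (fun x : R => (- x)%R : measurableTypeR R).
  exact: measurableT_comp.
have mfc : measurable_fun [set: R] (fun x : R => f (x + c)%R).
  by apply: (measurableT_comp mf); exact: measurable_funD.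
rewrite -[RHS](integral_lebesgue_shift c mf f0).
transitivity (\int[lam]_x (fun y => f (y + c)%R) (- x)%R).
  by apply: eq_integral => x _; rewrite addrC.
apply: (integral_same_law mN) => // A mA; exact: lebesgue_measureN.
Qed.

(** Reflecting the cell about [m] pairs [m + u] with [m - u], so a lower bound for paired values
    suffices and no convexity of [F] is assumed. *)
Lemma midpoint_cell (F : R -> R) (m h k : R) : (0 < h)%R -> (0 <= k)%R ->
  measurable_fun [set: R] F -> (forall x, (0 <= F x)%R) ->
  (forall u, (`|u| < h / 2)%R -> (k *+ 2 <= F (m + u) + F (m - u))%R) ->
  (h * k)%:E <= \int[lam]_x (F x * \1_(`](m - h / 2), (m + h / 2)[%classic : set R) x)%:E.
Proof.
move=> h0 k0 mF F0 Fk; set I := `]_, _[%classic.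
have lamI : lam I = h%:E.
  rewrite lebesgue_measure_itv/= lte_fin (_ : (m - h / 2 < m + h / 2)%R); last by lra.
  by rewrite -EFinB; congr EFin; lra.
pose G x : R := (F x * \1_I x)%R.
have mI : measurable (I : set R) by exact: measurable_itv.
have mG : measurable_fun [set: R] (EFin \o G).
  by apply/measurable_EFinP; apply: measurable_funM => //; exact: measurable_indic.
have G0 x : 0 <= (EFin \o G) x by rewrite lee_fin mulr_ge0.
have GG : \int[lam]_x (G x)%:E + \int[lam]_x (G x)%:E = \int[lam]_x (G x + G (m + m - x))%:E.
  rewrite -{2}(integral_lebesgue_reflect (m + m) mG G0)/= -ge0_integralD//.
  - by move=> x _; exact: G0.
  - by move=> x _; exact: (G0 (m + m - x)%R).
  - by apply: (measurableT_comp mG); exact: measurable_funB.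
have L : (h * k)%:E + (h * k)%:E <= \int[lam]_x (G x + G (m + m - x))%:E.
  have k2 : (0 <= k *+ 2)%R by rewrite mulrn_wge0.
  have mK : measurable_fun [set: R] (fun x => (k *+ 2 * \1_I x)%:E).
    by apply/measurable_EFinP; apply: measurable_funM => //; exact: measurable_indic.
  have mi : measurable_fun [set: R] (fun x => (\1_I x : R)%:E).
    by apply/measurable_EFinP; exact: measurable_indic.
  apply: (@le_trans _ _ (\int[lam]_x (k *+ 2 * \1_I x)%:E)).
    under eq_integral do rewrite EFinM.
    rewrite ge0_integralZl_EFin//.
    rewrite integral_indic// setIT [X in _ * X]lamI.
    by rewrite -EFinM -EFinD lee_fin -mulr_natr; lra.
  apply: ge0_le_integral => //.
  - by move=> x _; rewrite lee_fin mulr_ge0.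
  - apply/measurable_EFinP; apply: measurable_funD; first exact/measurable_EFinP.
    apply/measurable_EFinP; apply: (measurableT_comp mG); exact: measurable_funB.
  - move=> x _; rewrite indicE; case: (boolP (x \in I)) => [/set_mem|xI]; last first.
      by rewrite mulr0 EFinD adde_ge0// ?(G0 x) ?(G0 (m + m - x)%R).
    rewrite /I/= in_itv/= mulr1 => /andP[x1 x2]; rewrite lee_fin /G !indicE !mem_set ?mulr1.
    + have := Fk (x - m)%R; rewrite (_ : (m + (x - m) = x)%R); last by lra.
      rewrite (_ : (m - (x - m) = m + m - x)%R); last by lra.
      by apply; rewrite ltr_norml; lra.
    + by rewrite /I/= in_itv/=; lra.
    + by rewrite /I/= in_itv/=; lra.
have [->|fin] := eqVneq (\int[lam]_x (G x)%:E) +oo; first by rewrite leey.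
have Gfin : \int[lam]_x (G x)%:E \is a fin_num.
  by rewrite ge0_fin_numE ?lt_neqAle ?fin ?leey//; apply: integral_ge0 => x _; exact: G0.
move: L; rewrite -GG -(fineK Gfin) -!EFinD !lee_fin; lra.
Qed.

Lemma midpoint_rule (F : R -> R) (c h : R) (N : nat) (k : nat -> R) : (0 < h)%R ->
  (forall i, (0 <= k i)%R) ->
  measurable_fun [set: R] F -> (forall x, (0 <= F x)%R) ->
  (forall i u, (i < N)%N -> (`|u| < h / 2)%R ->
    (k i *+ 2 <= F (c + (i%:R + 1 / 2) * h + u) + F (c + (i%:R + 1 / 2) * h - u))%R) ->
  (\sum_(i < N) h * k i)%:E <= \int[lam]_x (F x)%:E.
Proof.
move=> h0 k0 mF F0 Fk; pose mid (i : nat) := (c + (i%:R + 1 / 2) * h)%R.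
pose I (i : nat) := `](mid i - h / 2)%R, (mid i + h / 2)%R[%classic.
have mI i : measurable (I i : set R) by exact: measurable_itv.
have mFI i : measurable_fun [set: R] (fun x => (F x * \1_(I i) x)%:E).
  by apply/measurable_EFinP; apply: measurable_funM => //; exact: measurable_indic.
apply: (@le_trans _ _ (\sum_(i < N) \int[lam]_x (F x * \1_(I i) x)%:E)).
  rewrite -sumEFin; apply: lee_sum => i _; apply: midpoint_cell => // u hu.
  exact: Fk.
rewrite -ge0_integral_sum//; last 2 first.
- by move=> i; exact: mFI.
- by move=> i x _; rewrite lee_fin mulr_ge0.
apply: ge0_le_integral => //.
- by move=> x _; apply: sume_ge0 => i _; rewrite lee_fin mulr_ge0.
- by apply: emeasurable_sum => i; exact: mFI.
- exact/measurable_EFinP.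
move=> x _; rewrite sumEFin lee_fin -mulr_sumr ler_piMr//.
have [[i0 xi0]|nx] := pselect (exists i : 'I_N, I i x); last first.
  by rewrite big1 ?ler01// => i _; rewrite indicE memNset// => xi; apply: nx; exists i.
rewrite (bigD1 i0)//= big1 ?addr0 ?indicE ?mem_set// => i ii0.
rewrite indicE memNset// => xi; move: xi0 xi; rewrite /I/= !in_itv/= /mid => /andP[a1 a2] /andP[b1 b2].
have [lt|lt|/val_inj e] := ltngtP (val i) (val i0); last by rewrite e eqxx in ii0.
  have : ((val i).+1%:R <= (val i0)%:R :> R)%R by rewrite ler_nat.
  rewrite -natr1 => H; nra.
have : ((val i0).+1%:R <= (val i)%:R :> R)%R by rewrite ler_nat.
rewrite -natr1 => H; nra.
Qed.

End midpoint_rule.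

(** * Bayes risk along one direction of the data space *)

Section bayes_lower_bound.
Local Open Scope ereal_scope.
Context d (O : measurableType d) (R : realType) (Q : probability O R).
Context (n : nat) (sigma : R) (z : 'I_n -> O -> R).
Hypothesis sigma0 : (0 < sigma)%R.
Hypothesis zQ : iid_gaussian_noise Q sigma z.
Context (K : nat) (w : 'I_K -> R) (th : 'I_K -> R).
Hypothesis w0 : forall i, (0 <= w i)%R.
Hypothesis W : (0 < \sum_i w i)%R.

Lemma measurable_lik (th' : 'I_K -> R) i : measurable_fun [set: R] (lik w th' i).
Proof.
apply: measurable_funM => //; apply: measurableT_comp => //; apply: measurable_funB => //.
Qed.

Lemma measurable_bayes_dens (th' : 'I_K -> R) : measurable_fun [set: R] (bayes_dens w th').
Proof.
have mp k : measurable_fun [set: R] (pmom w th' k).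
  by apply: measurable_sum => i; apply: measurable_funM => //; exact: measurable_lik.
apply: measurable_funB => //; apply: measurable_funM; first exact: measurable_funX.
rewrite (_ : (fun x => _) = (fun x => (pmom w th' 0 x) `^ (-1))%R).
  exact: (measurableT_comp (measurable_powR (-1)%R) (mp 0%N)).
apply/funext => x; rewrite powR_inv1// ltW// pmom0_gt0//.
Qed.

(* Cameron-Martin replaces the law of the data by the null law times the
   likelihood ratio, a function of the sufficient statistic [unit_form z a]. *)
Lemma bayes_risk_ge (a y0 : 'I_n -> R) (g : n.-tuple R -> R) :
  (0 < \sum_j a j ^+ 2)%R -> measurable_fun [set: n.-tuple R] g ->
  forall al : R, al = (Num.sqrt (\sum_j a j ^+ 2) / sigma)%R ->
  (al ^- 2)%:E * \int[lebesgue_measure]_x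
     (bayes_dens w (fun i => al * th i)%R x * normal_pdf 0 1 x)%:E <=
  \sum_i (w i)%:E * \int[Q]_v ((g [tuple (y0 j + th i * a j + z j v)%R | j < n] - th i) ^+ 2)%:E.
Proof.
move=> a0 mg al alE; set N := (\sum_j a j ^+ 2)%R in a0 alE *; pose s := Num.sqrt N.
have s0 : (0 < s)%R by rewrite sqrtr_gt0.
have sN : (s ^+ 2 = N)%R by rewrite sqr_sqrtr// ltW.
have al0 : (0 < al)%R by rewrite alE divr_gt0.
pose T := unit_form sigma z a.
pose g' (t : n.-tuple R) := g [tuple (y0 j + tnth t j)%R | j < n].
have mg' : measurable_fun [set: n.-tuple R] g'.
  apply: (measurableT_comp mg); apply/measurable_fun_tnthP => j.
  rewrite (_ : _ \o _ = fun t => y0 j + tnth t j)%R.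
    by apply: measurable_funD => //; exact: measurable_tnth.
  by apply/funext => t/=; rewrite tnth_mktuple.
pose th' i := (al * th i)%R.
pose Y v := noise_tuple z (cst 0%R) v.
have mY : measurable_fun [set: O] Y by exact: (measurable_noise_tuple zQ).
have mT : measurable_fun [set: O] T by exact: (measurable_unit_form zQ).
have step i : \int[Q]_v ((g [tuple (y0 j + th i * a j + z j v)%R | j < n] - th i) ^+ 2)%:E =
    \int[Q]_v ((g' (Y v) - th i) ^+ 2 * expR (th' i * T v - th' i ^+ 2 / 2))%:E.
  pose F (t : n.-tuple R) := (((g' t - th i) ^+ 2)%R)%:E.
  have mF : measurable_fun [set: n.-tuple R] F.
    by apply/measurable_EFinP; apply: measurable_funX; exact: measurable_funB.
  have F0 t : 0 <= F t by rewrite lee_fin sqr_ge0.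
  have := cameron_martin sigma0 zQ (fun j => th i * a j)%R mF F0.
  have -> : \int[Q]_v F (noise_tuple z (fun j => th i * a j)%R v) =
      \int[Q]_v ((g [tuple (y0 j + th i * a j + z j v)%R | j < n] - th i) ^+ 2)%:E.
    apply: eq_integral => v _; rewrite /F /g'; congr (((g _ - _) ^+ 2)%R)%:E.
    by apply: eq_from_tnth => j; rewrite !tnth_mktuple addrA addrAC.
  move=> ->; apply: eq_integral => v _; rewrite -EFinM; congr (_ * expR _)%:E.
  rewrite (eq_bigr (fun j => th i / sigma ^+ 2 * (a j * z j v) - (th i ^+ 2 / (2 * sigma ^+ 2)) * a j ^+ 2)%R); last first.
    by move=> j _; field; rewrite gt_eqF.
  rewrite sumrB -!mulr_sumr -/N /th' /T /unit_form alE -/N -/s -sN; field.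
  by rewrite !gt_eqF.
under eq_bigr do rewrite step.
have mexp i : measurable_fun [set: O] (fun v => expR (th' i * T v - th' i ^+ 2 / 2)).
  by apply: measurableT_comp => //; apply: measurable_funB => //; exact: measurable_funM.
have mgY i : measurable_fun [set: O] (fun v => (g' (Y v) - th i) ^+ 2)%R.
  by apply: measurable_funX; apply: measurable_funB => //; exact: (measurableT_comp mg' mY).
under eq_bigr => i _.
  rewrite -ge0_integralZl; first over.
  - by [].
  - by apply/measurable_EFinP; exact: measurable_funM.
  - by move=> v _; rewrite lee_fin mulr_ge0 ?sqr_ge0 ?expR_ge0.
  - by rewrite lee_fin.
rewrite -ge0_integral_sum//; last 2 first.
- by move=> i; apply: measurable_funeM; apply/measurable_EFinP; exact: measurable_funM.
- by move=> i v _; rewrite mule_ge0 ?lee_fin// mulr_ge0 ?sqr_ge0 ?expR_ge0.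
have bd0 x : (0 <= bayes_dens w th' x)%R by exact: bayes_dens_ge0.
have al2 : (0 <= al ^- 2)%R by rewrite invr_ge0 exprn_ge0 ?(ltW al0).
have mbd := @measurable_bayes_dens th'.
have -> : (al ^- 2)%:E * \int[lebesgue_measure]_x (bayes_dens w th' x * normal_pdf 0 1 x)%:E =
    \int[Q]_v (al ^- 2 * bayes_dens w th' (T v))%:E.
  rewrite (_ : \int[lebesgue_measure]_x _ = \int[Q]_v (bayes_dens w th' (T v))%:E); last first.
    rewrite (@unit_form_normal _ _ _ _ _ _ _ sigma0 zQ a (fun x => (bayes_dens w th' x)%:E))//.
    by exact/measurable_EFinP.
  rewrite -ge0_integralZl//.
  - by apply/measurable_EFinP; exact: (measurableT_comp mbd mT).
  - by move=> v _; rewrite lee_fin.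
apply: ge0_le_integral => //.
- by move=> v _; rewrite lee_fin mulr_ge0.
- by apply/measurable_EFinP; apply: measurable_funM => //; exact: (measurableT_comp mbd mT).
- by apply: emeasurable_sum => i; apply: measurable_funeM; apply/measurable_EFinP; exact: measurable_funM.
move=> v _; under eq_bigr do rewrite -EFinM.
rewrite sumEFin lee_fin ler_pdivrMl ?exprn_gt0//.
(* [bayes_dens_le] holds for every number [t]. The estimator may thus depend on all the data and not
   just on the sufficient statistic [T]. *)
have H : (bayes_dens w th' (T v) <= \sum_i lik w th' i (T v) * (al * g' (Y v) - th' i) ^+ 2)%R.
  exact: bayes_dens_le.
apply: (le_trans H).
rewrite mulr_sumr; apply: ler_sum => i _; rewrite /lik /th'; lra.
Qed.

End bayes_lower_bound.

(* Dalzell's integral: [22/7 - pi] is the integral of [x^4 (1-x)^4 / (1+x^2)] over [[0, 1]]. *)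
Lemma pi_le_22_7 (R : realType) : pi <= 22 / 7 :> R.
Proof.
pose p : {poly R} := (7^-1) *: 'X^7 - (2 / 3) *: 'X^6 + 'X^5 - (4 / 3) *: 'X^3 + 4 *: 'X.
pose f (x : R) := p.[x] - 4 * atan x.
have df (x : R) : is_derive x 1 f (p^`().[x] - 4 * (1 + x ^+ 2)^-1).
  have := is_derive_poly p x; have := is_derive1_atan x => ? ?.
  exact: is_deriveB.
have fc : {within `[0, 1], continuous f}.
  by apply: derivable_within_continuous => y _; have /@ex_derive := df y.
have [c _ fE] := MVT ltr01 (fun x _ => df x) fc.
have f0 : f 0 = 0 by rewrite /f /p atan0 !hornerE /=; ring.
have f1 : f 1 = 22 / 7 - pi by rewrite /f /p atan1 !hornerE /=; field.
have dE : p^`().[c] - 4 * (1 + c ^+ 2)^-1 = c ^+ 4 * (1 - c) ^+ 4 / (1 + c ^+ 2).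
  have c0 : 1 + c ^+ 2 != 0 by rewrite gt_eqF// ltr_pwDl// sqr_ge0.
  by rewrite /p !(derivB, derivD, derivZ, derivXn, derivX) !hornerE /=; field.
have : 0 <= f 1 - f 0.
  rewrite fE dE subr0 mulr1; apply: divr_ge0; last by rewrite addr_ge0 ?sqr_ge0.
  by apply: mulr_ge0; exact: exprn_even_ge0.
by rewrite f0 f1; lra.
Qed.

(* Locked, since unfolding [nval R 100000] yields a unary numeral. *)
HB.lock Definition nval (R : realType) (a : N) : R := (nat_of_bin a)%:R.

Section nval.
Context (R : realType).
Local Notation nval := (nval R).

Lemma nval_ge0 a : 0 <= nval a. Proof. by rewrite nval.unlock ler0n. Qed.
Lemma nval_gt0 a : (0 < a)%num -> 0 < nval a.
Proof. by move=> a0; rewrite nval.unlock ltr0n; lia. Qed.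
Lemma nvalD a b : nval (a + b)%num = nval a + nval b.
Proof. by rewrite nval.unlock -natrD; congr (_%:R); lia. Qed.
Lemma nvalM a b : nval (a * b)%num = nval a * nval b.
Proof. by rewrite nval.unlock -natrM; congr (_%:R); lia. Qed.
Lemma nval_of_nat n : nval (N.of_nat n) = n%:R.
Proof. by rewrite nval.unlock; congr (_%:R); lia. Qed.
Lemma nval0 : nval 0 = 0. Proof. by rewrite nval.unlock. Qed.
Lemma nval1 : nval 1 = 1. Proof. by rewrite nval.unlock. Qed.
Lemma nval_le a b : (a <= b)%num -> nval a <= nval b.
Proof. by move=> ab; rewrite nval.unlock ler_nat; lia. Qed.
Lemma nval_sub_le a b (x : R) : nval a - nval b <= x -> 0 <= x -> nval (a - b)%num <= x.
Proof.
move=> abx x0; have [ab|ab] : (a <= b)%num \/ (b <= a)%num by lia.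
  by rewrite (_ : (a - b)%num = 0%num) ?nval0//; lia.
by move: abx; rewrite -{1}(N.sub_add b a)// nvalD addrK.
Qed.
Lemma nval_div_le a b : nval (a / b)%num * nval b <= nval a.
Proof.
rewrite -nvalM; apply: nval_le; case: (N.eq_dec b 0) => [->|b0]; first by rewrite N.mul_0_r; lia.
by rewrite N.mul_comm; exact: N.Div0.mul_div_le.
Qed.
Lemma nval_shiftr_le a (k : N) : nval (N.shiftr a k) * nval (2 ^ k)%num <= nval a.
Proof. by rewrite N.shiftr_div_pow2; exact: nval_div_le. Qed.
Lemma nval_div_ge a b : nval a < (nval (a / b)%num + 1) * nval b \/ b = 0%num.
Proof.
case: (N.eq_dec b 0) => [->|b0]; [by right|left].
rewrite -nval1 -nvalD -nvalM nval.unlock ltr_nat.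
have := N.mul_succ_div_gt a b b0; rewrite -N.add_1_r N.mul_comm => H; lia.
Qed.
End nval.

(** As [pi <= 22 / 7], the square of the peak is at least [7 / 44]; what remains is the integer
    inequality [H]. *)
Lemma normal_peak1_ge (R : realType) : nval R 39885 / nval R 100000 <= normal_peak 1 :> R.
Proof.
have y0 : 0 < nval R 100000 by exact: nval_gt0.
have s0 : 0 < pi *+ 2 :> R by rewrite mulrn_wgt0 ?pi_gt0.
have -> : normal_peak 1 = (Num.sqrt (pi *+ 2))^-1 :> R by rewrite /normal_peak expr1n mul1r.
rewrite ler_pdivrMr// [leRHS]mulrC ler_pdivlMr ?sqrtr_gt0//.
have H : nval R (39885 * 39885 * 44)%num <= nval R (7 * (100000 * 100000))%num by exact: nval_le.
have e44 : nval R 44 = 44 by rewrite nval.unlock.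
have e7 : nval R 7 = 7 by rewrite nval.unlock.
have := nval_ge0 R 39885; move: H y0; rewrite !nvalM e44 e7.
move: (nval R 39885) (nval R 100000) => x y H y0 x0.
rewrite -ler_sqr ?nnegrE ?mulr_ge0 ?sqrtr_ge0 ?(ltW y0)// exprMn sqr_sqrtr ?(ltW s0)//.
have := ler_wpM2l (sqr_ge0 x) (pi_le_22_7 R).
by move: H; rewrite -!expr2 -mulr_natr; lra.
Qed.

(** * Integer arithmetic for the table of priors *)

Local Open Scope N_scope.
Arguments N.shiftr : simpl never.
Arguments N.mul : simpl never.
Arguments N.add : simpl never.
Arguments N.sub : simpl never.
Arguments N.div : simpl never.
(** Fixed-point repeated squaring in units of [2^-40], towards the power [2 ^ n]; truncation keeps
    it a lower bound. *)
Fixpoint sq_iter (n : nat) (a : N) : N :=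
  match n with O => a | S n' => sq_iter n' (N.shiftr (a * a) 40) end.
(** The exponents [(2 j + 1) ^ 2] have constant second difference 8. Each weight is therefore the
    previous one times a ratio [r], itself multiplied by [b] at each step, and a single exponential
    generates the table. *)
Fixpoint gauss_tab (n : nat) (b g r : N) : seq N :=
  match n with
  | O => [::]
  | S n' => N.shiftr g 16 :: gauss_tab n' b (N.shiftr (g * r) 40) (N.shiftr (r * b) 40)
  end.
(* [gauss_base K] and the entries of [gauss_table K n] are lower bounds for
   [exp (- 1 / (8 K^2))] in units of [2^-40] and for the Gaussian weights
   [exp (- ((j + 1/2) / K)^2 / 2)] in units of [2^-24]. *)
Definition gauss_base (K : N) : N :=
  sq_iter 12 (2 ^ 40 - (N.shiftr (2 ^ 40) 12 / (8 * K * K) + 1)).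
Definition gauss_table (K : N) (n : nat) : seq N :=
  let a := gauss_base K in let b := sq_iter 3 a in gauss_tab n b a b.
(** Atoms sit at integers and cell midpoints at half-integers in grid units, so the distance from
    [d] to [k + 1/2] is [j + 1/2] for the index [j] looked up, and one table serves all atoms. *)
Fixpoint moments (G : seq N) (k : nat) (pts : seq (nat * N)) : N * N * N :=
  match pts with
  | [::] => (0, 0, 0)
  | (_, 0) :: p => moments G k p
  | (d, w) :: p => let '(s0, s1, s2) := moments G k p in
      let g := w * nth 0 G (if leq d k then subn k d else subn d k.+1) in
      let h := g * N.of_nat d in
      (s0 + g, s1 + h, s2 + h * N.of_nat d)
  end.
(* Up to scaling, posterior variance times marginal density at [(k + 1/2) / K], for the atoms
   [d / K] with weights [w] listed in [pts]. *)
Definition cell (G : seq N) (k : nat) (pts : seq (nat * N)) : N :=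
  let '(s0, s1, s2) := moments G k pts in (s2 * s0 - s1 * s1) / s0.
Fixpoint cell_sum (G : seq N) (n k : nat) (pts : seq (nat * N)) : N :=
  match n with O => 0 | S n' => cell G k pts + cell_sum G n' k.+1 pts end.
Record prior_conf := PriorConf { pK : N; pM : nat; pa : nat; wout : N; winn : N; wmid : N;
  pcells : nat; ptop : N }.
(** Positions are translated by [pM] to make them natural numbers; the centre of symmetry is at
    [pM], where [prior_check] starts its cells. *)
Definition conf_pts (c : prior_conf) : seq (nat * N) :=
  let M := pM c in
  [:: (0%nat, wout c); (subn M (pa c), winn c); (M, wmid c); (addn M (pa c), winn c); (addn M M, wout c)].
Definition conf_weight (c : prior_conf) : N := 2 * wout c + 2 * winn c + wmid c.
(* The midpoint rule with step [1 / K] certifies that the Bayes risk is at least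
   [4/5 * num/den]; [0.39885] is a lower bound for [1 / sqrt (2 pi)]. *)
Definition prior_check (c : prior_conf) (num den : N) : bool :=
  let K := pK c in let M := N.of_nat (pM c) in
  let G := gauss_table K (addn (pcells c) (addn (pM c) (pM c))) in
  let K2 := K * K in let K4 := K2 * K2 in
  [&& 0 <? K, leq (pa c) (pM c), 0 <? conf_weight c &
   4 * num * (100000 * (8 * (K4 * K2 * K)) * (2 ^ 24 * conf_weight c)) <=?
   2 * 39885 * (8 * K4 - (K2 + M * M)) * cell_sum G (pcells c) (pM c) (conf_pts c) * 5 * den].
(** Each prior must fit in the radius [cur / 10^4] at the left end of its range, while its risk is
    compared with the target at the right end, where [b ^ 2 / (1 + b ^ 2)] is largest. For the
    unbounded last range the target is the supremum 1. *)
Fixpoint prior_chain (cur : N) (l : seq prior_conf) : bool :=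
  match l with
  | [::] => false
  | c :: l' => (N.of_nat (pM c) * 10000 <=? cur * pK c) &&
     let t := ptop c in
     if t =? 0 then prior_check c 1 1
     else prior_check c (t * t) (100000000 + t * t) && prior_chain t l'
  end.
Local Close Scope N_scope.

(** * Soundness of the integer computation *)

Section table_spec.
Context (R : realType).
Local Notation v := (@nval R).
Let p40 : R := v (2 ^ 40)%num.
Let p16 : R := v (2 ^ 16)%num.
Let p24 : R := v (2 ^ 24)%num.
Let p40E : p40 = p16 * p24. Proof. by rewrite /p40 /p16 /p24 -nvalM. Qed.
Let p40_gt0 : 0 < p40. Proof. exact: nval_gt0. Qed.
Let p16_gt0 : 0 < p16. Proof. exact: nval_gt0. Qed.

Lemma mul_shiftr_le a b (x y : R) : v a <= p40 * x -> v b <= p40 * y -> 0 <= x ->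
  v (N.shiftr (a * b) 40) <= p40 * (x * y).
Proof.
move=> ax b_y x0; rewrite -(ler_pM2r p40_gt0); apply: (le_trans (nval_shiftr_le _ _ _)).
rewrite nvalM (_ : _ * _ * _ = (p40 * x) * (p40 * y)); last by ring.
by apply: ler_pM => //; exact: nval_ge0.
Qed.

Lemma sq_iter_le n a (x : R) : v a <= p40 * x -> 0 <= x -> v (sq_iter n a) <= p40 * x ^+ (2 ^ n).
Proof.
elim: n a x => [|n IH] a x ax x0 /=; first by rewrite expn0 expr1.
rewrite expnS exprM; apply: IH; last by rewrite exprn_ge0.
by rewrite expr2; exact: mul_shiftr_le.
Qed.

Variable K : N.
Hypothesis K0 : (0 < K)%num.
Let q : R := (8 * v K ^+ 2)^-1.
Let vK0 : 0 < v K. Proof. exact: nval_gt0. Qed.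
Let q0 : 0 < q. Proof. by rewrite invr_gt0 mulr_gt0 ?exprn_gt0. Qed.

Lemma gauss_base_le : v (gauss_base K) <= p40 * expR (- q).
Proof.
(* Division by [2 ^ 12] brings the exponent so near 0 that the tangent line is an accurate lower
   bound; twelve squarings undo it. *)
have E : expR (- q) = expR (- q / 2 ^+ 12) ^+ (2 ^ 12).
  by rewrite -expRM_natl natrX; congr expR; field.
rewrite E; apply: sq_iter_le; last exact: expR_ge0.
apply: nval_sub_le; last by rewrite mulr_ge0 ?expR_ge0 ?ltW.
have [H|] := nval_div_ge R (N.shiftr (2 ^ 40) 12) (8 * K * K)%num; last by lia.
have H2 : p40 * (1 - q / 2 ^+ 12) <= p40 * expR (- q / 2 ^+ 12).
  by rewrite ler_pM2l//; have := expR_ge1Dx (- q / 2 ^+ 12); lra.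
apply: le_trans H2; rewrite nvalD mulrBr mulr1 lerB//.
have -> : p40 * (q / 2 ^+ 12) = v (N.shiftr (2 ^ 40) 12) / v (8 * K * K)%num.
  rewrite (_ : p40 = v (N.shiftr (2 ^ 40) 12) * 2 ^+ 12); last first.
    have -> : 2 ^+ 12 = v 4096 by rewrite nval.unlock -natrX; congr (_%:R).
    by rewrite -nvalM; congr v.
  rewrite /q !nvalM (_ : v 8%num = 8); last by rewrite nval.unlock.
  by field; rewrite gt_eqF.
rewrite nval1 ler_pdivrMr; first exact: ltW.
by rewrite !nvalM !mulr_gt0//; exact: nval_gt0.
Qed.

Let E (m : nat) : R := expR (- ((2 * m + 1)%:R ^+ 2 * q)).

Lemma gauss_tab_le n b g r m j :
  v b <= p40 * expR (- (8 * q)) -> v g <= p40 * E m ->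
  v r <= p40 * expR (- (8 * (m + 1)%:R * q)) ->
  v (nth 0%num (gauss_tab n b g r) j) <= p24 * E (m + j).
Proof.
elim: n b g r m j => [|n IH] b g r m j bb gg rr.
  by rewrite [nth _ _ _]nth_nil nval0 mulr_ge0 ?expR_ge0//; exact: nval_ge0.
case: j => [|j]; rewrite /=.
  rewrite addn0 -(ler_pM2r p16_gt0); apply: (le_trans (nval_shiftr_le _ _ _)).
  by apply: (le_trans gg); rewrite p40E; lra.
rewrite addnS -addSn; apply: IH => //.
- have := mul_shiftr_le gg rr (expR_ge0 _); rewrite /E -expRD => H.
  by apply: (le_trans H); rewrite ler_pM2l// ler_expR !natrD !natrM -natr1; lra.
- have := mul_shiftr_le rr bb (expR_ge0 _); rewrite -expRD => H.
  by apply: (le_trans H); rewrite ler_pM2l// ler_expR !natrD -natr1; lra.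
Qed.

Lemma gauss_table_le n j : v (nth 0%num (gauss_table K n) j) <= p24 * E j.
Proof.
have base := gauss_base_le.
have b3 : v (sq_iter 3 (gauss_base K)) <= p40 * expR (- (8 * q)).
  have := sq_iter_le 3 base (expR_ge0 _); rewrite -expRM_natl (_ : (2 ^ 3)%:R * - q = - (8 * q))//.
  by rewrite (_ : (2 ^ 3)%N = 8%N)// mulrN.
rewrite -[j]add0n; apply: gauss_tab_le => //.
  by rewrite /E expr1n mul1r.
by rewrite mulr1.
Qed.

(** A variance contains a subtraction, so rounding moments down looks unsafe. But it is also the
    minimum over [t] of a weighted sum of squares, which is monotone in the weights; hence the bound
    is stated for every [t]. *)
Lemma cell_le n k pts (t : R) : v (cell (gauss_table K n) k pts) <=
  p24 * \sum_(p <- pts) v p.2 * expR (- ((k%:R + 1 / 2 - p.1%:R) / v K) ^+ 2 / 2) * (t - p.1%:R) ^+ 2.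
Proof.
set G := gauss_table K n.
suff H : let '(s0, s1, s2) := moments G k pts in v s0 * t ^+ 2 - v s1 * t *+ 2 + v s2 <=
    p24 * \sum_(p <- pts) v p.2 * expR (- ((k%:R + 1 / 2 - p.1%:R) / v K) ^+ 2 / 2) * (t - p.1%:R) ^+ 2.
  move: H; rewrite /cell; case: (moments G k pts) => -[s0 s1] s2; set B := p24 * _ => H.
  have B0 : 0 <= B.
    rewrite mulr_ge0 ?nval_ge0// sumr_ge0// => p _.
    by apply: mulr_ge0; [apply: mulr_ge0; [exact: nval_ge0|exact: expR_ge0]|exact: sqr_ge0].
  have [->|s0_gt0] : s0 = 0%num \/ (0 < s0)%num by lia.
    by rewrite (_ : (_ / 0)%num = 0%num) ?nval0//; case: (_ - _)%num.
  have vs0 := nval_gt0 R s0_gt0.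
  rewrite -(ler_pM2r vs0); apply: (le_trans (nval_div_le _ _ _)).
  apply: nval_sub_le; last by rewrite mulr_ge0 ?nval_ge0.
  rewrite !nvalM; have := ler_wpM2r (nval_ge0 R s0) H.
  by have := sqr_ge0 (v s0 * t - v s1); lra.
elim: pts => [|[d [|w]] pts IH]/=.
- by rewrite big_nil nval0; lra.
- by rewrite big_cons/= nval0 !mul0r add0r; exact: IH.
move: IH; case: (moments G k pts) => -[s0 s1] s2 IH.
rewrite big_cons/= mulrDr !nvalD !nvalM nval_of_nat.
have -> : - ((k%:R + 1 / 2 - d%:R) / v K) ^+ 2 / 2 =
    - ((2 * (if (d <= k)%N then (k - d)%N else (d - k.+1)%N) + 1)%:R ^+ 2 * q).
  rewrite expr_div_n; have -> : (k%:R + 1 / 2 - d%:R) ^+ 2 =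
      ((2 * (if (d <= k)%N then (k - d)%N else (d - k.+1)%N) + 1)%:R / 2 : R) ^+ 2.
    case: leqP => dk; rewrite natrD natrM natrB//; first by field.
    by rewrite -[k.+1]addn1 natrD; field.
  by rewrite /q; field; rewrite gt_eqF.
set j := (if _ then _ else _); rewrite -/(E j).
have := gauss_table_le n j; rewrite -/G; move: (nth _ _ _) => g gE.
have := ler_wpM2r (sqr_ge0 (t - d%:R)) (ler_wpM2l (nval_ge0 R (N.pos w)) gE).
by move: IH; set A := \sum_(_ <- _) _; lra.
Qed.

End table_spec.

Section prior_spec.
Context (R : realType).
Local Notation v := (@nval R).
Variables (c : prior_conf).
Let K := v (pK c).
Let M : R := (pM c)%:R.
Let W := v (conf_weight c).
Definition conf_w (i : 'I_5) : R := v (nth (0%nat, 0%num) (conf_pts c) i).2 / W.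
Definition conf_th (i : 'I_5) : R := ((nth (0%nat, 0%num) (conf_pts c) i).1%:R - M) / K.

Hypothesis K0 : (0 < pK c)%num.
Hypothesis W0 : (0 < conf_weight c)%num.
Hypothesis aM : (pa c <= pM c)%N.
Let vK0 : 0 < K. Proof. exact: nval_gt0. Qed.
Let vW0 : 0 < W. Proof. exact: nval_gt0. Qed.

Lemma conf_w_ge0 i : 0 <= conf_w i.
Proof. by rewrite divr_ge0 ?nval_ge0// ltW. Qed.

Lemma conf_w_sum1 : \sum_i conf_w i = 1.
Proof.
rewrite /conf_w -mulr_suml !big_ord_recl big_ord0/= -nval0 -!nvalD.
rewrite (_ : (wout c + _)%num = conf_weight c) ?divff// ?gt_eqF// /conf_weight.
by lia.
Qed.

Lemma conf_th_le i : `|conf_th i| <= M / K.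
Proof.
rewrite normrM normfV (gtr0_norm vK0) ler_pM2r ?invr_gt0// ler_norml.
suff [k0 k1] : 0 <= (nth (0%nat, 0%num) (conf_pts c) i).1%:R :> R /\
   (nth (0%nat, 0%num) (conf_pts c) i).1%:R <= M *+ 2 by lra.
split; first exact: ler0n.
rewrite /M -mulrnA ler_nat muln2 -addnn.
by case: i => -[|[|[|[|[|//]]]]] _/=; lia.
Qed.

Let conf_rev i : (conf_w (rev_ord i) = conf_w i) * (conf_th (rev_ord i) = - conf_th i).
Proof.
rewrite /conf_w /conf_th /M.
case: i => -[|[|[|[|[|//]]]]] _/=; split => //=; rewrite ?natrB ?natrD//; field; rewrite gt_eqF//.
Qed.

Lemma conf_gauss_densN x : gauss_dens conf_w conf_th (- x) = gauss_dens conf_w conf_th x.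
Proof.
have pm k : pmom conf_w conf_th k (- x) = (-1) ^+ k * pmom conf_w conf_th k x.
  rewrite /pmom (reindex_inj rev_ord_inj)/= mulr_sumr; apply: eq_bigr => i _.
  have -> : lik conf_w conf_th (rev_ord i) (- x) = lik conf_w conf_th i x.
    by rewrite /lik !conf_rev mulrNN sqrrN.
  by rewrite conf_rev (exprNn (conf_th i) k) mulrCA.
rewrite /gauss_dens /bayes_dens sqrrN !pm expr0 mul1r; congr (_ * _); ring.
Qed.

(** [cell_le] is applied with [t] the posterior mean in grid units, at which the weighted sum of
    squares equals [bayes_dens]. *)
Lemma conf_cell_le n k : v (cell (gauss_table (pK c) n) k (conf_pts c)) <=
  v (2 ^ 24)%num * (W * K ^+ 2) * gauss_dens conf_w conf_th ((k%:R + 1 / 2 - M) / K).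
Proof.
set x := (_ / K); have [T TE] : exists T, T = pmom conf_w conf_th 1 x / pmom conf_w conf_th 0 x by exists (pmom conf_w conf_th 1 x / pmom conf_w conf_th 0 x).
apply: le_trans (cell_le K0 _ _ _ (T * K + M)) _.
rewrite -!mulrA ler_pM2l; last exact: nval_gt0.
rewrite (big_nth (0%nat, 0%num)) big_mkord /gauss_dens bayes_densE; last first.
- by rewrite conf_w_sum1.
- exact: conf_w_ge0.
rewrite !mulr_sumr ler_sum// => i _; rewrite -TE /lik.
set p := nth _ _ _; rewrite le_eqVlt; apply/orP; left; apply/eqP.
have -> : conf_w i = v p.2 / W by [].
have -> : conf_th i = (p.1%:R - M) / K by [].
have -> : - ((k%:R + 1 / 2 - p.1%:R) / v (pK c)) ^+ 2 / 2 =
   - x ^+ 2 / 2 + ((p.1%:R - M) / K * x - ((p.1%:R - M) / K) ^+ 2 / 2).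
  by rewrite /x -/K; field; rewrite gt_eqF.
rewrite expRD; move: (expR _) (expR _) => e1 e2; field; rewrite ?gt_eqF//.
Qed.

Lemma cell_sumE G n k pts : v (cell_sum G n k pts) = \sum_(i < n) v (cell G (k + i) pts).
Proof.
elim: n k => [|n IH] k; first by rewrite big_ord0 nval0.
by rewrite [LHS]nvalD IH big_ord_recl addn0; congr (_ + _); apply: eq_bigr => i _; rewrite addSnnS.
Qed.

Lemma conf_risk_ge n N : N = pcells c ->
  ((normal_peak 1 * (2 * (1 - (1 + (M / K) ^+ 2) / (8 * K ^+ 2)) *
     v (cell_sum (gauss_table (pK c) n) N (pM c) (conf_pts c)) /
     (v (2 ^ 24)%num * W * K ^+ 3)))%:E <= (\int[lebesgue_measure]_x (bayes_dens conf_w conf_th x * normal_pdf 0 1 x)%:E)%E)%E.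
Proof.
move=> NE; set kap := 1 - _; pose D := v (2 ^ 24)%num * (W * K ^+ 2).
have D0 : 0 < D by rewrite mulr_gt0 ?nval_gt0// mulr_gt0 ?exprn_gt0.
pose G := gauss_table (pK c) n.
have F0 x : 0 <= gauss_dens conf_w conf_th x.
  by rewrite mulr_ge0 ?expR_ge0// bayes_dens_ge0 ?conf_w_sum1//; exact: conf_w_ge0.
have mF : measurable_fun [set: R] (gauss_dens conf_w conf_th).
  apply: measurable_funM; last first.
    by apply: measurable_bayes_dens; [exact: conf_w_ge0|rewrite conf_w_sum1].
  by apply: measurableT_comp => //; apply: measurable_funM => //; apply: measurableT_comp => //; exact: measurable_funX.
(* The [N + N] cells lie on both sides of the origin while only the right half is tabulated; [ref]
   sends a left cell to its mirror image. *)
pose ref (i : nat) := if (i < N)%N then (N - i.+1)%N else (i - N)%N.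
(* [kap] is the tangent bound for the loss factor of [gauss_dens_midpoint] at [u = 1 / (2 K)]. It is
   cut at 0 since the midpoint rule takes nonnegative values. *)
pose k (i : nat) := Num.max kap 0 * (v (cell G (pM c + ref i) (conf_pts c)) / D).
have k0 i : 0 <= k i.
  by rewrite mulr_ge0 ?le_max ?lexx ?orbT// divr_ge0 ?nval_ge0// ltW.
have thM i : `|conf_th i| <= M / K by exact: conf_th_le.
have := @midpoint_rule R (gauss_dens conf_w conf_th) (- (N%:R / K)) K^-1 (N + N) k.
rewrite invr_gt0 => /(_ vK0 k0 mF F0) H.
apply: (@le_trans _ _ ((normal_peak 1)%:E * (\sum_(i < N + N) K^-1 * k i)%:E)%E); last first.
  under eq_integral do rewrite normal_pdf01 mulrCA EFinM.
  rewrite ge0_integralZl//.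
  - rewrite lee_wpmul2l// ?lee_fin ?normal_peak_ge0//.
    under eq_integral do rewrite mulrC -/(gauss_dens _ _ _).
    apply: H => i u iN uK; set m := _ + _ * K^-1.
    have km : k i <= Num.max kap 0 * gauss_dens conf_w conf_th m.
      rewrite ler_wpM2l ?le_max ?lexx ?orbT// ler_pdivrMr// mulrC.
      apply: (le_trans (conf_cell_le _ _)); rewrite -/D ler_pM2l//.
      rewrite /ref; case: ltnP => iN'.
        rewrite (_ : _ / K = - m) ?conf_gauss_densN// /m natrD natrB// -natr1.
        by rewrite -/M; field; rewrite gt_eqF.
      rewrite (_ : _ / K = m)// /m natrD natrB//.
      by rewrite -/M; field; rewrite gt_eqF.
    have := @gauss_dens_midpoint _ _ conf_w conf_th conf_w_ge0 _ (M / K) m u thM.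
    rewrite conf_w_sum1 => /(_ ltr01); apply: le_trans.
    rewrite ler_pMn2r// (le_trans km)// mulrC ler_wpM2l//.
    rewrite ge_max expR_ge0 andbT.
    apply: le_trans (expR_ge1Dx _); rewrite /kap lerD2l lerN2.
    have u2 : u ^+ 2 <= (K^-1 / 2) ^+ 2.
      by rewrite -(real_normK (num_real u)) ler_pXn2r ?nnegrE ?divr_ge0 ?invr_ge0 ?(ltW vK0) ?(ltW uK).
    have P0 : 0 <= (1 + (M / K) ^+ 2) / 2 by rewrite divr_ge0 ?addr_ge0 ?sqr_ge0.
    have := ler_wpM2l P0 u2; rewrite [leRHS](_ : _ = (1 + (M / K) ^+ 2) / (8 * K ^+ 2)); first by lra.
    by field; rewrite gt_eqF.
  - apply/measurable_EFinP; rewrite (_ : (fun x => _) = gauss_dens conf_w conf_th)//.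
    by apply/funext => x; rewrite mulrC.
  - by move=> x _; rewrite lee_fin mulrC; exact: F0.
  - by rewrite lee_fin normal_peak_ge0.
rewrite -EFinM lee_fin ler_pM2l ?normal_peak_gt0//.
rewrite -mulr_sumr -mulr_sumr -mulr_suml big_split_ord/=.
rewrite [X in X + _](_ : _ = v (cell_sum G N (pM c) (conf_pts c))); last first.
  rewrite cell_sumE [LHS](reindex_inj rev_ord_inj)/=; apply: eq_bigr => i _.
  by rewrite /ref ltn_subrL/= (leq_ltn_trans _ (ltn_ord i))// subnSK// subKn// ltnW.
rewrite [X in _ + X](_ : _ = v (cell_sum G N (pM c) (conf_pts c))); last first.
  rewrite cell_sumE; apply: eq_bigr => i _.
  by rewrite /ref ltnNge leq_addr/= addKn.
set S := v _; have S0 : 0 <= S by exact: nval_ge0.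
rewrite [leLHS](_ : _ = kap * (2 * S / (K * D))); last by rewrite /D; field; rewrite !gt_eqF// nval_gt0.
rewrite [leRHS](_ : _ = Num.max kap 0 * (2 * S / (K * D))); last by field; rewrite !gt_eqF.
apply: ler_wpM2r; last by rewrite le_max lexx.
by apply: divr_ge0; apply: mulr_ge0 => //; exact: ltW.
Qed.

End prior_spec.

Local Notation lam_risk w th :=
  (\int[lebesgue_measure]_x (bayes_dens w th x * normal_pdf 0 1 x)%:E)%E.

Lemma prior_check_sound (R : realType) (c : prior_conf) (num den : N) (b : R) :
  prior_check c num den -> (0 < den)%num -> 0 < b -> (pM c)%:R / nval R (pK c) <= b ->
  b ^+ 2 / (1 + b ^+ 2) <= nval R num / nval R den ->
  exists w th : 'I_5 -> R, [/\ forall i, 0 <= w i, \sum_i w i = 1, forall i, `|th i| <= b &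
    ((4 / 5 * (b ^+ 2 / (1 + b ^+ 2)))%:E <= lam_risk w th)%E].
Proof.
case/and4P => /N.ltb_lt K0 aM /N.ltb_lt W0 /N.leb_le H den0 b0 Mb bt.
exists (@conf_w R c), (@conf_th R c); split.
- by move=> i; exact: conf_w_ge0.
- exact: conf_w_sum1.
- by move=> i; apply: le_trans Mb; exact: conf_th_le.
set n := (pcells c + _)%N in H.
apply: le_trans (conf_risk_ge R K0 W0 aM n erefl).
rewrite lee_fin; have := nval_le R H; rewrite !nvalM => {}H.
set S := nval R (cell_sum _ _ _ _) in H *; have S0 : 0 <= S by exact: nval_ge0.
have K1 := nval_gt0 R K0; have W1 := nval_gt0 R W0; have d1 := nval_gt0 R den0.
have Y1 : 0 < nval R 100000 by exact: nval_gt0.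
have p24 : 0 < nval R (2 ^ 24)%num by exact: nval_gt0.
have num0 : 0 < nval R num.
  have : 0 < nval R num / nval R den.
    by apply: lt_le_trans bt; rewrite divr_gt0 ?exprn_gt0// ltr_pwDl ?sqr_ge0.
  by rewrite pmulr_lgt0 ?invr_gt0.
set T := nval R (_ - _) in H.
have e (m : N) (k : nat) : nat_of_bin m = k -> nval R m = k%:R by move=> <-; rewrite nval.unlock.
(* Subtraction in [N] truncates at 0. The check cannot succeed with [T = 0], so [T] is the true
   difference, as [TE] records. *)
have T0 : 0 < T.
  rewrite lt0r nval_ge0 andbT; apply/eqP => TE; move: H; rewrite TE !(mulr0, mul0r) leNgt => /negP; apply.
  by rewrite (e 4%num 4%N)// (e 8%num 8%N)// !mulr_gt0.
have TE : T = 8 * nval R (pK c) ^+ 4 - (nval R (pK c) ^+ 2 + (pM c)%:R ^+ 2).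
  have le : (pK c * pK c + N.of_nat (pM c) * N.of_nat (pM c) <= 8 * (pK c * pK c * (pK c * pK c)))%num.
    have [//|lt] := N.le_gt_cases (pK c * pK c + N.of_nat (pM c) * N.of_nat (pM c))
      (8 * (pK c * pK c * (pK c * pK c)))%num.
    by move: T0; rewrite /T (proj2 (N.sub_0_le _ _)) ?nval0 ?ltxx//; exact: N.lt_le_incl.
  rewrite /T; have := nvalD R (8 * (pK c * pK c * (pK c * pK c)) - (pK c * pK c + N.of_nat (pM c) * N.of_nat (pM c)))%num
     (pK c * pK c + N.of_nat (pM c) * N.of_nat (pM c))%num.
  rewrite N.sub_add// nvalD !nvalM nval_of_nat (e 8%num 8%N)// => E.
  by apply/eqP; rewrite -subr_eq0 -[eqbRHS](subrr (nval R (8 * (pK c * pK c * (pK c * pK c)) -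
     (pK c * pK c + N.of_nat (pM c) * N.of_nat (pM c)))%num)); apply/eqP; lra.
move: H; rewrite (e 4%num 4%N)// (e 8%num 8%N)// (e 2%num 2%N)// (e 5%num 5%N)// => H.
set K := nval R (pK c) in K1 TE H *; set W := nval R (conf_weight c) in W1 H *.
have num_le : 4 / 5 * (nval R num / nval R den) <=
    nval R 39885 / nval R 100000 * (2 * (T / (8 * K ^+ 4)) * S / (nval R (2 ^ 24)%num * W * K ^+ 3)).
  rewrite [leRHS](_ : _ = (2 * nval R 39885 * T * S) /
    (nval R 100000 * (8 * (K * K * (K * K) * (K * K) * K)) * (nval R (2 ^ 24)%num * W))); last first.
    by field; rewrite !gt_eqF.
  rewrite [leLHS](_ : _ = (4 * nval R num) / (5 * nval R den)); last by field; rewrite gt_eqF.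
  rewrite ler_pdivlMr ?mulr_gt0// mulrAC ler_pdivrMr ?mulr_gt0//.
  by apply: le_trans H _; rewrite le_eqVlt; apply/orP; left; apply/eqP; ring.
apply: (@le_trans _ _ (4 / 5 * (nval R num / nval R den))); first by rewrite ler_pM2l ?divr_gt0.
apply: (le_trans num_le).
rewrite [X in _ <= _ * (2 * X * _ / _)](_ : _ = T / (8 * K ^+ 4)); last by rewrite TE; field; rewrite gt_eqF.
apply: ler_wpM2r; last exact: normal_peak1_ge.
apply: divr_ge0; last by apply: ltW; rewrite !mulr_gt0 ?exprn_gt0.
by apply: mulr_ge0 => //; apply: ltW; rewrite mulr_gt0// divr_gt0// mulr_gt0// exprn_gt0.
Qed.

Lemma prior_chain_sound (R : realType) (l : seq prior_conf) (cur : N) (b : R) :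
  prior_chain cur l -> (0 < cur)%num -> nval R cur / nval R 10000 <= b ->
  exists w th : 'I_5 -> R, [/\ forall i, 0 <= w i, \sum_i w i = 1, forall i, `|th i| <= b &
    ((4 / 5 * (b ^+ 2 / (1 + b ^+ 2)))%:E <= lam_risk w th)%E].
Proof.
elim: l cur => [//|c l IH] cur /= /andP[/N.leb_le Mcur H] cur0 curb.
have y0 : 0 < nval R 10000 by exact: nval_gt0.
have b0 : 0 < b by apply: lt_le_trans curb; rewrite divr_gt0// nval_gt0.
have Mb : (0 < pK c)%num -> (pM c)%:R / nval R (pK c) <= b.
  move=> K0; apply: le_trans curb; rewrite ler_pdivrMr ?nval_gt0// mulrAC ler_pdivlMr//.
  by have := nval_le R Mcur; rewrite !nvalM nval_of_nat.
have b2 : 0 < 1 + b ^+ 2 by rewrite ltr_pwDl// sqr_ge0.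
move: H; case: (N.eqb_spec (ptop c) 0) => [_|t0].
  move=> H; have K0 : (0 < pK c)%num by case/and4P: H => /N.ltb_lt.
  apply: (prior_check_sound H) => //; first exact: Mb.
  by rewrite nval1 divr1 ler_pdivrMr// mul1r lerDr.
case/andP => H Hl; have K0 : (0 < pK c)%num by case/and4P: H => /N.ltb_lt.
have t1 : (0 < ptop c)%num by lia.
have [tb|/ltW bt] := lerP (nval R (ptop c) / nval R 10000) b; first exact: (IH _ Hl).
apply: (prior_check_sound H) => //; [by lia|exact: Mb|].
have vt := nval_gt0 R t1.
have e8 : nval R 100000000 = nval R 10000 ^+ 2 by rewrite expr2 -nvalM.
rewrite nvalD nvalM e8.
have d0 : 0 < nval R 10000 ^+ 2 + nval R (ptop c) * nval R (ptop c).
  by rewrite addr_gt0 ?mulr_gt0 ?exprn_gt0.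
rewrite ler_pdivrMr// mulrAC ler_pdivlMr//.
move: bt; rewrite ler_pdivlMr// => bt.
have : (b * nval R 10000) ^+ 2 <= nval R (ptop c) ^+ 2.
  by rewrite ler_pXn2r ?nnegrE ?(ltW vt)// mulr_ge0 ?ltW.
by rewrite exprMn; lra.
Qed.

Local Open Scope N_scope.
(* Symmetric priors on the grid [{-M, .., M} / K], found by numerical
   optimisation; the last field is [10^4] times the right end of the range of
   bounds [b] that the prior serves, [0] standing for infinity. *)
Definition priors : seq prior_conf :=
  [:: PriorConf 47 42 0 500 0 0 197 10370;
      PriorConf 55 57 0 500 0 0 231 11581;
      PriorConf 38 44 0 444 0 112 159 12346;
      PriorConf 47 58 0 416 0 168 197 12879;
      PriorConf 42 54 0 398 0 204 176 13265;
      PriorConf 46 61 0 386 0 228 193 13581;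
      PriorConf 42 57 0 376 0 248 176 13833;
      PriorConf 47 65 0 368 0 264 197 14049;
      PriorConf 42 59 0 364 0 272 176 14234;
      PriorConf 52 74 0 360 0 280 218 14393;
      PriorConf 41 59 0 356 0 288 172 14534;
      PriorConf 53 77 0 354 0 292 222 14658;
      PriorConf 43 63 0 350 0 300 180 14768;
      PriorConf 42 62 0 350 0 300 176 14869;
      PriorConf 37 55 0 346 0 308 155 14962;
      PriorConf 55 82 0 346 0 308 231 15006;
      PriorConf 48 72 0 344 0 312 201 15091;
      PriorConf 55 83 0 344 0 312 231 15176;
      PriorConf 29 44 0 340 0 320 121 15245;
      PriorConf 42 64 0 340 0 320 176 15315;
      PriorConf 32 49 0 338 0 324 134 15381;
      PriorConf 54 83 0 338 0 324 226 15441;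
      PriorConf 46 71 0 336 0 328 193 15504;
      PriorConf 40 62 0 336 0 328 168 15566;
      PriorConf 54 84 0 334 0 332 226 15621;
      PriorConf 41 64 0 334 0 332 172 15674;
      PriorConf 30 47 0 332 0 336 126 15724;
      PriorConf 42 66 0 332 0 336 176 15777;
      PriorConf 52 82 0 332 0 336 218 15832;
      PriorConf 55 87 0 330 0 340 231 15881;
      PriorConf 46 73 0 330 0 340 193 15931;
      PriorConf 54 86 0 330 0 340 226 15987;
      PriorConf 52 83 0 328 0 344 218 16024;
      PriorConf 50 80 0 328 0 344 210 16064;
      PriorConf 33 53 0 326 0 348 138 16118;
      PriorConf 54 87 0 326 0 348 226 16174;
      PriorConf 47 76 0 326 0 348 197 16236;
      PriorConf 53 86 0 324 0 352 222 16293;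
      PriorConf 35 57 0 324 0 352 147 16348;
      PriorConf 52 85 0 322 0 356 218 16415;
      PriorConf 39 64 0 322 0 356 163 16479;
      PriorConf 51 84 0 322 0 356 214 16544;
      PriorConf 52 86 0 320 0 360 218 16614;
      PriorConf 53 88 0 320 0 360 222 16682;
      PriorConf 51 85 0 318 0 364 214 16749;
      PriorConf 43 72 0 318 0 364 180 16828;
      PriorConf 44 74 0 318 0 364 184 16907;
      PriorConf 42 71 0 316 0 368 176 16998;
      PriorConf 53 90 0 316 0 368 222 17080;
      PriorConf 41 70 0 314 0 372 172 17177;
      PriorConf 46 79 0 312 0 376 193 17286;
      PriorConf 55 95 0 312 0 376 231 17393;
      PriorConf 46 80 0 310 0 380 193 17520;
      PriorConf 44 77 0 310 0 380 184 17638;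
      PriorConf 55 97 0 308 0 384 231 17788;
      PriorConf 54 96 0 306 0 388 226 17940;
      PriorConf 53 95 0 306 0 388 222 18102;
      PriorConf 42 76 0 302 0 396 176 18287;
      PriorConf 35 64 0 302 0 396 147 18491;
      PriorConf 53 98 0 300 0 400 222 18725;
      PriorConf 47 88 0 298 0 404 197 18982;
      PriorConf 49 93 0 296 0 408 205 19260;
      PriorConf 54 104 0 294 0 412 226 19565;
      PriorConf 45 88 0 292 0 416 189 19881;
      PriorConf 55 109 0 290 0 420 231 20163;
      PriorConf 51 102 0 290 0 420 214 20352;
      PriorConf 29 59 0 288 0 424 121 20673;
      PriorConf 45 93 0 286 0 428 189 21008;
      PriorConf 50 105 0 284 0 432 210 21322;
      PriorConf 53 113 0 284 0 432 222 21598;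
      PriorConf 44 95 0 282 0 436 184 21813;
      PriorConf 50 109 0 282 0 436 210 21976;
      PriorConf 36 79 18 1000 975 0 151 22504;
      PriorConf 32 72 18 1000 1050 0 134 23186;
      PriorConf 44 102 27 1000 1125 0 184 24128;
      PriorConf 34 82 23 1000 1225 0 142 25461;
      PriorConf 44 112 34 1000 1375 0 184 27707;
      PriorConf 39 108 35 1000 1575 0 187 32396;
      PriorConf 46 149 49 1000 1875 0 220 45568;
      PriorConf 20 84 41 1000 2050 2500 100 0].
Local Close Scope N_scope.

(** The chain starts at 0.894, just below the square root of 4/5, where the two-point prior
    stops. *)
Lemma priors_ok : prior_chain 8940 priors.
Proof. by vm_compute. Qed.

(** For equal masses at [b] and [- b] the density is [k / ch], where [ch] is the marginal likelihood
    and has mean 1. So the risk is at least [k = b ^ 2 * expR (- b ^ 2)], and it remains that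
    [expR (- y) * (1 + y) >= 4 / 5] for [y] in [[0, 4/5]]. *)
Lemma two_point_prior (R : realType) (b : R) : 0 < b -> b ^+ 2 <= 4 / 5 ->
  exists w th : 'I_5 -> R, [/\ forall i, 0 <= w i, \sum_i w i = 1, forall i, `|th i| <= b &
    ((4 / 5 * (b ^+ 2 / (1 + b ^+ 2)))%:E <= lam_risk w th)%E].
Proof.
move=> b0 b2.
pose w (i : 'I_5) : R := if (i < 2)%N then 1 / 2 else 0.
pose th (i : 'I_5) : R := if i == 0 :> nat then b else - b.
have w0 i : 0 <= w i by rewrite /w; case: ifP => // _; lra.
have w1 : \sum_i w i = 1 by rewrite !big_ord_recl big_ord0 /w/=; lra.
exists w, th; split => //.
  by move=> i; rewrite /th; case: ifP; rewrite ?normrN gtr0_norm.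
pose ch (x : R) := (expR (b * x) + expR (- (b * x))) / 2 * expR (- b ^+ 2 / 2).
pose k := b ^+ 2 * expR (- b ^+ 2).
have k0 : 0 <= k by rewrite mulr_ge0 ?sqr_ge0 ?expR_ge0.
have ch0 x : 0 < ch x by rewrite mulr_gt0 ?expR_gt0// divr_gt0// addr_gt0 ?expR_gt0.
have p0 x : pmom w th 0 x = ch x.
  rewrite /pmom !big_ord_recl big_ord0 /lik /w /th/= /ch sqrrN !mulNr.
  by rewrite !expRD; lra.
have densE x : bayes_dens w th x = k / ch x.
  have e1 : expR (b * x) * expR (- (b * x)) = 1 by rewrite -expRD subrr expR0.
  have e2 : expR (- b ^+ 2) = expR (- b ^+ 2 / 2) ^+ 2 by rewrite -expRM_natl; congr expR; field.
  have -> : bayes_dens w th x = pmom w th 2 x - pmom w th 1 x ^+ 2 / ch x by rewrite /bayes_dens p0.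
  have -> : pmom w th 2 x = b ^+ 2 * ch x.
    rewrite -p0 /pmom mulr_sumr; apply: eq_bigr => i _.
    have -> : th i ^+ 2 = b ^+ 2 by rewrite /th; case: ifP => // _; rewrite sqrrN.
    by rewrite mulr1 mulrC.
  have -> : pmom w th 1 x = b * ((expR (b * x) - expR (- (b * x))) / 2 * expR (- b ^+ 2 / 2)).
    rewrite /pmom !big_ord_recl big_ord0 /lik /w /th/= sqrrN !mulNr !expRD; lra.
  have cn := lt0r_neq0 (ch0 x); apply: (mulIf cn); rewrite mulrBl !divfK//.
  rewrite /ch /k e2; move: e1; move: (expR (b * x)) (expR (- (b * x))) (expR (- b ^+ 2 / 2)) => u v g uv.
  rewrite [RHS](_ : _ = b ^+ 2 * g ^+ 2 * (u * v)); last by rewrite uv mulr1.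
  by field.
have mexp (t : R) : measurable_fun [set: R] (fun x => expR (t * x)).
  by apply: measurableT_comp => //; exact: measurable_funM.
have mch : measurable_fun [set: R] ch.
  apply: measurable_funM => //; apply: measurable_funM => //; apply: measurable_funD => //.
  rewrite (_ : (fun x => _) = (fun x => expR (- b * x))); first exact: mexp.
  by apply/funext => x; rewrite mulNr.
have int_exp := @integral_expR_normal_pdf R.
have int_ch : (\int[lebesgue_measure]_x (ch x * normal_pdf 0 1 x)%:E = 1)%E.
  pose f (t x : R) := expR (t * x - t ^+ 2 / 2) * normal_pdf 0 1 x.
  have mf t : measurable_fun [set: R] (f t).
    apply: measurable_funM; last exact: measurable_normal_pdf.
    by apply: measurableT_comp => //; apply: measurable_funB => //; exact: measurable_funM.
  have f0 t x : (0 <= (1 / 2 * f t x)%:E)%E.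
    by rewrite lee_fin !mulr_ge0 ?expR_ge0 ?normal_pdf_ge0.
  have int_f t : (\int[lebesgue_measure]_x (1 / 2 * f t x)%:E = (1 / 2)%:E)%E.
    under eq_integral do rewrite EFinM.
    rewrite ge0_integralZl//.
    - by rewrite int_exp mule1.
    - by apply/measurable_EFinP; exact: mf.
    - by move=> x _; rewrite lee_fin mulr_ge0 ?expR_ge0 ?normal_pdf_ge0.
  transitivity (\int[lebesgue_measure]_x ((1 / 2 * f b x)%:E + (1 / 2 * f (- b) x)%:E))%E.
    apply: eq_integral => x _; rewrite -EFinD /f /ch sqrrN !mulNr !expRD; congr EFin; lra.
  rewrite ge0_integralD//.
  - by rewrite !int_f -EFinD; congr EFin; lra.
  - by apply/measurable_EFinP; apply: measurable_funM => //; exact: mf.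
  - by apply/measurable_EFinP; apply: measurable_funM => //; exact: mf.
have int_1 := @integral_normal_pdf R 0 1.
have mdens : measurable_fun [set: R] (bayes_dens w th).
  by apply: measurable_bayes_dens => //; rewrite w1.
have key : ((k * 2)%:E <= lam_risk w th + k%:E)%E.
  have mpdf := measurable_normal_pdf (0 : R) 1.
  have pdf0 x : 0 <= normal_pdf 0 1 x :> R by exact: normal_pdf_ge0.
  have chn x : 0 <= ch x by exact: ltW.
  have chp x : 0 <= ch x * normal_pdf 0 1 x by exact: mulr_ge0.
  have -> : (k%:E = \int[lebesgue_measure]_x (k * (ch x * normal_pdf 0 1 x))%:E)%E.
    under eq_integral do rewrite EFinM.
    rewrite ge0_integralZl// ?int_ch ?mule1//.
    - by apply/measurable_EFinP; exact: measurable_funM.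
    - by move=> x _; rewrite lee_fin.
  rewrite -ge0_integralD//=; first last.
  - by apply/measurable_EFinP; apply: measurable_funM => //; exact: measurable_funM.
  - by move=> x _; rewrite lee_fin mulr_ge0.
  - by apply/measurable_EFinP; exact: measurable_funM.
  - by move=> x _; rewrite lee_fin densE mulr_ge0// divr_ge0.
  have -> : ((k * 2)%:E = \int[lebesgue_measure]_x ((k * 2) * normal_pdf 0 1 x)%:E)%E.
    under eq_integral do rewrite EFinM.
    rewrite ge0_integralZl// ?int_1 ?mule1//.
    - by apply/measurable_EFinP.
    - by move=> x _; rewrite lee_fin.
    - by rewrite lee_fin mulr_ge0.
  apply: ge0_le_integral => //.
  - by move=> x _; rewrite lee_fin; apply: mulr_ge0 => //; exact: mulr_ge0.
  - by apply/measurable_EFinP; exact: measurable_funM.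
  - apply/measurable_EFinP; apply: measurable_funD; first exact: measurable_funM.
    by apply: measurable_funM => //; exact: measurable_funM.
  move=> x _; rewrite lee_fin mulrA -mulrDl ler_wpM2r ?normal_pdf_ge0// densE.
  (* The tangent line bound [1 / ch >= 2 - ch] linearises the density in [ch], whose mean is 1. *)
  have c0 := ch0 x; rewrite -(ler_pM2r c0) [leRHS]mulrDl divfK ?gt_eqF//.
  by have := mulr_ge0 k0 (sqr_ge0 (ch x - 1)); lra.
(* A tangent bound at [1 / 40] followed by five squarings, each rounded to a small fraction. The
   value 4/9 is exactly what the case [b ^ 2 = 4 / 5] requires. *)
have e8 : 4 / 9 <= expR (- (4 / 5)) :> R.
  have -> : - (4 / 5) = 32%:R * - (1 / 40) :> R by lra.
  rewrite expRM_natl; have : 39 / 40 <= expR (- (1 / 40)) :> R.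
    by have := expR_ge1Dx (- (1 / 40) : R); lra.
  move: (expR _) => e e1.
  have sq (c a y : R) : 0 <= a -> a <= y -> c <= a * a -> c <= y ^+ 2.
    by move=> a0 ay /le_trans; apply; rewrite expr2; apply: ler_pM.
  have e2 : 77 / 81 <= e ^+ 2 by apply: (sq _ (39 / 40)) => //; lra.
  have e4 : 75 / 83 <= e ^+ 4 by rewrite (exprM e 2 2); apply: (sq _ (77 / 81)) => //; lra.
  have e8 : 89 / 109 <= e ^+ 8 by rewrite (exprM e 4 2); apply: (sq _ (75 / 83)) => //; lra.
  have e16 : 2 / 3 <= e ^+ 16 by rewrite (exprM e 8 2); apply: (sq _ (89 / 109)) => //; lra.
  by rewrite (exprM e 16 2); apply: (sq _ (2 / 3)) => //; lra.
have kb : 4 / 5 * (b ^+ 2 / (1 + b ^+ 2)) <= k.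
  rewrite mulrCA /k ler_wpM2l ?sqr_ge0// ler_pdivrMr ?ltr_pwDl ?sqr_ge0//.
  (* Tangent line at [4 / 5]. With it the slack, for [y = b ^ 2], is [4 / 9 * y * (4 / 5 - y)],
     nonnegative on the range considered. *)
  have : expR (- (4 / 5)) * (1 + (4 / 5 - b ^+ 2)) <= expR (- b ^+ 2).
    have -> : expR (- b ^+ 2) = expR (- (4 / 5)) * expR (4 / 5 - b ^+ 2).
      by rewrite -expRD; congr expR; lra.
    by rewrite ler_wpM2l ?expR_ge0 ?expR_ge1Dx.
  have := sqr_ge0 b; move: (b ^+ 2) b2 (expR _) (expR _) e8 => y y1 f e e8 y0 ef.
  have y2 : 0 <= 4 / 5 - y by rewrite subr_ge0.
  have h : 4 / 9 * (1 + (4 / 5 - y)) <= f by apply: le_trans ef; rewrite ler_wpM2r// addr_ge0.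
  have y3 : 0 <= 1 + y by rewrite addr_ge0.
  by have := ler_wpM2r y3 h; have := mulr_ge0 y0 y2; lra.
apply: (@le_trans _ _ k%:E); first by rewrite lee_fin.
move: key; case: (lam_risk w th) => [x| |]; rewrite ?leey// ?lee_fin; lra.
Qed.

Theorem bounded_normal_mean (R : realType) (b : R) : 0 < b ->
  exists w th : 'I_5 -> R, [/\ forall i, 0 <= w i, \sum_i w i = 1, forall i, `|th i| <= b &
    ((4 / 5 * (b ^+ 2 / (1 + b ^+ 2)))%:E <= lam_risk w th)%E].
Proof.
move=> b0; have [b2|b2] := lerP (b ^+ 2) (4 / 5); first exact: two_point_prior.
apply: (prior_chain_sound priors_ok) => //.
have y0 : 0 < nval R 10000 by exact: nval_gt0.
rewrite ler_pdivrMr// -ler_sqr ?nnegrE ?nval_ge0 ?mulr_ge0 ?ltW// exprMn.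
have : nval R 5 * (nval R 8940 * nval R 8940) <= nval R 4 * (nval R 10000 * nval R 10000).
  by rewrite -!nvalM; exact: nval_le.
have e5 : nval R 5 = 5 by rewrite nval.unlock.
have e4 : nval R 4 = 4 by rewrite nval.unlock.
rewrite e5 e4.
by have := ltr_pM2r (exprn_gt0 2 y0) (4 / 5) (b ^+ 2); rewrite b2; lra.
Qed.

(** * Symmetric matrices *)

Section real_symmetric.
Context (R : rcfType).
Local Notation C := R[i].
Local Notation toC := (real_complex R).

Lemma hermitian_eigenvalue_real n (B : 'M[R]_n) (mu : C) (w : 'rV[C]_n) :
  B^T = B -> w != 0 -> w *m map_mx toC B = mu *: w -> mu \is Num.real.
Proof.
move=> BT w0 wB; set BC := map_mx toC B in wB.
pose cw := map_mx Num.conj w.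
have BCT : BC^T = BC by rewrite /BC matrix.map_trmx BT.
have BCc : map_mx Num.conj BC = BC.
  by apply/matrixP => i j; rewrite !mxE; apply: CrealP; rewrite complex_real.
have cwB : cw *m BC = Num.conj mu *: cw.
  by rewrite -{1}BCc -map_mxM wB map_mxZ.
have nz : (w *m cw^T) 0 0 != 0.
  rewrite mxE; under eq_bigr do rewrite !mxE -normCK.
  rewrite psumr_eq0; last by move=> i _; rewrite exprn_ge0.
  apply: contra w0 => /allP H; apply/eqP/rowP => i; rewrite mxE.
  by have := H i (mem_index_enum _); rewrite implyTb sqrf_eq0 normr_eq0 => /eqP <-.
apply/CrealP; apply: (mulIf nz).
have : (w *m BC *m cw^T) 0 0 = mu * (w *m cw^T) 0 0 by rewrite wB -scalemxAl mxE.
rewrite -mulmxA -{1}BCT -trmx_mul cwB linearZ/= -scalemxAr mxE => <-.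
by [].
Qed.

(** [X] is the matrix of [B] on the invariant row space of [F]. It need not be symmetric, but each
    complex eigenvalue of [X] is one of [B], hence real. *)
Lemma symmetric_eigenvector n m (B : 'M[R]_n) (F : 'M[R]_(m.+1, n)) (X : 'M[R]_m.+1) :
  B^T = B -> row_free F -> F *m B = X *m F ->
  exists mu (v : 'rV[R]_m.+1), v != 0 /\ v *m X = mu *: v.
Proof.
move=> BT Ffree FB.
have [mu mur] : exists mu, root (char_poly (map_mx toC X)) mu.
  by apply/closed_rootP; rewrite size_char_poly.
have : eigenvalue (map_mx toC X) mu by rewrite eigenvalue_root_char.
case/eigenvalueP => w wX w0.
have mureal : mu \is Num.real.
  apply: (@hermitian_eigenvalue_real _ B mu (w *m map_mx toC F)) => //.
    apply: contra w0 => /eqP wF.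
    have := congr1 (mulmx^~ (map_mx toC (pinvmx F))) wF.
    by rewrite mul0mx -mulmxA -map_mxM (mulmxVp Ffree) map_mx1 mulmx1 => ->.
  by rewrite -mulmxA -map_mxM FB map_mxM mulmxA wX scalemxAl.
have muE : mu = toC (complex.Re mu) by rewrite RRe_real.
move: mur; rewrite muE -map_char_poly fmorph_root => rr.
have : eigenvalue X (complex.Re mu) by rewrite eigenvalue_root_char.
by case/eigenvalueP => v vX v0; exists (complex.Re mu), v.
Qed.

(** [B] preserves an eigenspace of [A], and [symmetric_eigenvector] finds an eigenvector of [B]
    inside it. *)
Lemma common_eigenvector n (A B : 'M[R]_n.+1) : A^T = A -> B^T = B -> A *m B = B *m A ->
  exists a b (v : 'rV[R]_n.+1), [/\ v != 0, v *m A = a *: v & v *m B = b *: v].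
Proof.
move=> AT BT AB.
have [a [u [u0 uA]]] : exists a (u : 'rV[R]_n.+1), u != 0 /\ u *m A = a *: u.
  by apply: (@symmetric_eigenvector _ _ A 1%:M A AT); rewrite ?row_free_unit ?unitmx1// mul1mx mulmx1.
pose E := eigenspace A a.
have Er : (0 < \rank E)%N by rewrite lt0n mxrank_eq0; apply/eigenvalueP; exists u.
pose F := row_base E.
have FA : F *m A = a *: F by apply/eigenspaceP; rewrite eq_row_base.
have /submxP[X XE] : (F *m B <= F)%MS.
  by rewrite eq_row_base; apply/eigenspaceP; rewrite -mulmxA -AB mulmxA FA scalemxAl.
move: F X FA XE (row_base_free E : row_free F); rewrite -(prednK Er) => F X FA XE Ff.
have [b [w [w0 wX]]] := symmetric_eigenvector BT Ff XE.
exists a, b, (w *m F); split.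
- by rewrite -(mul0mx _ F); apply: contra w0 => /eqP/(row_free_inj Ff) ->.
- by rewrite -mulmxA FA scalemxAr.
- by rewrite -mulmxA XE mulmxA wX scalemxAl.
Qed.

Lemma row_norm_gt0 n (v : 'rV[R]_n) : v != 0 -> 0 < (v *m v^T) 0 0.
Proof.
have -> : (v *m v^T) 0 0 = \sum_i v 0 i ^+ 2 by rewrite mxE; apply: eq_bigr => i _; rewrite mxE.
move=> v0; rewrite lt0r sumr_ge0 ?andbT; last by move=> i _; rewrite sqr_ge0.
apply: contra v0; rewrite psumr_eq0; last by move=> i _; rewrite sqr_ge0.
move=> /allP H; apply/eqP/rowP => i; rewrite mxE.
by have := H i (mem_index_enum _); rewrite implyTb sqrf_eq0 => /eqP.
Qed.

(* A Householder reflection sends the first basis vector to [v]. *)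
Lemma orthogonal_completion n (v : 'rV[R]_(1 + n)) : v *m v^T = 1%:M ->
  exists Q : 'M[R]_(1 + n), Q *m Q^T = 1%:M /\ usubmx Q = v.
Proof.
move=> vv; pose e : 'rV[R]_(1 + n) := row_mx 1%:M 0; pose w := v - e.
have ee : e *m e^T = 1%:M by rewrite /e tr_row_mx mul_row_col trmx0 mulmx0 addr0 trmx1 mulmx1.
have ve : v *m e^T = e *m v^T.
  by rewrite -[RHS]trmxK trmx_mul trmxK; apply/matrixP => i j; rewrite [RHS]mxE !ord1.
have usub_e (A : 'M[R]_(1 + n)) : usubmx A = e *m A.
  by rewrite -[in RHS](vsubmxK A) mul_row_col mul1mx mul0mx addr0.
have [/eqP w0|w0] := boolP (w == 0).
  exists 1%:M; split; first by rewrite trmx1 mulmx1.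
  by rewrite usub_e mulmx1; apply/esym/eqP; rewrite -subr_eq0 -/w w0.
pose N := (w *m w^T) 0 0.
have NE : w *m w^T = N%:M by rewrite [LHS]mx11_scalar.
have N0 : N != 0.
  by rewrite gt_eqF// row_norm_gt0.
pose c := (e *m v^T) 0 0.
have cE : e *m v^T = c%:M by rewrite [LHS]mx11_scalar.
have Nc : N = (1 - c) *+ 2.
  have : w *m w^T = (1 - c)%:M + (1 - c)%:M.
    rewrite /w linearB/= mulmxBl !mulmxBr vv ee ve cE -raddfB/=.
    by congr (_ + _); rewrite opprB -raddfB.
  by rewrite NE -raddfD/= => /(congr1 (fun X : 'M[R]_1 => X 0 0)); rewrite !mxE/= !mulr1n mulr2n.
pose Q := 1%:M - (2 / N) *: (w^T *m w).
have QT : Q^T = Q by rewrite /Q linearB/= trmx1 linearZ/= trmx_mul trmxK.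
exists Q; split.
  pose P := w^T *m w; have PP : P *m P = N *: P.
    by rewrite mulmxA -[w^T *m w *m w^T]mulmxA NE mul_mx_scalar scalemxAl.
  rewrite QT /Q -/P mulmxBr mulmx1 mulmxBl mul1mx -scalemxAl -scalemxAr PP !scalerA.
  rewrite (_ : _ * N = 2 / N + 2 / N); last by field.
  by rewrite scalerDl opprB addrK subrK.
rewrite usub_e /Q mulmxBr mulmx1 -scalemxAr mulmxA.
rewrite (_ : e *m w^T = (c - 1)%:M); last by rewrite /w linearB/= mulmxBr cE ee -raddfB.
rewrite mul_scalar_mx scalerA (_ : 2 / N * (c - 1) = -1); last first.
  by rewrite Nc; field; move: N0; rewrite Nc mulrn_eq0.
by rewrite scaleN1r opprK /w addrC subrK.
Qed.

(** With [B = A] this is the spectral theorem, used throughout; the general form is needed when [ST]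
    commutes with the source covariance. *)
Lemma simultaneous_diagonalization n (A B : 'M[R]_n) : A^T = A -> B^T = B -> A *m B = B *m A ->
  exists (U : 'M[R]_n) (a b : 'rV[R]_n), [/\ U *m U^T = 1%:M,
    A = U^T *m diag_mx a *m U & B = U^T *m diag_mx b *m U].
Proof.
elim: n A B => [|n IH] A B AT BT AB.
  by exists 1%:M, 0, 0; split; apply/matrixP => -[].
have [a [b [v0 [v00 vA0 vB0]]]] := common_eigenvector AT BT AB.
have [v [vv vA vB]] : exists v : 'rV[R]_n.+1, [/\ v *m v^T = 1%:M, v *m A = a *: v & v *m B = b *: v].
  pose N := (v0 *m v0^T) 0 0; have N0 : 0 < N by exact: row_norm_gt0.
  exists ((Num.sqrt N)^-1 *: v0); split.
  - rewrite linearZ/= -scalemxAl -scalemxAr [_ *m _]mx11_scalar -/N scalerA -invfM -expr2 sqr_sqrtr ?ltW//.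
    by rewrite scale_scalar_mx mulVf ?gt_eqF.
  - by rewrite -scalemxAl vA0 !scalerA mulrC.
  - by rewrite -scalemxAl vB0 !scalerA mulrC.
have [Q [QQ Qv]] := @orthogonal_completion n v vv.
have QQ' : Q^T *m Q = 1%:M by apply: mulmx1C.
have block (M : 'M[R]_(1 + n)) m : M^T = M -> v *m M = m *: v ->
    exists2 M' : 'M[R]_n, M'^T = M' & Q *m M *m Q^T = block_mx m%:M 0 0 M'.
  move=> MT vM; pose P : 'M[R]_(1 + n) := Q *m M *m Q^T.
  have PT : P^T = P by rewrite /P !trmx_mul trmxK MT mulmxA.
  have uP : usubmx P = m *: row_mx 1%:M 0.
    have us (X Y : 'M[R]_(1 + n)) : usubmx (X *m Y) = usubmx X *m Y.
      by rewrite -[in LHS](vsubmxK X) mul_col_mx col_mxKu.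
    rewrite /P !us Qv vM -scalemxAl -Qv -us QQ; congr (_ *: _).
    by rewrite (scalar_mx_block 1 n 1) /block_mx col_mxKu.
  have ulP : ulsubmx P = m%:M by rewrite /ulsubmx uP linearZ/= row_mxKl scale_scalar_mx mulr1.
  have urP : ursubmx P = 0 by rewrite /ursubmx uP linearZ/= row_mxKr scaler0.
  have dlP : dlsubmx P = 0 by rewrite -PT -trmx_ursub urP trmx0.
  exists (drsubmx P); first by rewrite trmx_drsub PT.
  by rewrite -/P -[LHS](submxK P) ulP urP dlP.
have [A' A'T AE] := block A a AT vA.
have [B' B'T BE] := block B b BT vB.
have AB' : A' *m B' = B' *m A'.
  have : Q *m A *m Q^T *m (Q *m B *m Q^T) = Q *m B *m Q^T *m (Q *m A *m Q^T).
    rewrite !mulmxA -[Q *m A *m Q^T *m Q]mulmxA QQ' mulmx1.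
    by rewrite -[Q *m B *m Q^T *m Q]mulmxA QQ' mulmx1 -![Q *m _ *m _]mulmxA AB.
  rewrite AE BE !mulmx_block !mul0mx !mulmx0 !add0r => /(congr1 drsubmx).
  by rewrite !block_mxKdr.
have [U [a' [b' [UU AU BU]]]] := IH _ _ A'T B'T AB'.
pose V : 'M[R]_(1 + n) := block_mx 1%:M 0 0 U *m Q.
have back (M : 'M[R]_(1 + n)) m M' (m' : 'rV_n) : Q *m M *m Q^T = block_mx m%:M 0 0 M' ->
    M' = U^T *m diag_mx m' *m U -> M = V^T *m diag_mx (row_mx m%:M m') *m V.
  move=> ME M'E.
  have -> : M = Q^T *m (Q *m M *m Q^T) *m Q.
    by rewrite !mulmxA QQ' mul1mx -mulmxA QQ' mulmx1.
  rewrite ME M'E /V trmx_mul tr_block_mx !trmx0 trmx1 diag_mx_row !mulmxA; congr (_ *m Q).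
  rewrite -!mulmxA; congr (_ *m _); rewrite !mulmx_block !mul0mx !mulmx0 !mul1mx !mulmx1 !addr0 !add0r.
  rewrite mulmx0; congr block_mx; apply/matrixP => i j; rewrite !ord1 !mxE eqxx.
  by rewrite !mulr1n.
have VV : V *m V^T = 1%:M.
  rewrite /V trmx_mul mulmxA -[_ *m Q *m _]mulmxA QQ mulmx1 tr_block_mx !trmx0 trmx1.
  by rewrite mulmx_block !mul0mx !mulmx0 mul1mx UU !addr0 !add0r (scalar_mx_block 1 n 1).
exists V, (row_mx a%:M a'), (row_mx b%:M b'); split; first exact: VV.
- exact: back AE AU.
- exact: back BE BU.
Qed.

End real_symmetric.

Section quadratic_forms.
Context (R : realType).

Lemma dotE n (u v : 'cV[R]_n) : (u^T *m v) 0 0 = \sum_i u i 0 * v i 0.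
Proof. by rewrite mxE; apply: eq_bigr => i _; rewrite mxE. Qed.

Lemma l2norm_sq n (v : 'cV[R]_n) : l2norm v ^+ 2 = (v^T *m v) 0 0.
Proof.
rewrite dotE sqr_sqrtr; first by apply: eq_bigr => i _; rewrite expr2.
by apply: sumr_ge0 => i _; rewrite sqr_ge0.
Qed.

Lemma l2norm_ge0 n (v : 'cV[R]_n) : 0 <= l2norm v.
Proof. exact: sqrtr_ge0. Qed.

Lemma dotC n (u v : 'cV[R]_n) : (u^T *m v) 0 0 = (v^T *m u) 0 0.
Proof. by rewrite !dotE; apply: eq_bigr => i _; rewrite mulrC. Qed.

Lemma dot_ge0 n (v : 'cV[R]_n) : 0 <= (v^T *m v) 0 0.
Proof. by rewrite -l2norm_sq sqr_ge0. Qed.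

Lemma dot_eq0 n (v : 'cV[R]_n) : (v^T *m v) 0 0 = 0 -> v = 0.
Proof.
rewrite dotE => /eqP; rewrite psumr_eq0; last by move=> i _; rewrite -expr2 sqr_ge0.
move=> /allP H; apply/colP => i; rewrite mxE.
by have := H i (mem_index_enum _); rewrite implyTb -expr2 sqrf_eq0 => /eqP.
Qed.

Lemma dot_le n (v : 'cV[R]_n) r : 0 <= r -> (l2norm v <= r) = ((v^T *m v) 0 0 <= r ^+ 2).
Proof. by move=> r0; rewrite -l2norm_sq ler_sqr ?nnegrE ?l2norm_ge0. Qed.

Lemma qform_gram n m (B : 'M[R]_(m, n)) (v : 'cV[R]_n) :
  qform (B^T *m B) v = ((B *m v)^T *m (B *m v)) 0 0.
Proof. by rewrite /qform trmx_mul !mulmxA. Qed.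

Lemma qform_gram_ge0 n m (B : 'M[R]_(m, n)) (v : 'cV[R]_n) : 0 <= qform (B^T *m B) v.
Proof. by rewrite qform_gram dot_ge0. Qed.

Lemma qformD n (A B : 'M[R]_n) v : qform (A + B) v = qform A v + qform B v.
Proof. by rewrite /qform mulmxDr mulmxDl mxE. Qed.

Lemma qformZ n a (A : 'M[R]_n) v : qform (a *: A) v = a * qform A v.
Proof. by rewrite /qform -scalemxAr -scalemxAl mxE. Qed.

Lemma qform_congr n m (A : 'M[R]_n) (B : 'M[R]_(n, m)) v : qform (B^T *m A *m B) v = qform A (B *m v).
Proof. by rewrite /qform trmx_mul !mulmxA. Qed.

Lemma qform_scalar n a (v : 'cV[R]_n) : qform a%:M v = a * (v^T *m v) 0 0.
Proof. by rewrite /qform mul_mx_scalar -scalemxAl mxE. Qed.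

Lemma qform_diag n (a : 'rV[R]_n) v : qform (diag_mx a) v = \sum_i a 0 i * v i 0 ^+ 2.
Proof.
rewrite /qform -mulmxA mul_diag_mx mxE; apply: eq_bigr => i _; rewrite !mxE; ring.
Qed.

Lemma mx_subE m n (A B : 'M[R]_(m, n)) i j : (A - B) i j = A i j - B i j.
Proof. by rewrite !mxE. Qed.

Lemma qformB n (A B : 'M[R]_n) v : qform (A - B) v = qform A v - qform B v.
Proof. by rewrite /qform mulmxBr mulmxBl mx_subE. Qed.

Lemma trmx_scale m n a (B : 'M[R]_(m, n)) : (a *: B)^T = a *: B^T.
Proof. exact: linearZ. Qed.

Lemma dot_scale n a (v : 'cV[R]_n) : ((a *: v)^T *m (a *: v)) 0 0 = a ^+ 2 * (v^T *m v) 0 0.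
Proof. by rewrite trmx_scale -scalemxAl -scalemxAr scalerA mxE -expr2. Qed.

Lemma qform_scale n (A : 'M[R]_n) a v : qform A (a *: v) = a ^+ 2 * qform A v.
Proof. rewrite /qform trmx_scale.
by rewrite -!scalemxAl -scalemxAr scalerA mxE -expr2. Qed.

Definition spectral_psd n (U : 'M[R]_n) (a : 'rV[R]_n) := U^T *m diag_mx a *m U.

Lemma orthogonal_dot n (U : 'M[R]_n) (u v : 'cV[R]_n) : U *m U^T = 1%:M ->
  ((U *m u)^T *m (U *m v)) 0 0 = (u^T *m v) 0 0.
Proof.
by move=> /mulmx1C UU; rewrite trmx_mul -mulmxA (mulmxA U^T) UU mul1mx.
Qed.

Lemma spectral_sym n (U : 'M[R]_n) a : (spectral_psd U a)^T = spectral_psd U a.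
Proof. by rewrite /spectral_psd !trmx_mul tr_diag_mx trmxK mulmxA. Qed.

Lemma spectral_mul n (U : 'M[R]_n) a b : U *m U^T = 1%:M ->
  spectral_psd U a *m spectral_psd U b = spectral_psd U (\row_i (a 0 i * b 0 i)).
Proof.
move=> UU; rewrite /spectral_psd !mulmxA -[_ *m U *m U^T]mulmxA UU mulmx1.
rewrite -[U^T *m _ *m _]mulmxA; congr (_ *m _ *m _).
by rewrite mulmx_diag; congr diag_mx; apply/rowP => i; rewrite !mxE.
Qed.

Lemma spectral_qform n (U : 'M[R]_n) a v :
  qform (spectral_psd U a) v = \sum_i a 0 i * (U *m v) i 0 ^+ 2.
Proof. by rewrite qform_congr qform_diag. Qed.

Lemma psd_spectral n (A : 'M[R]_n) : psd A ->
  exists U a, [/\ U *m U^T = 1%:M, A = spectral_psd U a & forall i, 0 <= a 0 i].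
Proof.
move=> [AT A0]; have [U [a [b [UU AE _]]]] := simultaneous_diagonalization AT AT erefl.
exists U, a; split=> // i.
have := A0 (U^T *m delta_mx i 0); rewrite AE -/(spectral_psd U a) spectral_qform mulmxA UU mul1mx.
rewrite (bigD1 i)//= big1 => [|j ji]; last by rewrite mxE (negPf ji) expr0n mulr0.
by rewrite mxE !eqxx expr1n mulr1 addr0.
Qed.

Lemma spectral_is_psd n (U : 'M[R]_n) (a : 'rV[R]_n) : (forall i, 0 <= a 0 i) -> psd (spectral_psd U a).
Proof.
move=> a0; split; first exact: spectral_sym.
by move=> v; rewrite spectral_qform sumr_ge0// => i _; rewrite mulr_ge0 ?sqr_ge0.
Qed.

Lemma psd_msqrt n (A : 'M[R]_n) : psd A -> psd (msqrt A) /\ msqrt A *m msqrt A = A.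
Proof.
move=> Apsd; apply: (@xgetPex _ 0 [set S : 'M[R]_n | psd S /\ S *m S = A]).
have [U [a [UU -> a0]]] := psd_spectral Apsd.
exists (spectral_psd U (\row_i Num.sqrt (a 0 i))); split.
  by apply: spectral_is_psd => i; rewrite mxE sqrtr_ge0.
by rewrite spectral_mul//; congr spectral_psd; apply/rowP => i; rewrite !mxE -expr2 sqr_sqrtr.
Qed.

Lemma msqrt_l2norm n (A : 'M[R]_n) v : psd A -> l2norm (msqrt A *m v) ^+ 2 = qform A v.
Proof.
by move=> /psd_msqrt[[ST _] SS]; rewrite l2norm_sq -qform_gram ST SS.
Qed.

(** The Moore-Penrose inverse, obtained in an eigenbasis from the convention [0^-1 = 0]. Then
    [S *m W] is the orthogonal projection onto the range of [S], hence a contraction. *)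
Lemma psd_pinv n (S : 'M[R]_n) : psd S -> exists W : 'M[R]_n,
  [/\ W^T = W, W *m S = S *m W, S *m W *m S = S, (S *m W)^T = S *m W &
      forall v : 'cV[R]_n, ((S *m W *m v)^T *m (S *m W *m v)) 0 0 <= (v^T *m v) 0 0].
Proof.
move=> /psd_spectral[U [s [UU -> s0]]].
exists (spectral_psd U (\row_i (s 0 i)^-1)); rewrite !spectral_mul//; split.
- exact: spectral_sym.
- by congr spectral_psd; apply/rowP => i; rewrite !mxE mulrC.
- congr spectral_psd; apply/rowP => i; rewrite !mxE.
  by have [->|s1] := eqVneq (s 0 i) 0; rewrite ?mulr0// divff// mul1r.
- exact: spectral_sym.
- move=> v; rewrite -[leRHS](orthogonal_dot v v UU) -qform_gram spectral_sym spectral_mul//.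
  rewrite spectral_qform dotE; apply: ler_sum => i _; rewrite !mxE -expr2 ler_piMl ?sqr_ge0//.
  have [->|s1] := eqVneq (s 0 i) 0; first by rewrite mul0r expr0n.
  by rewrite divff// expr1n.
Qed.

End quadratic_forms.

(** * Concentration of the sample covariance *)

Section squared_subgaussian.
Local Open Scope ereal_scope.
Context (d : measure_display) (T : measurableType d) (R : realType) (P : probability T R).
Variables (xi : T -> R) (rho : R).
Hypothesis mxi : measurable_fun [set: T] xi.
Hypothesis rho0 : (0 < rho)%R.
Hypothesis mgf : forall s, \int[P]_x (expR (s * xi x))%:E <= (expR (s ^+ 2 * rho ^+ 2 / 2))%:E.

(* [exp (xi^2 / (4 rho^2))] is a Gaussian mixture of the exponentials
   [exp (s xi)], whose expectations are controlled by hypothesis. *)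
Lemma subgaussian_exp_sq :
  \int[P]_x (expR (xi x ^+ 2 / (4 * rho ^+ 2)))%:E <= (3 / 2)%:E.
Proof.
(* With this [c] the exponent is half the square of [c * xi]. Bounding the expectation over [xi]
   first leaves the Gaussian mean of [expR (g ^ 2 / 4)], which is [Num.sqrt 2]. *)
pose c := (rho * Num.sqrt 2)^-1%R.
have c2 : (c ^+ 2 = (2 * rho ^+ 2)^-1)%R by rewrite /c exprVn exprMn sqr_sqrtr// mulrC.
pose phi : measurableTypeR R -> R := normal_pdf 0 1.
have mphi : measurable_fun [set: measurableTypeR R] phi by exact: measurable_normal_pdf.
have phi0 g : (0 <= phi g)%R by exact: normal_pdf_ge0.
pose f (p : T * measurableTypeR R) : \bar R := (expR (c * xi p.1 * p.2) * phi p.2)%:E.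
have f0 p : 0 <= f p by rewrite lee_fin mulr_ge0 ?expR_ge0.
have mf : measurable_fun [set: T * measurableTypeR R] f.
  apply/measurable_EFinP; apply: measurable_funM; last exact: measurableT_comp.
  apply: measurableT_comp => //; apply: measurable_funM => //.
  by apply: measurable_funM => //; exact: measurableT_comp.
have fE x : (expR (xi x ^+ 2 / (4 * rho ^+ 2)))%:E = \int[lebesgue_measure]_g f (x, g).
  pose t := (c * xi x)%R.
  transitivity ((expR (t ^+ 2 / 2))%:E * \int[lebesgue_measure]_g (expR (t * g - t ^+ 2 / 2) * phi g)%:E).
    rewrite integral_expR_normal_pdf mule1 /t exprMn c2; congr (expR _)%:E.
    by field; rewrite gt_eqF.
  rewrite -ge0_integralZl//.
  - by apply: eq_integral => g _; rewrite /f/= -EFinM mulrA -expRD addrC subrK.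
  - apply/measurable_EFinP; apply: measurable_funM => //.
    by apply: measurableT_comp => //; apply: measurable_funB => //; exact: measurable_funM.
  - by move=> g _; rewrite lee_fin mulr_ge0 ?expR_ge0.
under eq_integral do rewrite fE.
rewrite (@fubini_tonelli _ _ _ _ _ P (@lebesgue_measure R) f mf f0).
have s20 : (0 < Num.sqrt 2 :> R)%R by rewrite sqrtr_gt0.
have s2 : (Num.sqrt 2 <= 3 / 2 :> R)%R.
  have h : (0 <= 3 / 2 :> R)%R by lra.
  by rewrite -(ger0_norm h) -sqrtr_sqr ler_wsqrtr//; lra.
apply: (@le_trans _ _ (Num.sqrt 2)%:E); last by rewrite lee_fin.
rewrite -[leRHS]mule1 -(@integral_normal_pdf R 0 (Num.sqrt 2)).
rewrite -ge0_integralZl//; first last.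
- by move=> g _; rewrite lee_fin normal_pdf_ge0.
- by apply/measurable_EFinP; exact: measurable_normal_pdf.
apply: ge0_le_integral => //.
- by move=> g _; apply: integral_ge0.
- exact: (measurable_fun_fubini_tonelli_G _ mf f0).
- by apply: measurable_funeM; apply/measurable_EFinP; exact: measurable_normal_pdf.
move=> g _; rewrite /f/=.
under eq_integral do rewrite EFinM muleC mulrAC.
rewrite ge0_integralZl//; first last.
- by rewrite lee_fin.
- by apply/measurable_EFinP; apply: measurableT_comp => //; exact: measurable_funM.
apply: (@le_trans _ _ ((phi g)%:E * (expR ((c * g) ^+ 2 * rho ^+ 2 / 2))%:E)).
  by apply: lee_wpmul2l; [rewrite lee_fin|exact: mgf].
rewrite -!EFinM lee_fin exprMn c2 /phi normal_pdf01 normal_pdfE ?gt_eqF// /normal_fun subr0 sqr_sqrtr//.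
have -> : (normal_peak 1 = Num.sqrt 2 * normal_peak (Num.sqrt 2) :> R)%R.
  rewrite /normal_peak sqr_sqrtr// expr1n mul1r -mulrnAr sqrtrM// invfM mulrA divff ?mul1r//.
rewrite [X in (X <= _)%R]mulrC mulrCA -expRD.
rewrite [X in expR X](_ : _ = - g ^+ 2 / (2 *+ 2))%R; first by rewrite mulrA.
by rewrite -mulr_natr; field; rewrite gt_eqF.
Qed.

(** A second-order Taylor bound whose remainder has a controlled mean when [l = (4 * rho ^ 2)^-1].
    Half of the rate [l] absorbs [expR x], the other half the square [(l * y) ^ 2], at the price of
    16. *)
Lemma expR_quad_le (t l y : R) : (0 < l)%R -> (0 <= y)%R -> (`|t| <= l / 2)%R ->
  (expR (t * y) <= 1 + t * y + 16 * (t / l) ^+ 2 * expR (l * y))%R.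
Proof.
move=> l0 y0 tl; set x := (`|t| * y)%R; have x0 : (0 <= x)%R by rewrite mulr_ge0.
have step : (expR (t * y) <= 1 + t * y + x ^+ 2 * expR x)%R.
  have e1 (z : R) : (expR z - 1 <= z * expR z)%R.
    have := expR_ge1Dx (- z); rewrite expRN => h.
    have := ler_wpM2r (expR_ge0 z) h; rewrite mulVf ?gt_eqF ?expR_gt0//; lra.
  have [t0|t0] := lerP 0 t.
    have -> : (t * y = x)%R by rewrite /x ger0_norm.
    by have := e1 x; move=> h; have := ler_wpM2l x0 h; lra.
  have -> : (t * y = - x)%R by rewrite /x ltr0_norm// mulNr opprK.
  have ex : (1 <= expR x)%R by rewrite -expR0 ler_expR.
  have := e1 (- x)%R; have := expR_ge1Dx x; rewrite expRN => h1 h2.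
  have ei : ((expR x)^-1 <= (1 + x)^-1)%R by rewrite lef_pV2 ?posrE ?expR_gt0 ?ltr_pwDl.
  have i1 : ((1 + x)^-1 <= 1 - x + x ^+ 2)%R.
    by rewrite -[leLHS]mul1r ler_pdivrMr ?ltr_pwDl//; have := mulr_ge0 x0 (sqr_ge0 x); lra.
  by have := ler_wpM2l (sqr_ge0 x) ex; lra.
apply: (le_trans step); rewrite lerD2l.
have xl : (x <= l * y / 2)%R by rewrite /x mulrAC ler_wpM2r.
have sq : ((l * y) ^+ 2 <= 16 * expR (l * y / 2))%R.
  have ly : (0 <= l * y)%R by rewrite mulr_ge0// ltW.
  have -> : (l * y / 2 = 2%:R * (l * y / 4))%R by field.
  rewrite expRM_natl; have h := expR_ge1Dx (l * y / 4).
  have h1 : (l * y <= 4 * expR (l * y / 4))%R by lra.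
  have h2 : (0 <= 4 * expR (l * y / 4))%R by rewrite mulr_ge0 ?expR_ge0.
  by have := ler_pM ly ly h1 h1; lra.
have -> : (expR (l * y) = expR (l * y / 2) * expR (l * y / 2))%R by rewrite -expRD; congr expR; field.
rewrite mulrA; apply: ler_pM; rewrite ?sqr_ge0 ?expR_ge0 ?ler_expR//.
rewrite /x exprMn real_normK ?num_real// expr_div_n.
rewrite [leRHS](_ : _ = t ^+ 2 * (16 * expR (l * y / 2) / l ^+ 2))%R; last by field; rewrite gt_eqF.
by rewrite ler_wpM2l ?sqr_ge0// ler_pdivlMr ?exprn_gt0// mulrC -exprMn.
Qed.

(** The constant is [16 * (t / l) ^ 2 * (3 / 2)] for [l = (4 * rho ^ 2)^-1]; the linear term of the
    Taylor bound cancels against the centring by [mu]. *)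
Lemma subgaussian_sq_mgf (mu t : R) : \int[P]_x (xi x ^+ 2)%:E = mu%:E ->
  (`|t| <= (8 * rho ^+ 2)^-1)%R ->
  \int[P]_x (expR (t * (xi x ^+ 2 - mu)))%:E <= (expR (24 * 16 * t ^+ 2 * rho ^+ 4))%:E.
Proof.
move=> xi2 tr; pose l : R := ((4 * rho ^+ 2)^-1)%R.
have l0 : (0 < l)%R by rewrite invr_gt0 mulr_gt0 ?exprn_gt0.
have tl : (`|t| <= l / 2)%R by rewrite (le_trans tr)// /l -invfM le_eqVlt; apply/orP; left; apply/eqP; congr (_^-1)%R; ring.
have msq : measurable_fun [set: T] (fun x => xi x ^+ 2)%R by exact: measurable_funX.
have mexp (k : R) : measurable_fun [set: T] (fun x => expR (k * xi x ^+ 2)).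
  by apply: measurableT_comp => //; exact: measurable_funM.
(* Positive and negative parts of [t]: the negative one is moved to the other side, so that only
   nonnegative functions are integrated. *)
pose a := Num.max (- t)%R 0%R; pose b := Num.max t 0%R.
have a0 : (0 <= a)%R by rewrite le_max lexx orbT.
have b0 : (0 <= b)%R by rewrite le_max lexx orbT.
have abt : (b - a = t)%R by rewrite /a /b; case: (ltrgtP t 0); case: (ltrgtP (- t)%R 0) => //; lra.
pose k := (16 * (t / l) ^+ 2)%R; have k0 : (0 <= k)%R by rewrite mulr_ge0 ?sqr_ge0.
have intZ (c : R) (f : T -> R) : (0 <= c)%R -> measurable_fun [set: T] f -> (forall x, (0 <= f x)%R) ->
    \int[P]_x (c * f x)%:E = c%:E * \int[P]_x (f x)%:E.
  move=> c0 mf f0; under eq_integral do rewrite EFinM.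
  by rewrite ge0_integralZl//; [exact/measurable_EFinP|move=> x _; rewrite lee_fin].
have intD (f g : T -> R) : measurable_fun [set: T] f -> (forall x, (0 <= f x)%R) ->
    measurable_fun [set: T] g -> (forall x, (0 <= g x)%R) ->
    \int[P]_x (f x + g x)%:E = \int[P]_x (f x)%:E + \int[P]_x (g x)%:E.
  move=> mf f0 mg g0; under eq_integral do rewrite EFinD.
  by rewrite ge0_integralD//; first [exact/measurable_EFinP|move=> x _; rewrite lee_fin].
have sq0 x : (0 <= xi x ^+ 2)%R by exact: sqr_ge0.
have e0 (c : R) x : (0 <= expR (c * xi x ^+ 2))%R by exact: expR_ge0.
have csq0 (c : R) : (0 <= c)%R -> forall x, (0 <= c * xi x ^+ 2)%R by move=> c0 x; rewrite mulr_ge0.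
have ke0 x : (0 <= k * expR (l * xi x ^+ 2))%R by rewrite mulr_ge0.
have bsq1 x : (0 <= 1 + b * xi x ^+ 2)%R by rewrite addr_ge0// csq0.
have mcsq (c : R) : measurable_fun [set: T] (fun x => c * xi x ^+ 2)%R by exact: measurable_funM.
have mke : measurable_fun [set: T] (fun x => k * expR (l * xi x ^+ 2))%R by exact: measurable_funM.
have mb1 : measurable_fun [set: T] (fun x => 1 + b * xi x ^+ 2)%R by exact: measurable_funD.
have asq0 := csq0 a a0; have bsq0 := csq0 b b0.
have main : \int[P]_x (expR (t * xi x ^+ 2))%:E + (a * mu)%:E <=
    1 + (b * mu)%:E + (k * (3 / 2))%:E.
  rewrite EFinM -xi2 -intZ// -intD//.
  apply: (@le_trans _ _ (\int[P]_x (1 + b * xi x ^+ 2 + k * expR (l * xi x ^+ 2))%:E)).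
    apply: ge0_le_integral => //.
    - by move=> x _; rewrite lee_fin addr_ge0.
    - by apply/measurable_EFinP; exact: measurable_funD.
    - by apply/measurable_EFinP; exact: measurable_funD.
    - move=> x _; rewrite lee_fin; have := expR_quad_le l0 (sqr_ge0 (xi x)) tl.
      by rewrite -/k -abt; lra.
  rewrite intD// intD// !intZ//.
  rewrite xi2 -EFinM (EFinM k) (integral_prob_cst P 1) leeD2l// lee_wpmul2l ?lee_fin//.
  rewrite (le_trans _ subgaussian_exp_sq)// le_eqVlt; apply/orP; left; apply/eqP.
  by apply: eq_integral => x _; rewrite /l mulrC.
under eq_integral do rewrite mulrBr expRD mulrC.
rewrite intZ// ?expR_ge0//.
move: main; have : 0 <= \int[P]_x (expR (t * xi x ^+ 2))%:E.
  by apply: integral_ge0 => x _; rewrite lee_fin expR_ge0.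
case: (\int[P]_x _)%E => [I| |]//; rewrite -!EFinD -!EFinM !lee_fin => I0 H.
rewrite expRN -[leLHS]mulrC ler_pdivrMr ?expR_gt0// -expRD.
apply: (@le_trans _ _ (1 + t * mu + k * (3 / 2)))%R; first by rewrite -abt; lra.
have -> : (24 * 16 * t ^+ 2 * rho ^+ 4 = k * (3 / 2))%R.
  by rewrite /k /l; field; rewrite gt_eqF.
by have := expR_ge1Dx (k * (3 / 2) + t * mu)%R; lra.
Qed.

End squared_subgaussian.

Section iid_deviation.
Local Open Scope ereal_scope.
Context (dO dT : measure_display) (O : measurableType dO) (T : measurableType dT) (R : realType).
Variables (P : probability O R) (pT : probability T R) (n : nat) (x : 'I_n -> O -> T).
Hypothesis mx : forall j, measurable_fun [set: O] (x j).
Hypothesis xlaw : forall j (A : set T), measurable A -> P (x j @^-1` A) = pT A.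
Hypothesis xprod : forall A : 'I_n -> set T, (forall j, measurable (A j)) ->
  P (\bigcap_j (x j @^-1` A j)) = \big[*%E/1%E]_j P (x j @^-1` A j).

Lemma chernoff_sum (f : T -> R) (a s : R) : measurable_fun [set: T] f ->
  \int[pT]_y (expR (f y))%:E <= (expR a)%:E ->
  P [set w | (s <= \sum_j f (x j w))%R] <= (expR (n%:R * a - s))%:E.
Proof.
move=> mf fa; set A := [set w | _].
have mfx j : measurable_fun [set: O] (fun w => f (x j w)) by exact: measurableT_comp.
have mS : measurable_fun [set: O] (fun w => \sum_j f (x j w))%R by exact: measurable_sum.
have mA : measurable A.
  rewrite (_ : A = (fun w => \sum_j f (x j w))%R @^-1` `[s, +oo[%classic); last first.
    by apply/seteqP; split => w; rewrite /= in_itv/= andbT.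
  by rewrite -[X in measurable X]setTI; exact: mS.
have mE : measurable_fun [set: T] (fun y => expR (f y)) by exact: measurableT_comp.
have Elaw j : \int[P]_w (expR (f (x j w)))%:E = \int[pT]_y (expR (f y))%:E.
  apply: (integral_same_law (mx j) (xlaw j)) => //; first exact/measurable_EFinP.
have [r rE r0] : exists2 r, \int[pT]_y (expR (f y))%:E = r%:E & (0 <= r)%R.
  have : 0 <= \int[pT]_y (expR (f y))%:E by apply: integral_ge0 => y _; rewrite lee_fin expR_ge0.
  by move: fa; case: (\int[pT]_y _) => // r _ r0; exists r.
have ra : (r <= expR a)%R by rewrite -lee_fin -rE.
rewrite -[A]setIT -integral_indic//.
apply: (@le_trans _ _ (\int[P]_w ((expR (- s))%:E * (\prod_j expR (f (x j w)))%R%:E))).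
  apply: ge0_le_integral => //.
  - exact/measurable_EFinP/measurable_indic.
  - apply: measurable_funeM; apply/measurable_EFinP; apply: measurable_prod => j _.
    exact: measurableT_comp.
  - move=> w _; rewrite lee_fin -expR_sum -expRD indicE.
    have [/set_mem Aw|_] := boolP (w \in A); last exact: expR_ge0.
    by rewrite -expR0 ler_expR addrC subr_ge0.
rewrite ge0_integralZl//; last 2 first.
- apply/measurable_EFinP; apply: measurable_prod => j _; exact: measurableT_comp.
- by move=> w _; rewrite lee_fin prodr_ge0// => j _; exact: expR_ge0.
rewrite (expectation_prod mx xprod (f := fun _ y => expR (f y)))//; last by move=> j; rewrite Elaw rE ltry.
under eq_bigr do rewrite Elaw rE.
rewrite (_ : \big[_/_]_(j < n) _ = (r ^+ n)%:E); last first.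
  rewrite -[in RHS](card_ord n) -prodr_const.
  by apply/esym; apply: (big_morph EFin) => // u v; rewrite EFinM.
rewrite -EFinM lee_fin addrC expRD ler_wpM2l ?expR_ge0// expRM_natl.
by apply: lerXn2r; rewrite ?nnegrE ?expR_ge0.
Qed.

Lemma sq_deviation (xi : T -> R) (rho mu eps : R) : (0 < n)%N -> (0 < rho)%R ->
  measurable_fun [set: T] xi ->
  (forall s, \int[pT]_y (expR (s * xi y))%:E <= (expR (s ^+ 2 * rho ^+ 2 / 2))%:E) ->
  \int[pT]_y (xi y ^+ 2)%:E = mu%:E -> (0 < eps <= 6 * 16 * rho ^+ 2)%R ->
  P [set w | (eps <= `|n%:R^-1 * \sum_j xi (x j w) ^+ 2 - mu|)%R] <=
    (2 * expR (- (n%:R * eps ^+ 2 / (6 * 16 ^+ 2 * rho ^+ 4))))%:E.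
Proof.
move=> n0 rho0 mxi mgf mu_xi /andP[eps0 eps_le].
(* The minimiser of [24 * 16 * t ^ 2 * rho ^ 4 - t * eps]. The upper limit on [eps] is what keeps it
   within the range of [subgaussian_sq_mgf]. *)
pose t := (eps / (3 * 16 ^+ 2 * rho ^+ 4))%R.
have t0 : (0 < t)%R by rewrite divr_gt0// mulr_gt0// exprn_gt0.
have trho : (t <= (8 * rho ^+ 2)^-1)%R.
  rewrite /t ler_pdivrMr ?mulr_gt0 ?exprn_gt0//; apply: (le_trans eps_le).
  by rewrite le_eqVlt; apply/orP; left; apply/eqP; field; rewrite gt_eqF.
have n1 : (0 < n%:R :> R)%R by rewrite ltr0n.
pose f (c : R) y := (c * (xi y ^+ 2 - mu))%R.
have mf c : measurable_fun [set: T] (f c).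
  by apply: measurable_funM => //; apply: measurable_funB => //; exact: measurable_funX.
pose A c := [set w | (t * (n%:R * eps) <= \sum_j f c (x j w))%R].
have mA c : measurable (A c).
  rewrite (_ : A c = (fun w => \sum_j f c (x j w))%R @^-1` `[(t * (n%:R * eps))%R, +oo[%classic); last first.
    by apply/seteqP; split => w; rewrite /= in_itv/= andbT.
  rewrite -[X in measurable X]setTI.
  have mS : measurable_fun [set: O] (fun w => \sum_j f c (x j w))%R.
    by apply: measurable_sum => j; exact: measurableT_comp.
  exact: mS.
have PA c : (`|c| = t)%R -> P (A c) <= (expR (- (n%:R * eps ^+ 2 / (6 * 16 ^+ 2 * rho ^+ 4))))%:E.
  move=> ct; have := @chernoff_sum (f c) (24 * 16 * c ^+ 2 * rho ^+ 4)%R (t * (n%:R * eps))%R (mf c).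
  rewrite -[(c ^+ 2)%R](real_normK (num_real c)) ct => H.
  apply: (le_trans (H _)).
    have := @subgaussian_sq_mgf _ _ _ pT xi rho mxi rho0 mgf mu c mu_xi.
    by rewrite ct -[(c ^+ 2)%R](real_normK (num_real c)) ct; apply.
  rewrite lee_fin ler_expR le_eqVlt; apply/orP; left; apply/eqP.
  by rewrite /t; field; rewrite gt_eqF.
have mD : measurable_fun [set: O] (fun w => `|n%:R^-1 * \sum_j xi (x j w) ^+ 2 - mu|)%R.
  apply: measurableT_comp => //; apply: measurable_funB => //; apply: measurable_funM => //.
  apply: measurable_sum => j; apply: measurable_funX; exact: measurableT_comp.
have sumf c w : (\sum_j f c (x j w) = c * (n%:R * (n%:R^-1 * \sum_j xi (x j w) ^+ 2 - mu)))%R.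
  rewrite /f -mulr_sumr sumrB sumr_const card_ord (mulrBr n%:R) mulVKf ?gt_eqF//.
  by rewrite mulr_natl.
apply: (@le_trans _ _ (P (A t `|` A (- t)%R))).
  apply: le_measure; rewrite ?inE.
  - rewrite (_ : [set w | _] = (fun w => `|n%:R^-1 * \sum_j xi (x j w) ^+ 2 - mu|)%R @^-1` `[eps, +oo[%classic).
      by rewrite -[X in measurable X]setTI; exact: mD.
    by apply/seteqP; split => w; rewrite /= in_itv/= andbT.
  - exact: measurableU.
  - move=> w /=; rewrite /A/= !sumf !mulNr lter_normr => /orP[h|h]; [left|right].
      by rewrite /= !ler_pM2l.
    by rewrite -mulrN -mulrN !ler_pM2l.
apply: le_trans; first exact: (measureU2 P (mA _) (mA _)).
rewrite mulr2n mulrDl mul1r EFinD; apply: leeD; apply: PA; rewrite ?normrN gtr0_norm//.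
Qed.

End iid_deviation.

(** * A net of the unit ball and quadratic forms on it *)

Section net.
Context (R : realType) (d : nat).
Local Notation K := (4 * d).+1%N.
Let h : R := (4 * Num.sqrt d%:R)^-1.

Definition net_point (k : {ffun 'I_d -> bool * 'I_K}) : 'cV[R]_d :=
  \col_i ((-1) ^+ (k i).1 * (k i).2%:R * h).

(** The unit ball in grid units, because [h ^ 2 = (16 * d)^-1] for positive [d]. *)
Definition in_net (k : {ffun 'I_d -> bool * 'I_K}) : bool :=
  (\sum_i ((k i).2 : nat) ^ 2 <= 16 * d)%N.

Let h2 : (0 < d)%N -> h ^+ 2 = (16 * d%:R)^-1.
Proof. by move=> d0; rewrite /h exprVn exprMn sqr_sqrtr//; congr (_^-1); rewrite -natrX. Qed.

(** Counting by weights: on the net the moduli sum to at most [16 * d], an integer being at most its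
    square, so the weight [2^-(sum of moduli)] of a point is at least [2^-(16 d)]. All weights
    together factor over coordinates and sum to at most [4 ^ d]. *)
Lemma card_net : #|[pred k | in_net k]|%:R <= 2 ^+ (18 * d) :> R.
Proof.
pose c (p : bool * 'I_K) : R := (1 / 2) ^+ p.2.
have sumc : \sum_p c p <= 4.
  rewrite -(pair_bigA _ (fun (b : bool) (j : 'I_K) => c (b, j)))/= big_bool/=.
  have H m : \sum_(j < m) (1 / 2 : R) ^+ j = 2 - 2 * (1 / 2) ^+ m.
    elim: m => [|m IH]; first by rewrite big_ord0 expr0; lra.
    by rewrite big_ord_recr/= IH exprS; lra.
  have h0 : 0 <= (1 / 2 : R) ^+ K by rewrite exprn_ge0.
  by rewrite /c/= H; lra.
have c0 p : 0 <= c p by rewrite exprn_ge0.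
apply: (@le_trans _ _ (\sum_(k : {ffun 'I_d -> bool * 'I_K}) 2 ^+ (16 * d) * \prod_i c (k i))).
  rewrite -sum1_card natr_sum (big_mkcond (fun k => k \in _))/=; apply: ler_sum => k _; rewrite inE.
  case: ifP => [knet|_]; last by rewrite mulr_ge0 ?exprn_ge0// prodr_ge0.
  have -> : \prod_i c (k i) = (1 / 2) ^+ (\sum_i (k i).2).
    by rewrite /c; apply: (big_rec2 (fun x y => x = (1 / 2) ^+ y)) => // i x y _ ->; rewrite exprD.
  have le : (\sum_i (k i).2 <= 16 * d)%N.
    apply: leq_trans knet; apply: leq_sum => i _; case: (nat_of_ord _) => // m.
    by rewrite expnS expn1 leq_pmulr.
  rewrite -(subnK le) exprD -mulrA -exprMn (_ : 2 * (1 / 2) = 1); last by lra.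
  by rewrite expr1n mulr1 exprn_ege1// ler1n.
rewrite -mulr_sumr -(bigA_distr_bigA (fun (_ : 'I_d) p => c p)) prodr_const card_ord.
rewrite (_ : 18 * d = 16 * d + 2 * d)%N; last by rewrite -mulnDl.
rewrite exprD ler_pM2l ?exprn_gt0// exprM; apply: lerXn2r; rewrite ?nnegrE ?sumr_ge0//.
by apply: le_trans sumc _; lra.
Qed.

Let net_point_coord k i : net_point k i 0 ^+ 2 = (((k i).2 : nat) ^ 2)%N%:R * h ^+ 2.
Proof. by rewrite mxE !exprMn natrX sqrr_sign mul1r. Qed.

Lemma net_point_le1 k : in_net k -> ((net_point k)^T *m net_point k) 0 0 <= 1.
Proof.
move=> knet; rewrite dotE; under eq_bigr do rewrite -expr2 net_point_coord.
rewrite -mulr_suml -natr_sum.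
have [d0|d0] := posnP d.
  suff -> : (\sum_i ((k i).2 : nat) ^ 2 = 0)%N by rewrite mul0r.
  by apply: big1 => i; have := ltn_ord i; rewrite {2}d0.
by rewrite h2// ler_pdivrMr ?mulr_gt0 ?ltr0n// mul1r -natrM ler_nat.
Qed.

(** Each coordinate is rounded towards 0, which cannot leave the ball. The error is at most [h] per
    coordinate, so its square sums to [d * h ^ 2 = 1 / 16]. *)
Lemma net_approx (v : 'cV[R]_d) : (v^T *m v) 0 0 = 1 ->
  exists2 k, in_net k & ((v - net_point k)^T *m (v - net_point k)) 0 0 <= 1 / 16.
Proof.
rewrite dotE => v1.
have d0 : (0 < d)%N.
  rewrite lt0n; apply/eqP => d0; move: v1; rewrite big1 => [/eqP|i _]; first by rewrite eq_sym oner_eq0.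
  by have := ltn_ord i; rewrite {2}d0.
have dR : 1 <= d%:R :> R by rewrite ler1n.
have sd : 1 <= Num.sqrt d%:R :> R by rewrite -[leLHS]sqrtr1; exact: ler_wsqrtr.
have sdd : Num.sqrt d%:R <= d%:R :> R.
  by rewrite -[leRHS]sqr_sqrtr ?ler0n// expr2 ler_peMr// sqrtr_ge0.
have h0 : 0 < h by rewrite invr_gt0 mulr_gt0// (lt_le_trans _ sd).
pose m i := Num.truncn (`|v i 0| / h).
have vi i : `|v i 0| <= 1.
  rewrite -(@ler_sqr _ _ 1) ?nnegrE// expr1n real_normK ?num_real// -v1 (bigD1 i)//= -expr2 lerDl.
  by rewrite sumr_ge0// => j _; rewrite -expr2 sqr_ge0.
have mv i : (m i)%:R * h <= `|v i 0| < ((m i)%:R + 1) * h.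
  rewrite -ler_pdivlMr// -ltr_pdivrMr// natr1; apply: truncn_itv; rewrite divr_ge0// ltW//.
have mK i : (m i < K)%N.
  rewrite ltnS -(ler_nat R); have /andP[H _] := mv i.
  move: H; rewrite -ler_pdivlMr// => /le_trans; apply.
  rewrite ler_pdivrMr// (le_trans (vi i))//.
  have hs : (4 * Num.sqrt d%:R) * h = 1 by rewrite divff// gt_eqF// mulr_gt0// (lt_le_trans _ sd).
  by rewrite -[leLHS]hs natrM ler_pM2r// ler_pM2l.
pose k : {ffun 'I_d -> bool * 'I_K} := [ffun i => (v i 0 < 0, inord (m i))].
have kE i : net_point k i 0 = (-1) ^+ (v i 0 < 0)%R * ((m i)%:R * h).
  by rewrite mxE ffunE/= inordK// mulrA.
exists k.
  have H : (\sum_i ((k i).2 : nat) ^ 2)%N%:R * h ^+ 2 <= 1.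
    rewrite natr_sum mulr_suml -[leRHS]v1; apply: ler_sum => i _.
    rewrite -net_point_coord kE exprMn sqrr_sign mul1r -expr2.
    rewrite -[v i 0 ^+ 2]real_normK ?num_real// ler_sqr ?nnegrE ?mulr_ge0 ?(ltW h0)//.
    by have /andP[] := mv i.
  move: H; rewrite h2// ler_pdivrMr ?mulr_gt0 ?ltr0n// mul1r -natrM ler_nat.
  exact.
rewrite dotE; apply: (@le_trans _ _ (\sum_(i < d) h ^+ 2)); last first.
  rewrite sumr_const card_ord -mulr_natl h2// le_eqVlt; apply/orP; left; apply/eqP.
  by field; rewrite pnatr_eq0 -lt0n.
apply: ler_sum => i _; rewrite -expr2 (_ : (v - _) i 0 = v i 0 - net_point k i 0); last by rewrite !mxE.
rewrite kE; set s := (-1) ^+ _; have s2 : s ^+ 2 = 1 by rewrite /s sqrr_sign.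
have vE : v i 0 = s * `|v i 0| by rewrite /s -realEsign ?num_real.
rewrite {1}vE -mulrBr exprMn s2 mul1r; have /andP[m1 m2] := mv i.
by rewrite ler_sqr ?nnegrE ?subr_ge0 ?(ltW h0)//; lra.
Qed.

(** Take a unit eigenvector for the eigenvalue of largest modulus and a net point within 1/4 of it.
    The form there is at least [1 - 1/2 - 1/16 = 7/16] of that modulus. *)
Lemma net_qform_le (A : 'M[R]_d) (e : R) : A^T = A ->
  (forall k, in_net k -> `|qform A (net_point k)| <= e) ->
  forall v, `|qform A v| <= 16 / 7 * e * (v^T *m v) 0 0.
Proof.
move=> AT Anet; have [U [a [_ [UU AE _]]]] := simultaneous_diagonalization AT AT erefl.
rewrite -/(spectral_psd U a) in AE.
have qE v : qform A v = \sum_i a 0 i * (U *m v) i 0 ^+ 2 by rewrite AE spectral_qform.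
have nE (v : 'cV[R]_d) : \sum_i (U *m v) i 0 ^+ 2 = (v^T *m v) 0 0.
  by rewrite -(orthogonal_dot v v UU) dotE; apply: eq_bigr => i _; rewrite expr2.
suff H i : `|a 0 i| <= 16 / 7 * e.
  move=> v; rewrite qE -nE mulr_sumr (le_trans (ler_norm_sum _ _ _))//; apply: ler_sum => i _.
  by rewrite normrM (@ger0_norm _ (_ ^+ 2)) ?sqr_ge0// ler_wpM2r ?sqr_ge0.
pose i0 := [arg max_(j > i) `|a 0 j|]%O.
have imax j : `|a 0 j| <= `|a 0 i0| by rewrite /i0; case: arg_maxP => // k _; apply.
apply: (le_trans (imax i)); pose v0 := U^T *m delta_mx i0 (0 : 'I_1).
have Uv0 : U *m v0 = delta_mx i0 0 by rewrite mulmxA UU mul1mx.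
have v01 : (v0^T *m v0) 0 0 = 1.
  rewrite -nE Uv0 (bigD1 i0)//= big1 => [|j ji]; last by rewrite mxE (negPf ji) expr0n.
  by rewrite mxE !eqxx expr1n addr0.
have [k knet kv] := net_approx v01.
pose w := v0 - net_point k; pose y j := (U *m w) j 0.
have yy : \sum_j y j ^+ 2 <= 1 / 16 by rewrite nE.
have yi : `|y i0| <= 1 / 4.
  rewrite -ler_sqr ?nnegrE// real_normK ?num_real//.
  apply: (@le_trans _ _ (1 / 16)); last by lra.
  apply: le_trans yy; rewrite (bigD1 i0)//= lerDl sumr_ge0// => j _; exact: sqr_ge0.
have sub (X Y : 'cV[R]_d) j : (X - Y) j 0 = X j 0 - Y j 0 by rewrite !mxE.
have qk : qform A (net_point k) = \sum_j a 0 j * y j ^+ 2 + a 0 i0 * (1 - 2 * y i0).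
  have -> : net_point k = v0 - w by rewrite /w opprB addrC subrK.
  rewrite qE mulmxBr Uv0 (bigD1 i0)//= [in RHS](bigD1 i0)//= -/(y i0).
  rewrite (eq_bigr (fun j => a 0 j * y j ^+ 2)) => [|j ji]; last first.
    by rewrite sub mxE (negPf ji) sub0r sqrrN.
  by rewrite sub mxE !eqxx -/(y i0)/=; set S := \sum_(_ | _) _; ring.
have sy : `|\sum_j a 0 j * y j ^+ 2| <= `|a 0 i0| / 16.
  apply: (le_trans (ler_norm_sum _ _ _)); apply: (@le_trans _ _ (\sum_j `|a 0 i0| * y j ^+ 2)).
    by apply: ler_sum => j _; rewrite normrM (@ger0_norm _ (_ ^+ 2)) ?sqr_ge0// ler_wpM2r ?sqr_ge0.
  by rewrite -mulr_sumr; have := ler_wpM2l (normr_ge0 (a 0 i0)) yy; lra.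
have := Anet k knet; rewrite qk => H.
have h1 : `|a 0 i0 * (1 - 2 * y i0)| <= e + `|a 0 i0| / 16.
  rewrite -[X in `|X|](addKr (\sum_j a 0 j * y j ^+ 2)) (le_trans (ler_normD _ _))// normrN addrC.
  exact: lerD.
have h2' : `|a 0 i0| * (1 / 2) <= `|a 0 i0 * (1 - 2 * y i0)|.
  rewrite normrM ler_wpM2l// ler_normr; apply/orP; left.
  by move: yi; rewrite ler_norml => /andP[_]; move: (y i0) => z; lra.
by move: h1 h2'; move: `|a 0 i0| `|a 0 i0 * _| => b c; clear; lra.
Qed.

End net.

Section finite_expectation.
Local Open Scope ereal_scope.
Context (d : measure_display) (T : measurableType d) (R : realType) (P : {measure set T -> \bar R}).

(** The difference of an infinite positive part and an infinite negative part is not finite, so a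
    moment equation with a real value already carries integrability. *)
Lemma integrable_of_finite (f : T -> R) (r : R) : measurable_fun [set: T] f ->
  \int[P]_x (f x)%:E = r%:E -> P.-integrable [set: T] (EFin \o f).
Proof.
move=> mf; have mf' : measurable_fun [set: T] (EFin \o f) by exact/measurable_EFinP.
rewrite -[X in X = _ -> _]/(\int[P]_x (EFin \o f) x) integralE => fr.
apply/integrableP; split=> //.
have p0 : 0 <= \int[P]_x (EFin \o f)^\+ x by exact: integral_ge0.
have n0 : 0 <= \int[P]_x (EFin \o f)^\- x by exact: integral_ge0.
rewrite -[X in X < _]/(\int[P]_x (abse \o (EFin \o f)) x) fune_abse ge0_integralD//; last 2 first.
- exact: measurable_funepos.
- exact: measurable_funeneg.
by move: fr p0 n0; do 2 case: (\int[P]_x _) => [?| |] //; rewrite -EFinD ltry.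
Qed.

Lemma integral_lincomb (I : finType) (c e : I -> R) (f : I -> T -> R) :
  (forall i, measurable_fun [set: T] (f i)) ->
  (forall i, \int[P]_x (f i x)%:E = (e i)%:E) ->
  \int[P]_x (\sum_i c i * f i x)%:E = (\sum_i c i * e i)%:E.
Proof.
move=> mf fe; have fint i : P.-integrable [set: T] (EFin \o f i) by exact: integrable_of_finite (fe i).
under eq_integral do rewrite -sumEFin.
rewrite (@integral_sum _ _ _ P _ measurableT _ (fun i x => (c i * f i x)%:E)); last first.
  move=> i; rewrite (_ : (fun x => _) = (fun x => (c i)%:E * (EFin \o f i) x))//.
  exact: integrableZl.
rewrite -sumEFin; apply: eq_bigr => i _.
under eq_integral do rewrite EFinM.
by rewrite (integralZl measurableT (fint i)) EFinM -fe.
Qed.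
End finite_expectation.

Section second_moment.
Local Open Scope ereal_scope.
Context (R : realType) (d : nat) (p : probability (d.-tuple R) R) (ST : 'M[R]_d).
Hypothesis mom : mean_zero_with_second_moment p ST.

Definition tform (a : 'cV[R]_d) (x : d.-tuple R) : R := ((a^T *m tcol x) 0 0)%R.

Lemma tformE a x : tform a x = (\sum_i a i 0 * tnth x i)%R.
Proof. by rewrite /tform dotE; apply: eq_bigr => i _; rewrite mxE. Qed.

Lemma measurable_tform a : measurable_fun [set: d.-tuple R] (tform a).
Proof.
rewrite (_ : tform a = (fun x => \sum_i a i 0 * tnth x i)%R); last exact/funext/tformE.
by apply: measurable_sum => i; apply: measurable_funM => //; exact: measurable_tnth.
Qed.

Lemma tform_mean a : \int[p]_x (tform a x)%:E = 0.
Proof.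
under eq_integral do rewrite tformE.
rewrite (@integral_lincomb _ _ _ p _ _ (fun=> 0%R)) => [|i|i].
- by rewrite big1// => i _; rewrite mulr0.
- exact: measurable_tnth.
- exact: mom.1.
Qed.

Lemma tform_second_moment a : \int[p]_x (tform a x ^+ 2)%:E = (qform ST a)%:E.
Proof.
pose c (ij : 'I_d * 'I_d) := (a ij.1 0 * a ij.2 0)%R.
transitivity (\int[p]_x (\sum_ij c ij * (tnth x ij.1 * tnth x ij.2))%:E).
  apply: eq_integral => x _; congr EFin; rewrite tformE expr2 big_distrlr/= pair_bigA/=.
  by apply: eq_bigr => ij _; rewrite /c mulrACA.
rewrite (@integral_lincomb _ _ _ p _ _ (fun ij => ST ij.1 ij.2)) => [|ij|ij].
- congr EFin; rewrite /qform mxE (eq_bigr (fun j => \sum_i a i 0 * a j 0 * ST i j)%R); last first.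
    by move=> j _; rewrite mxE mulr_suml; apply: eq_bigr => i _; rewrite mxE mulrAC.
  by rewrite exchange_big/= pair_bigA.
- by apply: measurable_funM; exact: measurable_tnth.
- exact: mom.2.
Qed.

Lemma second_moment_psd : psd ST.
Proof.
split=> [|v].
  apply/matrixP => i j; rewrite mxE; apply: EFin_inj; rewrite -!mom.2.
  by apply: eq_integral => x _; rewrite mulrC.
by rewrite -lee_fin -tform_second_moment integral_ge0// => x _; rewrite lee_fin sqr_ge0.
Qed.

End second_moment.

(** * Relative deviation of the sample covariance *)

Section sample_covariance.
Context (R : realType) (d n : nat) (rho : R) (p : probability (d.-tuple R) R) (ST : 'M[R]_d).
Hypothesis mom : mean_zero_with_second_moment p ST.
Hypothesis subg : subgaussian p ST rho.
Hypothesis rho0 : (0 < rho)%R.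
Let S := msqrt ST.
Variable W : 'M[R]_d.
Hypothesis WT : W^T = W.
Hypothesis WS : W *m S = S *m W.
Hypothesis SWS : S *m W *m S = S.
Hypothesis SWle : forall v : 'cV[R]_d, ((S *m W *m v)^T *m (S *m W *m v)) 0 0 <= (v^T *m v) 0 0.

Let Spsd := psd_msqrt (second_moment_psd mom).
Let ST' : S^T = S. Proof. exact: Spsd.1.1. Qed.
Let SS : S *m S = ST. Proof. exact: Spsd.2. Qed.
Let SWT : (S *m W)^T = S *m W. Proof. by rewrite trmx_mul WT ST'. Qed.
Let SWSW : S *m W *m (S *m W) = S *m W. Proof. by rewrite mulmxA SWS. Qed.

Lemma qform_whiten v : qform ST (W *m v) = ((S *m W *m v)^T *m (S *m W *m v)) 0 0.
Proof. by rewrite -mulmxA -qform_gram ST' SS. Qed.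

Lemma tform_whiten (q : 'cV[R]_d) (y : 'cV[R]_d) x : tcol x = S *m y ->
  tform (W *m q) x = ((S *m W *m q)^T *m y) 0 0.
Proof.
by move=> xy; rewrite /tform xy [(W *m q)^T]trmx_mul WT [(S *m W *m q)^T]trmx_mul SWT -WS !mulmxA.
Qed.

(** For singular [S] the vector [xbar] is determined only up to the kernel of [S], and its mean [m]
    may be nonzero. But the direction [S *m W *m q] lies in the range of [S], and its product with
    [m] is the mean of a linear form of [x], which is 0. *)
Lemma tform_mgf (q : 'cV[R]_d) (s : R) : ((q^T *m q) 0 0 <= 1)%R ->
  (\int[p]_x (expR (s * tform (W *m q) x))%:E <= (expR (s ^+ 2 * rho ^+ 2 / 2))%:E)%E.
Proof.
move=> q1; have [xbar [m [mxbar [xbarE [xbarm sub]]]]] := subg.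
pose v := S *m W *m q.
pose g x := ((v^T *m xbar x) 0 0)%R.
have gE x : g x = (\sum_k v k 0 * xbar x k 0)%R by rewrite /g dotE.
have mg : measurable_fun [set: d.-tuple R] g.
  rewrite (_ : g = fun x => \sum_k v k 0 * xbar x k 0)%R; last exact/funext.
  by apply: measurable_sum => k; exact: measurable_funM.
have mf := measurable_tform (W *m q).
have fg : {ae p, forall x, tform (W *m q) x = g x}.
  by apply: filterS xbarE => x xE; exact: tform_whiten.
have vm : ((v^T *m m) 0 0 = 0)%R.
  apply: EFin_inj; rewrite -[RHS](tform_mean mom (W *m q)).
  transitivity (\int[p]_x (g x)%:E)%E.
    under eq_integral do rewrite gE.
    by rewrite (integral_lincomb _ mxbar xbarm) dotE.
  apply: ae_eq_integral => //; [exact/measurable_EFinP|exact/measurable_EFinP|].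
  by apply: filterS fg => x xE _; rewrite xE.
have mexp (f : d.-tuple R -> R) : measurable_fun [set: d.-tuple R] f ->
    measurable_fun [set: d.-tuple R] (fun x => (expR (s * f x))%:E).
  by move=> ?; apply/measurable_EFinP; apply: measurableT_comp => //; exact: measurable_funM.
have -> : (\int[p]_x (expR (s * tform (W *m q) x))%:E = \int[p]_x (expR (s * g x))%:E)%E.
  apply: ae_eq_integral => //; [exact: mexp|exact: mexp|].
  by apply: filterS fg => x xE _; rewrite xE.
pose nv := l2norm v.
have nv1 : (nv ^+ 2 <= 1)%R by rewrite l2norm_sq (le_trans (SWle q)).
have [nv0|nv0] := eqVneq nv 0%R.
  have v0 : v = 0 by apply: dot_eq0; rewrite -l2norm_sq -/nv nv0 expr0n.
  rewrite (eq_integral (cst 1%:E)) => [|x _]; last by rewrite /g v0 trmx0 mul0mx mxE mulr0 expR0.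
  rewrite (integral_prob_cst p 1) lee_fin -expR0 ler_expR.
  by rewrite divr_ge0// mulr_ge0 ?sqr_ge0.
have nvp : (0 < nv)%R by rewrite lt0r nv0 l2norm_ge0.
have u1 : l2norm (nv^-1 *: v) = 1%R.
  apply/eqP; rewrite -(eqrXn2 (n := 2)) ?l2norm_ge0// expr1n l2norm_sq.
  by rewrite dot_scale -l2norm_sq -/nv exprVn mulVf// expf_neq0.
have := sub _ (s * nv)%R u1; rewrite (eq_integral (fun x => (expR (s * g x))%:E)) => [H|x _].
  apply: (le_trans H); rewrite lee_fin ler_expR ler_pM2r ?invr_gt0// ler_wpM2r ?sqr_ge0// exprMn.
  by rewrite ler_piMr ?sqr_ge0.
rewrite trmx_scale -scalemxAl mxE mulmxBr mx_subE vm subr0 -/(g x).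
by rewrite -mulrA mulVKf.
Qed.

(** In a direction of unit variance the bound 3/2 of [subgaussian_exp_sq] is at least
    [1 + (4 * rho ^ 2)^-1]. This ensures the limit on the deviation in [sq_deviation]. *)
Lemma rho_ge (v : 'cV[R]_d) : S *m W *m v != 0 -> 1 / 2 <= rho ^+ 2.
Proof.
move=> v0; pose u := S *m W *m v; pose q := ((l2norm u)^-1 *: u).
have n0 : l2norm u != 0.
  by apply: contra v0 => /eqP u0; apply/eqP; apply: dot_eq0; rewrite -l2norm_sq -/u u0 expr0n.
have q1 : (q^T *m q) 0 0 = 1.
  by rewrite dot_scale -l2norm_sq exprVn mulVf// expf_neq0.
have Pq : S *m W *m q = q by rewrite /q -scalemxAr mulmxA SWSW.
have q1' : (q^T *m q) 0 0 <= 1 by rewrite q1.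
have mt := measurable_tform (W *m q).
have H := subgaussian_exp_sq mt rho0 (fun s => tform_mgf s q1').
have sec : (\int[p]_x (tform (W *m q) x ^+ 2)%:E = 1)%E.
  by rewrite (tform_second_moment mom) qform_whiten Pq q1.
have r2 : 0 < 4 * rho ^+ 2 by rewrite mulr_gt0 ?exprn_gt0.
have : ((1 + (4 * rho ^+ 2)^-1)%:E <= (3 / 2)%:E :> \bar R)%E.
  apply: le_trans H.
  have -> : ((1 + (4 * rho ^+ 2)^-1)%:E = \int[p]_x (1%:E + (4 * rho ^+ 2)^-1%:E * (tform (W *m q) x ^+ 2)%:E) :> \bar R)%E.
    have msq : measurable_fun [set: d.-tuple R] (fun x => (tform (W *m q) x ^+ 2)%:E).
      by apply/measurable_EFinP; exact: measurable_funX.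
    rewrite ge0_integralD//; last 2 first.
    - by move=> x _; rewrite -EFinM lee_fin mulr_ge0 ?sqr_ge0// invr_ge0 ltW.
    - exact: measurable_funeM.
    rewrite ge0_integralZl//; last 2 first.
    - by move=> x _; rewrite lee_fin sqr_ge0.
    - by rewrite lee_fin invr_ge0 ltW.
    by rewrite sec mule1 (integral_prob_cst p 1) EFinD.
  apply: ge0_le_integral => //.
  - by move=> x _; rewrite -EFinM lee_fin addr_ge0// mulr_ge0 ?sqr_ge0// invr_ge0 ltW.
  - by apply/measurable_EFinP; apply: measurable_funD => //; apply: measurable_funM => //; exact: measurable_funX.
  - apply/measurable_EFinP; apply: measurableT_comp => //; apply: measurable_funM => //.
    exact: measurable_funX.
  - by move=> x _; rewrite -EFinM -EFinD lee_fin mulrC expR_ge1Dx.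
rewrite lee_fin => h; have h1 : (4 * rho ^+ 2)^-1 <= 2^-1 by lra.
by move: h1; rewrite lef_pV2 ?posrE//; lra.
Qed.

Context (dO : measure_display) (O : measurableType dO) (P : probability O R).
Variable x : 'I_n -> O -> d.-tuple R.
Hypothesis xiid : iid_sample P p x.
Hypothesis n0 : (0 < n)%N.
Let SU w := emp_cov (\matrix_(i < n, j < d) tnth (x i w) j).

Lemma qform_emp_cov w v : qform (SU w) v = n%:R^-1 * \sum_j tform v (x j w) ^+ 2.
Proof.
rewrite /SU /emp_cov qformZ qform_gram dotE; congr (_ * _); apply: eq_bigr => j _.
rewrite -expr2; congr (_ ^+ 2); rewrite tformE mxE; apply: eq_bigr => i _.
by rewrite mxE mulrC.
Qed.

Lemma emp_cov_sym w : (SU w)^T = SU w.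
Proof. by rewrite /SU /emp_cov linearZ/= trmx_mul trmxK. Qed.

(** The range of [msqrt ST], which contains the rows almost surely. A relative bound forces [SU] to
    vanish wherever [ST] does, and only this event gives that. *)
Let in_range : set (d.-tuple R) := [set y | S *m W *m tcol y = tcol y].

Let range_form (i : 'I_d) : 'cV[R]_d := (row i (S *m W - 1%:M))^T.

Lemma in_rangeE y : in_range y <-> forall i, tform (range_form i) y = 0.
Proof.
have E i : tform (range_form i) y = ((S *m W - 1%:M) *m tcol y) i 0.
  by rewrite /tform /range_form trmxK -row_mul mxE.
rewrite /in_range/=; split=> [yE i|H].
  by rewrite E mulmxBl mul1mx yE subrr mxE.
by apply/eqP; rewrite -subr_eq0 -{2}[tcol y]mul1mx -mulmxBl; apply/eqP/colP => i; rewrite -E H mxE.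
Qed.

Lemma measurable_in_range : measurable in_range.
Proof.
rewrite (_ : in_range = \bigcap_(i in [set: 'I_d]) (tform (range_form i) @^-1` [set 0])).
  apply: fin_bigcap_measurable => // i _; rewrite -[X in measurable X]setTI.
  exact: measurable_tform.
apply/seteqP; split => y; first by move/in_rangeE => H i _; exact: H.
by move=> H; apply/in_rangeE => i; exact: H.
Qed.

Lemma in_range_null : p (~` in_range) = 0%E.
Proof.
apply: measure_negligible; first exact: measurableC measurable_in_range.
have [xbar [m [_ [xbarE _]]]] := subg.
by apply: filterS xbarE => y yE; rewrite /in_range/= yE mulmxA SWS.
Qed.

Lemma union_bound (I : finType) (A : I -> set O) (b : I -> R) : (forall i, measurable (A i)) ->
  (forall i, (P (A i) <= (b i)%:E)%E) ->
  exists U, [/\ measurable U, forall i, A i `<=` U & (P U <= (\sum_i b i)%:E)%E].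
Proof.
move=> mA bA; pose U := \big[setU/set0]_i A i.
have [mU PU] : measurable U /\ (P U <= (\sum_i b i)%:E)%E.
  apply: (big_rec2 (fun V s => measurable V /\ (P V <= s%:E)%E)).
    by split=> //; rewrite measure0.
  move=> i V s _ [mV PV]; split; first exact: measurableU.
  by apply: (le_trans (measureU2 P (mA i) mV)); rewrite EFinD; exact: leeD (bA i) PV.
by exists U; split=> // i w Aw; rewrite /U (bigD1 i)//=; left.
Qed.

Lemma prob_setC_ge (U : set O) (delta : R) : measurable U -> (P U <= delta%:E)%E ->
  (P (~` U) >= (1 - delta)%:E)%E.
Proof.
by move=> mU Ud; rewrite probability_setC// EFinB; exact: leeB.
Qed.

Lemma dev_prob (q : 'cV[R]_d) (e : R) : (q^T *m q) 0 0 <= 1 -> 0 < e <= 6 * 16 * rho ^+ 2 ->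
  (P [set w | (e <= `|qform (SU w) (W *m q) - qform ST (W *m q)|)%R] <=
    (2 * expR (- (n%:R * e ^+ 2 / (6 * 16 ^+ 2 * rho ^+ 4))))%:E)%E.
Proof.
move=> q1 e0; have [mx [xlaw xprod]] := xiid.
have sec : (\int[p]_y (tform (W *m q) y ^+ 2)%:E = (qform ST (W *m q))%:E)%E.
  exact: tform_second_moment.
have := sq_deviation mx xlaw xprod n0 rho0 (measurable_tform _) (fun s => tform_mgf s q1) sec e0.
by under [X in P X]eq_set do rewrite -qform_emp_cov.
Qed.

Lemma measurable_dev (q : 'cV[R]_d) (e : R) :
  measurable [set w | e <= `|qform (SU w) (W *m q) - qform ST (W *m q)|].
Proof.
have [mx _] := xiid.
have mD : measurable_fun [set: O] (fun w => `|qform (SU w) (W *m q) - qform ST (W *m q)|).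
  apply: measurableT_comp => //; apply: measurable_funB => //.
  rewrite (_ : (fun w => _) = (fun w => n%:R^-1 * \sum_j tform (W *m q) (x j w) ^+ 2)); last by apply/funext => w; exact: qform_emp_cov.
  apply: measurable_funM => //; apply: measurable_sum => j; apply: measurable_funX.
  by apply: measurableT_comp => //; exact: measurable_tform.
rewrite (_ : [set w | _] = (fun w => `|qform (SU w) (W *m q) - qform ST (W *m q)|) @^-1` `[e, +oo[%classic).
  by rewrite -[X in measurable X]setTI; exact: mD.
by apply/seteqP; split => w; rewrite /= in_itv/= andbT.
Qed.

(** The net bound is applied to the whitened difference [A] at [S *m v]. On the range,
    [W *m (S *m v)] gives the same sample values as [v], so the estimate returns to all [v], those
    in the kernel included. *)
Lemma whiten_deviation w e : (forall j, in_range (x j w)) ->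
  (forall k : {ffun 'I_d -> bool * 'I_(4 * d).+1}, in_net k ->
    `|qform (SU w) (W *m net_point R k) - qform ST (W *m net_point R k)| <= e) ->
  forall v, `|qform (SU w) v - qform ST v| <= 16 / 7 * e * qform ST v.
Proof.
move=> xr Hnet v; pose A := W^T *m (SU w - ST) *m W.
have qA q : qform A q = qform (SU w) (W *m q) - qform ST (W *m q).
  by rewrite /A qform_congr qformB.
have AT : A^T = A.
  by rewrite /A !trmx_mul trmxK linearB/= emp_cov_sym (second_moment_psd mom).1 mulmxA.
have := net_qform_le AT (e := e) _ (S *m v); rewrite qA.
have -> : ((S *m v)^T *m (S *m v)) 0 0 = qform ST v by rewrite -qform_gram ST' SS.
have -> : qform ST (W *m (S *m v)) = qform ST v.
  by rewrite qform_whiten (mulmxA (S *m W)) SWS -qform_gram ST' SS.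
have -> : qform (SU w) (W *m (S *m v)) = qform (SU w) v.
  rewrite !qform_emp_cov; congr (_ * _); apply: eq_bigr => j _; congr (_ ^+ 2).
  rewrite /tform mulmxA WS trmx_mul SWT -mulmxA; congr ((_ *m _) 0 0); exact: xr.
by apply => k knet; rewrite qA; exact: Hnet.
Qed.

Lemma sample_covariance (delta : R) : 0 < delta < 1 -> (0 < d)%N ->
  forall eps, eps = Num.sqrt (rho ^+ 4 * (d%:R + ln delta^-1) / n%:R) -> eps <= 1 / 8 ->
  exists E : set O, [/\ measurable E, (P E >= (1 - delta)%:E)%E &
    forall w, E w -> forall v, `|qform (SU w) v - qform ST v| <= 16 / 7 * (12 * 16 * eps) * qform ST v].
Proof.
move=> /andP[delta0 delta1] d0 eps epsE eps1.
have [mx [xlaw xprod]] := xiid.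
pose L := ln delta^-1; have L0 : 0 < L by rewrite ln_gt0// invf_gt1.
(* Chosen to make the Chernoff exponent equal to [24 * (d + L)]. This pays for the [18 * d] of the
   net, the factor 2 and [delta = expR (- L)]. *)
pose e := 12 * 16 * eps.
have nR : 0 < n%:R :> R by rewrite ltr0n.
have dL : 0 < d%:R + L by rewrite ltr_wpDl.
have eps2 : eps ^+ 2 = rho ^+ 4 * (d%:R + L) / n%:R.
  by rewrite epsE sqr_sqrtr// divr_ge0// mulr_ge0 ?exprn_ge0// ltW.
have eps0 : 0 < eps by rewrite epsE sqrtr_gt0 divr_gt0// mulr_gt0 ?exprn_gt0.
pose B j := x j @^-1` (~` in_range).
have mB j : measurable (B j).
  by rewrite -[X in measurable X]setTI; apply: mx => //; exact: measurableC measurable_in_range.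
have PB j : (P (B j) <= (0 : R)%:E)%E.
  by rewrite [P _]xlaw ?in_range_null//; exact: measurableC measurable_in_range.
have [U1 [mU1 BU1 PU1]] := union_bound mB PB.
have rU1 w : ~ U1 w -> forall j, in_range (x j w).
  by move=> H j; apply: contrapT => nr; apply: H; exact: (BU1 j).
rewrite big1// in PU1.
have [[v0 v0P]|H0] := pselect (exists v : 'cV[R]_d, S *m W *m v != 0); last first.
  have SW0 (v : 'cV[R]_d) : S *m W *m v = 0.
    by apply/eqP; apply: contrapT => /negP nz; apply: H0; exists v.
  have ST0 v : qform ST v = 0.
    have -> : qform ST v = ((S *m v)^T *m (S *m v)) 0 0 by rewrite -qform_gram ST' SS.
    by rewrite -SWS -mulmxA SW0 mulmx0 mxE.
  exists (~` U1); split; first exact: measurableC.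
    by apply: prob_setC_ge => //; apply: le_trans PU1 _; rewrite lee_fin ltW.
  move=> w /rU1 xr v; rewrite ST0 mulr0 subr0 qform_emp_cov big1 ?mulr0 ?normr0// => j _.
  by rewrite /tform -(xr j) SW0 mulmx0 mxE expr0n.
have rho1 := rho_ge v0P.
(* [eps <= 1 / 8] gives [e <= 24], and [rho ^ 2 >= 1 / 2] makes the right side at least 48. *)
have e_range : 0 < e <= 6 * 16 * rho ^+ 2.
  by rewrite /e mulr_gt0//=; lra.
pose c := 2 * expR (- (n%:R * e ^+ 2 / (6 * 16 ^+ 2 * rho ^+ 4))).
pose D (k : {ffun 'I_d -> bool * 'I_(4 * d).+1}) : set O := if in_net k then
  [set w | e <= `|qform (SU w) (W *m net_point R k) - qform ST (W *m net_point R k)|] else set0.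
have mD k : measurable (D k) by rewrite /D; case: ifP => // _; exact: measurable_dev.
have PD k : (P (D k) <= (if in_net k then c else 0)%:E)%E.
  rewrite /D; case: ifP => knet; last by rewrite measure0.
  by apply: dev_prob => //; exact: net_point_le1.
have [U2 [mU2 DU2 PU2]] := union_bound mD PD.
exists (~` (U1 `|` U2)); split; first by apply: measurableC; exact: measurableU.
  apply: prob_setC_ge; first exact: measurableU.
  apply: (le_trans (measureU2 P mU1 mU2)).
  apply: (@le_trans _ _ (0%:E + (\sum_k (if in_net k then c else 0))%:E)%E).
    apply: leeD; first exact: PU1.
    exact: PU2.
  rewrite add0e lee_fin -big_mkcond/= sumr_const -mulr_natl.
  apply: (@le_trans _ _ (2 ^+ (18 * d) * c)).
    by rewrite ler_wpM2r ?mulr_ge0 ?expR_ge0//; exact: (card_net R d).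
  have -> : c = 2 * expR (- (24 * (d%:R + L))).
    rewrite /c /e exprMn eps2; congr (_ * expR (- _)); field.
    by rewrite !gt_eqF.
  have two : 2 <= expR 1 :> R by have := expR_ge1Dx (1 : R); lra.
  apply: (@le_trans _ _ (expR (18 * d)%:R * (expR 1 * expR (- (24 * (d%:R + L)))))).
    apply: ler_pM; rewrite ?exprn_ge0 ?mulr_ge0 ?expR_ge0//; last by rewrite ler_wpM2r ?expR_ge0.
    by rewrite -[(18 * d)%:R]mulr1 expRM_natl lerXn2r ?nnegrE ?expR_ge0.
  have -> : delta = expR (- L) by rewrite /L lnV ?posrE// opprK lnK ?posrE.
  have d1 : 1 <= d%:R :> R by rewrite ler1n.
  by rewrite -!expRD ler_expR natrM; lra.
move=> w /not_orP[/rU1 xr nU2]; apply: whiten_deviation => // k knet.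
rewrite leNgt; apply/negP => /ltW H; apply: nU2; apply: (DU2 k).
by rewrite /D knet.
Qed.

End sample_covariance.

(** * The program *)

Section trace_forms.
Context (R : realType).

Lemma trace_gram n m (A : 'M[R]_n) (B : 'M[R]_(n, m)) :
  \tr (B^T *m A *m B) = \sum_j qform A (col j B).
Proof.
rewrite /mxtrace; apply: eq_bigr => j _.
by rewrite /qform tr_col -row_mul mxE [RHS]mxE; apply: eq_bigr => i _; rewrite !mxE.
Qed.

Lemma trace_gram_ge0 n m (A : 'M[R]_n) (B : 'M[R]_(n, m)) : psd A -> 0 <= \tr (B^T *m A *m B).
Proof. by move=> [_ A0]; rewrite trace_gram sumr_ge0. Qed.

Lemma trace_gram_le n m (A1 A2 : 'M[R]_n) (c : R) (B : 'M[R]_(n, m)) :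
  (forall v, qform A1 v <= c * qform A2 v) ->
  \tr (B^T *m A1 *m B) <= c * \tr (B^T *m A2 *m B).
Proof. by move=> H; rewrite !trace_gram mulr_sumr ler_sum. Qed.

Lemma emp_cov_psd n d (X : 'M[R]_(n, d)) : psd (emp_cov X).
Proof.
split=> [|v]; first by rewrite /emp_cov linearZ/= trmx_mul trmxK.
by rewrite /emp_cov qformZ mulr_ge0 ?invr_ge0// qform_gram_ge0.
Qed.

Lemma invmx_gram n (A : 'M[R]_n) : psd A -> A \in unitmx -> exists G : 'M[R]_n,
  G \in unitmx /\ invmx A = G *m G^T.
Proof.
move=> Apsd Au; have [[ST' _] SS] := psd_msqrt Apsd; set S := msqrt A in ST' SS.
have Su : S \in unitmx.
  by move: Au; rewrite -SS unitmx_mul => /andP[].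
exists (invmx S); split; first by rewrite unitmx_inv.
apply: (can_inj (mulKmx Au)); rewrite mulmxV// trmx_inv ST' -SS -mulmxA (mulmxA S (invmx S)).
by rewrite mulmxV// mul1mx mulmxV.
Qed.

Lemma noise_trace d (C V G SU : 'M[R]_d) : V = G *m G^T ->
  \tr (C *m V *m C^T *m SU) = \tr ((C *m G)^T *m SU *m (C *m G)).
Proof. by move=> ->; rewrite trmx_mul [RHS]mxtrace_mulC !mulmxA. Qed.

End trace_forms.

Section linear_risk.
Local Open Scope ereal_scope.
Context (R : realType) (dO : measure_display) (O : measurableType dO) (Q : probability O R)
  (nS d : nat) (sigma : R) (z : 'I_nS -> O -> R).
Hypothesis sigma0 : (0 < sigma)%R.
Hypothesis zQ : iid_gaussian_noise Q sigma z.
Variables (XS : 'M[R]_(nS, d)) (ST : 'M[R]_d).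
Hypothesis STpsd : psd ST.

Lemma linear_risk (A : 'M[R]_(d, nS)) (beta : 'cV[R]_d) :
  risk Q z XS ST (fun y => A *m y) beta =
  (qform ST ((A *m XS - 1%:M) *m beta) + sigma ^+ 2 * \tr (A^T *m ST *m A))%:E.
Proof.
have [[S' _] SS] := psd_msqrt STpsd; pose S := msqrt ST.
pose b := S *m ((A *m XS - 1%:M) *m beta).
rewrite /risk; transitivity (\int[Q]_w \sum_(k < d) ((b k 0 + \sum_j (S *m A) k j * z j w) ^+ 2)%:E).
  apply: eq_integral => w _; rewrite sumEFin; congr EFin.
  rewrite l2norm_sq dotE; apply: eq_bigr => k _; rewrite -expr2; congr (_ ^+ 2)%R.
  rewrite (_ : msqrt ST *m _ = (b + S *m A *m (\col_j z j w))%R); last first.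
    by rewrite /b mulmxDr mulmxA mulmxBl mul1mx !mulmxBr mulmxDr !mulmxA addrAC.
  by rewrite mxE; congr (_ + _)%R; rewrite mxE; apply: eq_bigr => j _; congr (_ * _)%R; rewrite mxE.
rewrite ge0_integral_sum//; last 2 first.
- move=> k; apply/measurable_EFinP; apply: measurable_funX; apply: measurable_funD => //.
  by apply: measurable_sum => j; apply: measurable_funM => //; exact: zQ.1.
- by move=> k w _; rewrite lee_fin sqr_ge0.
under eq_bigr do rewrite (linear_form_second_moment sigma0 zQ).
rewrite sumEFin; congr EFin; rewrite big_split/=; congr (_ + _)%R.
  rewrite -(msqrt_l2norm _ STpsd) l2norm_sq dotE.
  by apply: eq_bigr => k _; rewrite expr2.
rewrite -mulr_sumr; congr (_ * _)%R.
rewrite trace_gram (eq_bigr (fun j => \sum_k (S *m A) k j ^+ 2)%R) => [|j _].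
  by rewrite exchange_big.
rewrite -(msqrt_l2norm _ STpsd) l2norm_sq dotE.
apply: eq_bigr => k _; rewrite -expr2; congr (_ ^+ 2)%R; rewrite [LHS]mxE [RHS]mxE.
by apply: eq_bigr => l _; rewrite mxE.
Qed.

Hypothesis nS0 : (0 < nS)%N.
Hypothesis d0 : (0 < d)%N.
Variable r : R.
Hypothesis r0 : (0 < r)%R.
Let SS := emp_cov XS.
Hypothesis SSu : SS \in unitmx.

Lemma emp_cov_gram : XS^T *m XS = nS%:R *: SS.
Proof. by rewrite /SS /emp_cov scalerA divff ?scale1r// pnatr_eq0 -lt0n. Qed.

Definition est (C : 'M[R]_d) : 'M[R]_(d, nS) := nS%:R^-1 *: (C *m invmx SS *m XS^T).

Lemma est_XS C : est C *m XS = C.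
Proof.
rewrite /est -scalemxAl -mulmxA emp_cov_gram -scalemxAr scalerA mulVf ?pnatr_eq0 -?lt0n//.
by rewrite scale1r -mulmxA mulVmx// mulmx1.
Qed.

Lemma SSsym : (invmx SS)^T = invmx SS.
Proof. by rewrite trmx_inv (emp_cov_psd XS).1. Qed.

Lemma est_gram C : est C *m (est C)^T = nS%:R^-1 *: (C *m invmx SS *m C^T).
Proof.
rewrite {2}/est trmx_scale !trmx_mul trmxK SSsym -scalemxAr !mulmxA est_XS.
by [].
Qed.

Lemma est_noise C : \tr ((est C)^T *m ST *m est C) = (nS%:R^-1 * \tr (C *m invmx SS *m C^T *m ST))%R.
Proof. by rewrite mxtrace_mulC mulmxA est_gram -scalemxAl mxtraceZ. Qed.

(** Gauss-Markov: the difference [B] satisfies [B *m XS = 0], whereas [est] ends in [XS^T], so the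
    cross terms vanish and [B] only adds noise. *)
Lemma noise_le (A : 'M[R]_(d, nS)) :
  (\tr ((est (A *m XS))^T *m ST *m est (A *m XS)) <= \tr (A^T *m ST *m A))%R.
Proof.
pose B := (A - est (A *m XS))%R.
have BX : B *m XS = 0%R by rewrite mulmxBl est_XS subrr.
have eB : est (A *m XS) *m B^T = 0%R.
  by rewrite /est -scalemxAl -[_ *m XS^T *m _]mulmxA -trmx_mul BX trmx0 mulmx0 scaler0.
have Be : B *m (est (A *m XS))^T = 0%R by rewrite -[LHS]trmxK trmx_mul trmxK eB trmx0.
have -> : \tr (A^T *m ST *m A) = (\tr ((est (A *m XS))^T *m ST *m est (A *m XS)) + \tr (B^T *m ST *m B))%R.
  rewrite ![\tr (_ *m _ *m _)]mxtrace_mulC !mulmxA -mxtraceD -mulmxDl; congr (\tr (_ *m _)).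
  have {1 2}-> : A = (est (A *m XS) + B)%R by rewrite /B addrC subrK.
  by rewrite linearD/= mulmxDl !mulmxDr eB Be addr0 add0r.
by rewrite lerDl trace_gram_ge0.
Qed.

Lemma LB_est_le C tau : prog_feasible ST C tau ->
  LB Q z XS ST r (fun y => est C *m y) <= (prog_obj nS sigma r SS ST C tau)%:E.
Proof.
move=> feas; apply: ge_ereal_sup => _ [beta br <-].
rewrite linear_risk est_XS lee_fin /prog_obj est_noise mulrA; apply: lerD => //.
have tau0 : (0 <= tau)%R.
  pose e : 'cV[R]_d := delta_mx (Ordinal d0) 0%R.
  have := feas e; rewrite qform_congr qform_scalar.
  have -> : ((e^T *m e) 0 0 = 1 :> R)%R.
    rewrite dotE (bigD1 (Ordinal d0))//= big1 => [|j jd]; first by rewrite mxE !eqxx mulr1 addr0.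
    by rewrite mxE (negPf jd) mulr0.
  by rewrite mulr1; apply: le_trans; exact: STpsd.2.
have := feas beta; rewrite qform_congr qform_scalar => /le_trans; apply.
by rewrite mulrC ler_wpM2r// -dot_le// ltW.
Qed.

(** [tau] is what the worst-case risk leaves for the squared bias, divided by [r ^ 2]. Rescaling any
    [v] to norm [r] turns the risk bound at that point into feasibility. *)
Lemma prog_le_LB (A : 'M[R]_(d, nS)) (L : R) :
  LB Q z XS ST r (fun y => A *m y) = L%:E ->
  exists tau, prog_feasible ST (A *m XS) tau /\ (prog_obj nS sigma r SS ST (A *m XS) tau <= L)%R.
Proof.
move=> LE; pose nz := (sigma ^+ 2 * \tr (A^T *m ST *m A))%R.
exists ((L - nz) / r ^+ 2)%R; split; last first.
  rewrite /prog_obj mulrCA divff ?mulr1 ?expf_neq0 ?gt_eqF//.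
  have := noise_le A; rewrite est_noise => H.
  have := ler_wpM2l (sqr_ge0 sigma) H; rewrite /nz mulrA; lra.
move=> v; rewrite qform_congr qform_scalar.
have [->|v0] := eqVneq v 0%R; first by rewrite !mulmx0 /qform trmx0 !mul0mx mxE mulr0.
have n0 : (l2norm v != 0)%R.
  by apply: contra v0 => /eqP n0; apply/eqP; apply: dot_eq0; rewrite -l2norm_sq n0 expr0n.
have np : (0 < l2norm v)%R by rewrite lt0r n0 l2norm_ge0.
pose beta := (r / l2norm v)%R *: v.
have : risk Q z XS ST (fun y => A *m y) beta <= L%:E.
  rewrite -LE; apply: ereal_sup_ubound; exists beta => //=.
  by rewrite dot_le ?(ltW r0)// dot_scale -l2norm_sq -exprMn divfK.
rewrite linear_risk lee_fin /beta -scalemxAr qform_scale -/nz expr_div_n => H.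
rewrite mulrAC ler_pdivlMr ?exprn_gt0// -l2norm_sq.
move: H; rewrite -lerBrDr -mulrA mulrC -mulrA => H.
have n2 : (0 < l2norm v ^+ 2)%R by rewrite exprn_gt0.
by rewrite [leRHS]mulrC -ler_pdivrMl.
Qed.

Lemma lee_mul_inf (c : R) (a : \bar R) (X : set \bar R) : (0 < c)%R ->
  (forall y, X y -> a <= c%:E * y) -> a <= c%:E * ereal_inf X.
Proof.
move=> c0 H; rewrite -lee_pdivrMl//; apply: le_ereal_inf_tmp => y Xy.
by rewrite lee_pdivrMl// H.
Qed.

(** [C] stays feasible for [ST] with [tau / (1 - u)], and [C1] is feasible for [SU] with
    [(1 + u) * tau1]. The competitor is an arbitrary pair feasible for [ST], so the lemma serves
    both inequalities of the theorem. *)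
Lemma deviation_transfer (SU C C1 : 'M[R]_d) (u tau tau1 : R) : (0 <= u < 1)%R ->
  (forall v, `|qform SU v - qform ST v| <= u * qform ST v)%R ->
  prog_optimal nS sigma r SS SU C tau -> prog_feasible ST C1 tau1 ->
  LB Q z XS ST r (fun y => est C *m y) <=
    ((1 + u) / (1 - u) * prog_obj nS sigma r SS ST C1 tau1)%:E.
Proof.
move=> /andP[u0 u1] dev [feas opt] feas1; have u1' : (0 < 1 - u)%R by rewrite subr_gt0.
have STU v : (qform ST v <= (1 - u)^-1 * qform SU v)%R.
  by rewrite mulrC ler_pdivlMr//; have := dev v; rewrite ler_norml => /andP[]; lra.
have SUT v : (qform SU v <= (1 + u) * qform ST v)%R.
  by have := dev v; rewrite ler_norml => /andP[]; lra.
have [G [_ GE]] := invmx_gram (emp_cov_psd XS) SSu.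
have noise1 (S1 S2 : 'M[R]_d) c D : (forall v, qform S1 v <= c * qform S2 v)%R ->
    (\tr (D *m invmx SS *m D^T *m S1) <= c * \tr (D *m invmx SS *m D^T *m S2))%R.
  by move=> H; rewrite !(noise_trace _ _ GE) trace_gram_le.
have sn : (0 <= sigma ^+ 2 / nS%:R)%R by rewrite divr_ge0 ?sqr_ge0.
have feasT : prog_feasible ST C ((1 - u)^-1 * tau)%R.
  move=> v; rewrite qform_congr qform_scalar; apply: (le_trans (STU _)).
  by rewrite -mulrA ler_pM2l ?invr_gt0//; have := feas v; rewrite qform_congr qform_scalar.
have feasU : prog_feasible SU C1 ((1 + u) * tau1)%R.
  move=> v; rewrite qform_congr qform_scalar; apply: (le_trans (SUT _)).
  by rewrite -mulrA ler_pM2l ?ltr_pwDl//; have := feas1 v; rewrite qform_congr qform_scalar.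
apply: (le_trans (LB_est_le feasT)); rewrite lee_fin.
apply: (@le_trans _ _ ((1 - u)^-1 * prog_obj nS sigma r SS SU C tau))%R.
  rewrite /prog_obj mulrDr; apply: lerD; first by rewrite mulrCA.
  by rewrite mulrCA ler_wpM2l// noise1.
rewrite (mulrC (1 + u)%R) -mulrA ler_pM2l ?invr_gt0//; apply: (le_trans (opt _ _ feasU)).
rewrite /prog_obj mulrDr; apply: lerD; first by rewrite mulrCA.
by rewrite mulrCA ler_wpM2l// noise1.
Qed.

End linear_risk.

(** * Existence of an optimal solution *)

Section polynomial_continuity.
Context (T : topologicalType) (R : realType).
Implicit Types f g : T -> R.

Lemma continuous_addr f g : continuous f -> continuous g -> continuous (fun t => f t + g t).
Proof. by move=> cf cg t; apply: cvgD; [exact: cf|exact: cg]. Qed.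

Lemma continuous_mulr f g : continuous f -> continuous g -> continuous (fun t => f t * g t).
Proof. by move=> cf cg t; apply: cvgM; [exact: cf|exact: cg]. Qed.

Lemma continuous_cst (c : R) : continuous (fun _ : T => c).
Proof. by move=> t; exact: cvg_cst. Qed.

Lemma continuous_sumr (I : Type) (s : seq I) (f : I -> T -> R) : (forall i, continuous (f i)) ->
  continuous (fun t => \sum_(i <- s) f i t).
Proof.
move=> cf; elim: s => [|i s IH].
  by under eq_fun do rewrite big_nil; exact: continuous_cst.
by under eq_fun do rewrite big_cons; apply: continuous_addr; [exact: cf|exact: IH].
Qed.

Lemma closed_le_fun f (c : R) : continuous f -> closed [set t | f t <= c].
Proof. by move=> cf; apply: (@preimage_closed _ _ f [set x | x <= c]) => [t _|]; [exact: cf|exact: closed_le]. Qed.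

End polynomial_continuity.

Section program_minimizer.
Context (R : realType) (d : nat) (a c : R) (S G : 'M[R]_d).
Hypothesis d0 : (0 < d)%N.
Hypothesis a0 : 0 < a.
Hypothesis c0 : 0 < c.
Hypothesis Gu : G \in unitmx.

Let feas (D : 'M[R]_d) (tau : R) := forall v : 'cV[R]_d,
  (((D - S) *m v)^T *m ((D - S) *m v)) 0 0 <= tau * (v^T *m v) 0 0.
Let obj (D : 'M[R]_d) (tau : R) := a * tau + c * \tr ((D *m G)^T *m (D *m G)).

Let frob (X : 'M[R]_d) : \tr (X^T *m X) = \sum_i \sum_j X j i ^+ 2.
Proof.
by rewrite /mxtrace; apply: eq_bigr => i _; rewrite mxE; apply: eq_bigr => j _; rewrite mxE expr2.
Qed.

(** Here [D] stands for [S *m C]. In this variable the objective is coercive, as [G] is invertible,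
    whatever the rank of [S]. The sublevel set through [D = S], [tau = 0] is compact. *)
Lemma program_minimizer : exists D tau, feas D tau /\
  forall D' tau', feas D' tau' -> obj D tau <= obj D' tau'.
Proof.
pose T := 'rV[R]_(d * d).+1.
pose Dm (t : T) : 'M[R]_d := \matrix_(i, j) t 0 (lift ord0 (mxvec_index i j)).
pose tau (t : T) : R := t 0 ord0.
pose enc (D : 'M[R]_d) (x : R) : T := \row_k (if unlift ord0 k is Some l then mxvec D 0 l else x).
have encD D x : Dm (enc D x) = D by apply/matrixP => i j; rewrite !mxE liftK mxvecE.
have enct D x : tau (enc D x) = x by rewrite /tau mxE unlift_none.
have ctau : continuous tau by move=> t; exact: coord_continuous.
have cD i j : continuous (fun t => Dm t i j).
  by rewrite (_ : (fun t => _) = (fun t : T => t 0 (lift ord0 (mxvec_index i j)))); [move=> t; exact: coord_continuous|apply/funext => t; rewrite mxE].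
have cDM (X : 'M[R]_d) i j : continuous (fun t => (Dm t *m X) i j).
  rewrite (_ : (fun t => _) = (fun t => \sum_k Dm t i k * X k j)); last by apply/funext => t; rewrite mxE.
  by apply: continuous_sumr => k; apply: continuous_mulr; [exact: cD|exact: continuous_cst].
have cobj : continuous (fun t => obj (Dm t) (tau t)).
  apply: continuous_addr; apply: continuous_mulr => //; try exact: continuous_cst.
  rewrite (_ : (fun t => _) = (fun t => \sum_i \sum_j (Dm t *m G) j i * (Dm t *m G) j i)); last first.
    by apply/funext => t; rewrite frob.
  by do 2 (apply: continuous_sumr => ?); apply: continuous_mulr; exact: cDM.
pose gap (v : 'cV[R]_d) (t : T) := (((Dm t - S) *m v)^T *m ((Dm t - S) *m v)) 0 0 + - (v^T *m v) 0 0 * tau t.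
have cgap v : continuous (gap v).
  apply: continuous_addr; last by apply: continuous_mulr => //; exact: continuous_cst.
  have cv i : continuous (fun t => ((Dm t - S) *m v) i 0).
    rewrite (_ : (fun t => _) = (fun t => \sum_k (Dm t i k + - S i k) * v k 0)); last first.
      by apply/funext => t; rewrite mxE; apply: eq_bigr => k _; rewrite mx_subE.
    apply: continuous_sumr => k; apply: continuous_mulr; last exact: continuous_cst.
    by apply: continuous_addr; [exact: cD|exact: continuous_cst].
  rewrite (_ : (fun t => _) = (fun t => \sum_i ((Dm t - S) *m v) i 0 * ((Dm t - S) *m v) i 0)); last first.
    by apply/funext => t; rewrite dotE.
  by apply: continuous_sumr => i; exact: continuous_mulr.
have gapE v t : (gap v t <= 0) =
    ((((Dm t - S) *m v)^T *m ((Dm t - S) *m v)) 0 0 <= tau t * (v^T *m v) 0 0).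
  by rewrite /gap mulNr subr_le0 mulrC.
pose M0 := obj S 0.
pose K := (\bigcap_(v in [set: 'cV[R]_d]) [set t | gap v t <= 0]) `&` [set t | obj (Dm t) (tau t) <= M0].
have feasS : feas S 0 by move=> v; rewrite subrr mul0mx trmx0 mul0mx mxE mul0r.
have KE D x : K (enc D x) <-> feas D x /\ obj D x <= M0.
  split=> [[H1]|[H1 H2]]; rewrite /= ?encD ?enct.
    by split=> // v; have := H1 v I; rewrite /= gapE encD enct.
  by split=> [v _|]; rewrite /= ?gapE encD enct.
have tau0 t : K t -> 0 <= tau t.
  move=> [H _]; pose e : 'cV[R]_d := delta_mx (Ordinal d0) 0.
  have := H e I; rewrite /= gapE => h.
  have : 0 <= tau t * (e^T *m e) 0 0 by apply: le_trans h; exact: dot_ge0.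
  have -> : (e^T *m e) 0 0 = 1.
    rewrite dotE (bigD1 (Ordinal d0))//= big1 => [|j jd]; first by rewrite mxE !eqxx mulr1 addr0.
    by rewrite mxE (negPf jd) mulr0.
  by rewrite mulr1.
have trge0 (D : 'M[R]_d) : 0 <= \tr ((D *m G)^T *m (D *m G)).
  by rewrite frob; apply: sumr_ge0 => i _; apply: sumr_ge0 => j _; exact: sqr_ge0.
have M00 : 0 <= M0 by rewrite /M0 /obj mulr0 add0r mulr_ge0// ltW.
have Kcompact : compact K.
  apply: bounded_closed_compact; last first.
    apply: closedI; last exact: closed_le_fun.
    by apply: closed_bigI => v _; exact: closed_le_fun.
  (* [B1] bounds [tau]. The entries of [D *m G] have squares at most [M0 / c], hence moduli at most
     [B2], and [invmx G] carries this over to [D]. *)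
  pose B1 := M0 / a; pose B2 := 1 + M0 / c.
  pose B := B1 + B2 * \sum_i \sum_j `|invmx G i j|.
  have B10 : 0 <= B1 by rewrite divr_ge0// ltW.
  have B20 : 0 <= B2 by rewrite addr_ge0// divr_ge0// ltW.
  have s0 : 0 <= \sum_i \sum_j `|invmx G i j| by apply: sumr_ge0 => i _; apply: sumr_ge0.
  have tb t : K t -> `|t| <= B.
    move=> Kt; have t0 := tau0 t Kt; have Kobj := Kt.2.
    have h1 : tau t <= B1.
      rewrite /B1 ler_pdivlMr// mulrC.
      by apply: le_trans Kobj; rewrite lerDl mulr_ge0// ltW.
    have h2 i j : `|(Dm t *m G) i j| <= B2.
      have h : c * (Dm t *m G) i j ^+ 2 <= M0.
        apply: (@le_trans _ _ (c * \tr ((Dm t *m G)^T *m (Dm t *m G)))).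
          rewrite ler_pM2l// frob (bigD1 j)//= (bigD1 i)//= -addrA lerDl addr_ge0 ?sumr_ge0//.
            by move=> k _; exact: sqr_ge0.
          by move=> k _; apply: sumr_ge0 => l _; exact: sqr_ge0.
        by apply: le_trans Kobj; rewrite lerDr mulr_ge0// ltW.
      have {}h : (Dm t *m G) i j ^+ 2 <= M0 / c by rewrite ler_pdivlMr// mulrC.
      rewrite /B2; move: h; rewrite -(real_normK (num_real ((Dm t *m G) i j))).
      by move: `|_| (normr_ge0 ((Dm t *m G) i j)) => y y0 h; have := sqr_ge0 (y - 1); nra.
    have h3 i j : `|Dm t i j| <= B2 * \sum_i \sum_j `|invmx G i j|.
      rewrite -(mulmxK Gu (Dm t)) mxE (le_trans (ler_norm_sum _ _ _))//.
      rewrite mulr_sumr; apply: ler_sum => k _; rewrite normrM; apply: ler_pM => //.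
      by rewrite (bigD1 j)//= lerDl sumr_ge0.
    rewrite [`|t|]mx_normrE; apply: bigmax_le => [|[i k] _]/=.
      by apply: addr_ge0 => //; exact: mulr_ge0.
    rewrite ord1; case: (unliftP ord0 k) => [l ->|->].
      case/mxvec_indexP: l => i' j'; apply: (@le_trans _ _ (B2 * \sum_i \sum_j `|invmx G i j|)).
        by have := h3 i' j'; rewrite mxE.
      by rewrite lerDr.
    rewrite -/(tau t) ger0_norm// (le_trans h1)// lerDl mulr_ge0//.
  exists B; split; first exact: num_real.
  by move=> x Bx t Kt /=; apply: (le_trans (tb t Kt)); exact: ltW.
have [|t] := compact_EVT_min _ Kcompact (continuous_subspaceT cobj).
  by exists (enc S 0); apply/KE.
rewrite inE => Kt tmin.
exists (Dm t), (tau t); split.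
  by move=> v; have := Kt.1 v I; rewrite /= gapE.
move=> D' tau' feas'; have [H|/ltW H] := lerP (obj D' tau') M0; last exact: le_trans Kt.2 H.
have := tmin (enc D' tau'); rewrite encD enct; apply; rewrite inE.
exact/KE.
Qed.

End program_minimizer.

(** A minimiser [D] need not be of the form [S *m C]. Replacing it by its projection [S *m (W *m D)]
    costs nothing: the projection fixes [S] and is a contraction, so the constraint survives and the
    trace does not grow. *)
Lemma prog_optimal_exists (R : realType) (d nS : nat) (sigma r : R) (SS SU : 'M[R]_d) :
  (0 < d)%N -> (0 < nS)%N -> 0 < sigma -> 0 < r -> psd SS -> SS \in unitmx -> psd SU ->
  exists C tau, prog_optimal nS sigma r SS SU C tau.
Proof.
move=> d0 nS0 s0 r0 SSpsd SSu SUpsd.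
have [Spsd SE] := psd_msqrt SUpsd; set S := msqrt SU in Spsd SE; have ST' := Spsd.1.
have [W [_ _ SWS SWT SWle]] := psd_pinv Spsd.
have [G [Gu GE]] := invmx_gram SSpsd SSu.
have a0 : 0 < r ^+ 2 by rewrite exprn_gt0.
have c0 : 0 < sigma ^+ 2 / nS%:R by rewrite divr_gt0 ?exprn_gt0 ?ltr0n.
have [D [tau [Dfeas Dmin]]] := program_minimizer S d0 a0 c0 Gu.
have feasE C t : prog_feasible SU C t <->
    forall v : 'cV[R]_d, (((S *m C - S) *m v)^T *m ((S *m C - S) *m v)) 0 0 <= t * (v^T *m v) 0 0.
  have E (v : 'cV[R]_d) : qform ((C - 1%:M)^T *m SU *m (C - 1%:M)) v =
      (((S *m C - S) *m v)^T *m ((S *m C - S) *m v)) 0 0.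
    have -> : S *m C - S = S *m (C - 1%:M) by rewrite mulmxBr mulmx1.
    by rewrite qform_congr -SE -{1}ST' qform_gram (mulmxA S).
  split=> H v; have := H v; rewrite /loewner_le qform_scalar E//.
have objE C t : prog_obj nS sigma r SS SU C t =
    r ^+ 2 * t + sigma ^+ 2 / nS%:R * \tr ((S *m C *m G)^T *m (S *m C *m G)).
  by rewrite /prog_obj (noise_trace _ _ GE) -SE !trmx_mul ST' !mulmxA.
have SC : S *m (W *m D) = S *m W *m D by rewrite mulmxA.
exists (W *m D), tau; split.
  have E2 : S *m W *m D - S = S *m W *m (D - S) by rewrite mulmxBr SWS.
  apply/feasE => v; rewrite SC E2 -(mulmxA (S *m W)).
  by apply: le_trans (Dfeas v); exact: SWle.
move=> C' t' /feasE feas'; rewrite !objE SC.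
apply: le_trans (Dmin _ _ feas'); rewrite lerD2l ler_pM2l//.
have trE (X : 'M[R]_d) : \tr (X^T *m X) = \sum_j ((col j X)^T *m (col j X)) 0 0.
  rewrite -{1}[X^T]mulmx1 trace_gram; apply: eq_bigr => j _.
  by rewrite qform_scalar mul1r.
rewrite !trE; apply: ler_sum => j _.
have -> : col j (S *m W *m D *m G) = S *m W *m col j (D *m G) by rewrite !colE !mulmxA.
exact: SWle.
Qed.

(** * Minimax lower bounds *)

Section inner_products.
Context (R : realType).

Lemma dotDl n (u v w : 'cV[R]_n) : ((u + v)^T *m w) 0 0 = (u^T *m w) 0 0 + (v^T *m w) 0 0.
Proof. by rewrite !dotE -big_split/=; apply: eq_bigr => i _; rewrite mxE mulrDl. Qed.

Lemma dotZl n a (u w : 'cV[R]_n) : ((a *: u)^T *m w) 0 0 = a * (u^T *m w) 0 0.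
Proof. by rewrite trmx_scale -scalemxAl mxE. Qed.

Lemma dot_cauchy n (u v : 'cV[R]_n) :
  ((u^T *m v) 0 0) ^+ 2 <= (u^T *m u) 0 0 * (v^T *m v) 0 0.
Proof.
have [u0|/eqP u0] := boolP ((u^T *m u) 0 0 == 0).
  by rewrite (dot_eq0 (eqP u0)) trmx0 !mul0mx mxE expr0n mul0r.
have N0 : 0 < (u^T *m u) 0 0 by rewrite lt0r dot_ge0 andbT; exact/eqP.
set a := (u^T *m u) 0 0 in N0 *; set b := (u^T *m v) 0 0; set c := (v^T *m v) 0 0.
pose w := a *: v + (- b) *: u.
have wE : (w^T *m w) 0 0 = a * (a * c - b ^+ 2).
  have wv : (v^T *m w) 0 0 = a * c - b ^+ 2.
    by rewrite dotC dotDl !dotZl -/b -/c; ring.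
  have wu : (u^T *m w) 0 0 = 0.
    by rewrite dotC dotDl !dotZl (dotC v) -/a -/b; ring.
  by rewrite {1}/w dotDl !dotZl wv wu; ring.
by move: (dot_ge0 w); rewrite wE pmulr_rge0// subr_ge0.
Qed.

Lemma qform_outer n (u v : 'cV[R]_n) : qform (u *m u^T) v = ((u^T *m v) 0 0) ^+ 2.
Proof. by rewrite /qform mulmxA -mulmxA [v^T *m u]mx11_scalar mul_scalar_mx mxE (dotC v) expr2. Qed.

Lemma unitmx_inj n (A : 'M[R]_n) : (forall v : 'cV[R]_n, A *m v = 0 -> v = 0) -> A \in unitmx.
Proof.
move=> H; rewrite -unitmx_tr -row_free_unit -kermx_eq0; apply/rowV0P => x /sub_kermxP xA.
by rewrite -[x]trmxK (H x^T) ?trmx0// -[A]trmxK -trmx_mul xA trmx0.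
Qed.

Lemma rank1_outer n (A : 'M[R]_n) : psd A -> \rank A = 1%N ->
  exists2 u : 'cV[R]_n, u != 0 & A = u *m u^T.
Proof.
move=> [AT A0] rk1.
have Anz : A != 0 by rewrite -mxrank_eq0 rk1.
move: (col_base A) (row_base A) (mulmx_base A); rewrite rk1 => x y xy.
have x0 : x != 0 by apply: contra Anz => /eqP x0; rewrite -xy x0 mul0mx.
pose xx := (x^T *m x) 0 0; have xx0 : 0 < xx.
  by rewrite lt0r dot_ge0 andbT; apply: contra x0 => /eqP/dot_eq0 ->.
pose k := (y *m x) 0 0 / xx.
have yE : y^T = k *: x.
  have : A^T *m x = A *m x by rewrite AT.
  rewrite -xy trmx_mul -!mulmxA [x^T *m x]mx11_scalar [y *m x]mx11_scalar -/xx !mul_mx_scalar => H.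
  by rewrite /k mulrC -scalerA -H scalerA mulVf ?scale1r// gt_eqF.
have AE : A = k *: (x *m x^T) by rewrite -xy -[y]trmxK yE trmx_scale -scalemxAr.
have k0 : 0 <= k.
  have := A0 x; rewrite AE qformZ qform_outer -/xx => h.
  by rewrite -(@pmulr_lge0 _ (xx ^+ 2)) ?exprn_gt0.
exists (Num.sqrt k *: x).
  apply: contra Anz => /eqP sx0.
  have /eqP sk : Num.sqrt k == 0.
    apply: contraT => k1; case/eqP: x0.
    by rewrite -[x]scale1r -(mulVf k1) -scalerA sx0 scaler0.
   have := sqr_sqrtr k0.
  by rewrite sk expr0n => k00; rewrite AE -k00 scale0r.
by rewrite trmx_scale -scalemxAl -scalemxAr scalerA -expr2 sqr_sqrtr.
Qed.

End inner_products.

(** * Priors on a segment and their products *)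

Section directional_bound.
Local Open Scope ereal_scope.
Context (R : realType) (dO : measure_display) (O : measurableType dO) (Q : probability O R)
  (n : nat) (sigma : R) (z : 'I_n -> O -> R).
Hypothesis sigma0 : (0 < sigma)%R.
Hypothesis zQ : iid_gaussian_noise Q sigma z.

(** Rescaling by [al] makes the noise standard and the radius [al * b]. The prior is chosen before
    the offset [y0] and the estimator [g], which lets it be a factor of a product prior. *)
Lemma directional_bayes (a : 'I_n -> R) (b : R) : (0 < \sum_j a j ^+ 2)%R -> (0 <= b)%R ->
  exists w th : 'I_5 -> R,
   [/\ forall i, (0 <= w i)%R, (\sum_i w i = 1)%R, forall i, (`|th i| <= b)%R &
    forall (y0 : 'I_n -> R) (g : n.-tuple R -> R), measurable_fun [set: n.-tuple R] g ->
      (4 / 5 * (b ^+ 2 / (1 + (\sum_j a j ^+ 2) / sigma ^+ 2 * b ^+ 2)))%:E <=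
      \sum_i (w i)%:E * \int[Q]_v ((g [tuple (y0 j + th i * a j + z j v)%R | j < n] - th i) ^+ 2)%:E].
Proof.
move=> a0 b0; set N := (\sum_j a j ^+ 2)%R in a0 *.
have [->|bn0] := eqVneq b 0%R.
  exists (fun i => (i == ord0)%:R), (fun=> 0%R); split=> [i||i|y0 g mg].
  - exact: ler0n.
  - by rewrite (bigD1 ord0)//= big1 => [|i /negPf ->]; rewrite ?addr0.
  - by rewrite normr0.
  - rewrite expr0n/= mul0r mulr0; apply: sume_ge0 => i _; apply: mule_ge0.
      by rewrite lee_fin ler0n.
    by apply: integral_ge0 => v _; rewrite lee_fin sqr_ge0.
have bp : (0 < b)%R by rewrite lt0r bn0.
pose al := (Num.sqrt N / sigma)%R; have al0 : (0 < al)%R by rewrite divr_gt0// sqrtr_gt0.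
have al2 : (al ^+ 2 = N / sigma ^+ 2)%R by rewrite /al expr_div_n sqr_sqrtr// ltW.
have [w [th [w0 w1 thb H]]] := bounded_normal_mean (mulr_gt0 al0 bp).
exists w, (fun i => th i / al)%R; split=> // [i|y0 g mg].
  by rewrite normrM normfV (gtr0_norm al0) ler_pdivrMr// mulrC.
have W : (0 < \sum_i w i)%R by rewrite w1.
apply: (le_trans _ (bayes_risk_ge sigma0 zQ (fun i => th i / al)%R w0 W y0 a0 mg erefl)).
rewrite -/al (_ : (fun i => al * (th i / al))%R = th); last first.
  by apply/funext => i; rewrite mulrC divfK// gt_eqF.
apply: le_trans (lee_wpmul2l _ H); last by rewrite lee_fin invr_ge0 exprn_ge0// ltW.
rewrite -EFinM lee_fin (exprMn 2 al b) al2 le_eqVlt; apply/orP; left; apply/eqP.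
by field; rewrite !gt_eqF//= ltr_wpDr ?mulr_ge0 ?sqr_ge0 ?exprn_gt0// ltW.
Qed.

End directional_bound.

Section product_prior.
Local Open Scope ereal_scope.
Context (R : realType) (d m : nat) (w : 'I_d -> 'I_m -> R).
Hypothesis w0 : forall i j, (0 <= w i j)%R.
Hypothesis w1 : forall i, (\sum_j w i j = 1)%R.
Local Notation K := {ffun 'I_d -> 'I_m}.

Definition prior (k : K) : R := (\prod_i w i (k i))%R.

Definition upd (k : K) (i : 'I_d) (j : 'I_m) : K := [ffun l => if l == i then j else k l].

Lemma prior_ge0 k : (0 <= prior k)%R.
Proof. by apply: prodr_ge0. Qed.

Lemma prior_sum1 : (\sum_k prior k = 1)%R.
Proof. by rewrite /prior -(bigA_distr_bigA (fun i j => w i j)) big1. Qed.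

Lemma prior_upd k i j : (prior (upd k i j) * w i (k i) = prior k * w i j)%R.
Proof.
rewrite /prior (bigD1 i)//= [in RHS](bigD1 i)//= ffunE eqxx.
rewrite (eq_bigr (fun l => w l (k l))) => [|l li]; last by rewrite ffunE (negPf li).
by set p := (\prod_(_ | _) _)%R; ring.
Qed.

(** Redrawing coordinate [i] leaves a product prior unchanged: exchanging [k i] with the fresh value
    [j] is an involution of the pairs that preserves their joint weight. *)
Lemma prior_resample (F : K -> \bar R) (i : 'I_d) : (forall k, 0 <= F k) ->
  \sum_k (prior k)%:E * F k = \sum_k (prior k)%:E * \sum_j (w i j)%:E * F (upd k i j).
Proof.
move=> F0.
transitivity (\sum_(p : K * 'I_m) (prior p.1 * w i p.2)%:E * F p.1).
  rewrite -(pair_bigA _ (fun k j => (prior k * w i j)%:E * F k))/=; apply: eq_bigr => k _.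
  rewrite -ge0_sume_distrl => [|j _]; last by rewrite lee_fin mulr_ge0 ?prior_ge0.
  by rewrite sumEFin -mulr_sumr w1 mulr1.
pose sw (p : K * 'I_m) := (upd p.1 i p.2, p.1 i).
have swK : involutive sw.
  case=> k j; rewrite /sw/= ffunE eqxx; congr pair; apply/ffunP => l; rewrite !ffunE.
  by case: eqP => // ->.
rewrite (reindex_inj (inv_inj swK))/=.
rewrite -(pair_bigA _ (fun k j => (prior (upd k i j) * w i (k i))%:E * F (upd k i j)))/=.
apply: eq_bigr => k _; rewrite ge0_sume_distrr => [|j _]; last by rewrite mule_ge0 ?lee_fin.
by apply: eq_bigr => j _; rewrite prior_upd EFinM muleA.
Qed.

Lemma product_prior_ge (F : K -> \bar R) (i : 'I_d) (L : \bar R) : (forall k, 0 <= F k) ->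
  (forall k, L <= \sum_j (w i j)%:E * F (upd k i j)) -> L <= \sum_k (prior k)%:E * F k.
Proof.
move=> F0 H; rewrite (prior_resample i F0).
have -> : L = \sum_k (prior k)%:E * L.
  rewrite -[LHS]mul1e -(_ : (\sum_k prior k)%:E = 1); last by rewrite prior_sum1.
  by rewrite -sumEFin ge0_sume_distrl// => k _; rewrite lee_fin prior_ge0.
by apply: lee_sum => k _; apply: lee_wpmul2l; rewrite ?lee_fin ?prior_ge0.
Qed.

End product_prior.

(** The sum is continuous in [k] and vanishes at 0, and at [k1] the single coordinate [i] already
    contributes [s]. *)
Lemma water_filling (R : realType) (d : nat) (v a : 'I_d -> R) (i : 'I_d) (s : R) :
  (forall j, 0 < v j) -> (forall j, 0 <= a j) -> 0 < a i -> 0 < s ->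
  exists2 k : R, 0 < k & \sum_j v j * Num.max 0 (k * a j - 1) = s.
Proof.
move=> v0 a0 ai s0; pose f k := \sum_j v j * Num.max 0 (k * a j - 1).
have f0 : f 0 = 0 by rewrite /f big1// => j _; rewrite mul0r sub0r max_l ?mulr0// oppr_le0.
pose k1 := (s / v i + 1) / a i.
have k10 : 0 <= k1 by rewrite divr_ge0// addr_ge0// divr_ge0// ltW.
have f1 : s <= f k1.
  rewrite /f (bigD1 i)//= ler_wpDr//.
    by apply: sumr_ge0 => j _; rewrite mulr_ge0 ?(ltW (v0 j))// le_max lexx.
  have sv : 0 <= s / v i by rewrite divr_ge0// ltW.
  by rewrite /k1 divfK ?gt_eqF// addrK max_r// mulrCA mulfV ?mulr1// gt_eqF.
have cf : continuous f.
  apply: continuous_sumr => j; apply: continuous_mulr; first exact: continuous_cst.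
  under eq_fun do rewrite maxr_absE.
  have c1 : continuous (fun k : R => k * a j - 1).
    by move=> k; apply: cvgB; [apply: cvgM; [exact: cvg_id|exact: cvg_cst]|exact: cvg_cst].
  apply: continuous_mulr; last exact: continuous_cst.
  apply: continuous_addr; first by apply: continuous_addr; [exact: continuous_cst|exact: c1].
  by move=> k; apply: cvg_norm; apply: cvgB; [exact: cvg_cst|exact: c1].
have [|k kk fk] := @IVT R f 0 k1 s k10 (continuous_subspaceT cf).
  by rewrite f0 ge_min le_max (ltW s0) f1 orbT.
exists k => //; rewrite lt0r; move: kk; rewrite in_itv/= => /andP[-> _]; rewrite andbT.
by apply: contraTneq s0 => kn; rewrite -fk kn f0 ltxx.
Qed.

(** * Program values as lower bounds for all estimators *)

Section minimax_lower_bound.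
Local Open Scope ereal_scope.
Context (R : realType) (dO : measure_display) (O : measurableType dO) (Q : probability O R)
  (nS d : nat) (sigma r : R) (z : 'I_nS -> O -> R) (XS : 'M[R]_(nS, d)) (ST : 'M[R]_d).
Hypothesis sigma0 : (0 < sigma)%R.
Hypothesis r0 : (0 < r)%R.
Hypothesis zQ : iid_gaussian_noise Q sigma z.
Hypothesis STpsd : psd ST.
Hypothesis nS0 : (0 < nS)%N.
Hypothesis d0 : (0 < d)%N.
Let SS := emp_cov XS.
Hypothesis SSu : SS \in unitmx.

Lemma LB_ge_bayes (K : finType) (pi : K -> R) (beta : K -> 'cV[R]_d) (g : 'cV[R]_nS -> 'cV[R]_d) :
  (forall k, (0 <= pi k)%R) -> (\sum_k pi k = 1)%R -> (forall k, (l2norm (beta k) <= r)%R) ->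
  \sum_k (pi k)%:E * risk Q z XS ST g (beta k) <= LB Q z XS ST r g.
Proof.
move=> pi0 pi1 br.
have H k : risk Q z XS ST g (beta k) <= LB Q z XS ST r g.
  by apply: ereal_sup_ubound; exists (beta k) => //=; exact: br.
apply: (@le_trans _ _ (\sum_k (pi k)%:E * LB Q z XS ST r g)).
  by apply: lee_sum => k _; apply: lee_wpmul2l; rewrite ?lee_fin.
by rewrite -ge0_sume_distrl ?sumEFin ?pi1 ?mul1e// => k _; rewrite lee_fin.
Qed.

Lemma LB_ge0 (g : 'cV[R]_nS -> 'cV[R]_d) : 0 <= LB Q z XS ST r g.
Proof.
apply: (@le_trans _ _ (risk Q z XS ST g 0%R)).
  by apply: integral_ge0 => v _; rewrite lee_fin sqr_ge0.
apply: ereal_sup_ubound; exists 0%R => //=.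
by rewrite dot_le ?(ltW r0)// mulmx0 mxE sqr_ge0.
Qed.

Lemma dir_norm (v : 'cV[R]_d) : (\sum_j (XS *m v) j 0 ^+ 2 = nS%:R * qform SS v)%R.
Proof.
rewrite -qformZ -emp_cov_gram// qform_gram dotE.
by apply: eq_bigr => j _; rewrite expr2.
Qed.

Lemma SS_pos (v : 'cV[R]_d) : v != 0%R -> (0 < qform SS v)%R.
Proof.
move=> v0; rewrite lt0r (emp_cov_psd XS).2 andbT; apply: contra v0 => /eqP q0.
have XSv : XS *m v = 0%R.
  apply: dot_eq0; rewrite -qform_gram emp_cov_gram// qformZ -/SS q0 mulr0//.
apply/eqP; rewrite -(mulKmx SSu v) /SS /emp_cov -scalemxAl -mulmxA XSv mulmx0 scaler0 mulmx0.
by [].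
Qed.

Lemma data_tuple (beta : 'cV[R]_d) (v : O) :
  (XS *m beta + \col_j z j v)%R = tcol [tuple ((XS *m beta) j 0 + z j v)%R | j < nS].
Proof. by apply/colP => j; rewrite !mxE tnth_mktuple mxE. Qed.

Lemma measurable_estimate (g : 'cV[R]_nS -> 'cV[R]_d) (l : 'cV[R]_d) : measurable_estimator g ->
  measurable_fun [set: nS.-tuple R] (fun t => (l^T *m g (tcol t)) 0 0)%R.
Proof.
move=> mg; rewrite (_ : (fun t => _) = (fun t => \sum_k l k 0 * g (tcol t) k 0)%R).
  by apply: measurable_sum => k; apply: measurable_funM => //; exact: mg.
by apply/funext => t; rewrite dotE.
Qed.

Lemma measurable_data (y0 : 'I_nS -> R) :
  measurable_fun [set: O] (fun v => [tuple (y0 j + z j v)%R | j < nS]).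
Proof.
apply/measurable_fun_tnthP => j; rewrite (_ : _ \o _ = fun w => y0 j + z j w)%R.
  by apply: measurable_funD => //; exact: zQ.1.
by apply/funext => w /=; rewrite tnth_mktuple.
Qed.

Lemma direction_prior (e : 'cV[R]_d) (b : R) : e != 0%R -> (0 <= b)%R ->
  exists w th : 'I_5 -> R,
   [/\ forall i, (0 <= w i)%R, (\sum_i w i = 1)%R, forall i, (`|th i| <= b)%R &
    forall (beta0 l : 'cV[R]_d) (g : 'cV[R]_nS -> 'cV[R]_d), measurable_estimator g ->
      (4 / 5 * (b ^+ 2 / (1 + nS%:R * qform SS e / sigma ^+ 2 * b ^+ 2)))%:E <=
      \sum_i (w i)%:E * \int[Q]_v (((l^T *m g (XS *m (beta0 + th i *: e) + \col_j z j v)) 0 0 - th i) ^+ 2)%:E].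
Proof.
move=> e0 b0; have N0 : (0 < \sum_j (XS *m e) j 0 ^+ 2)%R.
  by rewrite dir_norm mulr_gt0 ?ltr0n ?SS_pos.
have [w [th [w0 w1 thb H]]] := directional_bayes sigma0 zQ N0 b0.
exists w, th; split=> // beta0 l g mg.
rewrite -dir_norm.
apply: le_trans; first exact: (H (fun j => (XS *m beta0) j 0%R) _ (measurable_estimate l mg)).
apply: lee_sum => i _; rewrite le_eqVlt; apply/orP; left; apply/eqP; congr (_ * _).
apply: eq_integral => v _; congr ((_ - _) ^+ 2)%:E; congr ((_ *m g _) 0 0)%R.
rewrite mulmxDr -scalemxAr; move: (XS *m beta0) (XS *m e) => A B.
by apply/colP => j; rewrite !mxE tnth_mktuple.
Qed.

Lemma risk_forms (g : 'cV[R]_nS -> 'cV[R]_d) (beta : 'cV[R]_d) (I : finType) (t : I -> R) (l : I -> 'cV[R]_d) :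
  measurable_estimator g -> (forall i, (0 <= t i)%R) ->
  (forall v, qform ST v = \sum_i t i * ((l i)^T *m v) 0 0 ^+ 2)%R ->
  risk Q z XS ST g beta = \sum_i (t i)%:E *
    \int[Q]_v (((((l i)^T *m g (XS *m beta + \col_j z j v)) 0 0 - ((l i)^T *m beta) 0 0)) ^+ 2)%:E.
Proof.
move=> mg t0 STE; rewrite /risk.
have mF i : measurable_fun [set: O] (fun v => ((((l i)^T *m g (XS *m beta + \col_j z j v)) 0 0 - ((l i)^T *m beta) 0 0) ^+ 2)%:E).
  apply/measurable_EFinP; apply: measurable_funX; apply: measurable_funB => //.
  rewrite (_ : (fun v => _) = (fun t => ((l i)^T *m g (tcol t)) 0 0)%R \o
      (fun v => [tuple ((XS *m beta) j 0 + z j v)%R | j < nS])); last first.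
    by apply/funext => v; rewrite /= data_tuple.
  by apply: measurableT_comp; [exact: measurable_estimate|exact: measurable_data].
transitivity (\int[Q]_v \sum_i (t i)%:E *
    ((((l i)^T *m g (XS *m beta + \col_j z j v)) 0 0 - ((l i)^T *m beta) 0 0) ^+ 2)%:E).
  apply: eq_integral => v _; rewrite msqrt_l2norm// STE -sumEFin; apply: eq_bigr => i _.
  by rewrite -EFinM mulmxBr mx_subE.
rewrite ge0_integral_sum//; last 2 first.
- by move=> i; apply: measurable_funeM.
- by move=> i v _; rewrite -EFinM lee_fin mulr_ge0 ?sqr_ge0.
apply: eq_bigr => i _; rewrite ge0_integralZl//.
- by move=> v _; rewrite lee_fin sqr_ge0.
- by rewrite lee_fin.
Qed.

Lemma rank1_lower_bound : \rank ST = 1%N -> exists C tau, prog_feasible ST C tau /\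
  forall g, measurable_estimator g ->
    (4 / 5 * prog_obj nS sigma r SS ST C tau)%:E <= LB Q z XS ST r g.
Proof.
move=> rk1.
have [u u0 STE] := rank1_outer STpsd rk1.
have nR : (0 < nS%:R :> R)%R by rewrite ltr0n.
pose s2 := (sigma ^+ 2 / nS%:R)%R; have s20 : (0 < s2)%R by rewrite divr_gt0// exprn_gt0.
pose V := (s2 *: invmx SS)%R.
have [G [Gu GE]] := invmx_gram (emp_cov_psd XS) SSu.
have Vpos (v : 'cV[R]_d) : v != 0%R -> (0 < qform V v)%R.
  move=> v0; rewrite qformZ mulr_gt0//.
  have q0 : (0 <= qform (invmx SS) v)%R by rewrite GE -{1}[G]trmxK qform_gram_ge0.
  rewrite lt0r q0 andbT; apply: contra v0; rewrite GE -{1}[G]trmxK qform_gram => /eqP/dot_eq0 Gv.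
  have GTu : G^T \in unitmx by rewrite unitmx_tr.
  by rewrite -(mulKmx GTu v) Gv mulmx0.
pose M := ((r ^+ 2)%:M + V)%R.
have Mu : M \in unitmx.
  apply: unitmx_inj => v Mv; apply/eqP; apply: contraT => v0.
  have : (0 < qform M v)%R by rewrite qformD qform_scalar ltr_wpDl ?Vpos// mulr_ge0 ?sqr_ge0 ?dot_ge0.
  by rewrite /qform -mulmxA Mv mulmx0 mxE ltxx.
pose q := invmx M *m u.
have Mq : M *m q = u by rewrite mulmxA mulmxV// mul1mx.
have q0 : q != 0%R by apply: contra u0 => /eqP q0; rewrite -Mq q0 mulmx0.
(* The functional [u] splits as [e + c]: [c] is the part that the rule estimates and [e] the part
   that it gives up as bias. *)
pose e := V *m q; pose c := (r ^+ 2 *: q)%R.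
have ec : (e + c)%R = u by rewrite /e /c -[RHS]Mq /M mulmxDl mul_scalar_mx addrC.
pose h := qform V q; have h0 : (0 < h)%R by exact: Vpos.
have he : h = ((q^T *m e) 0 0)%R by rewrite /h /qform /e mulmxA.
have e0 : e != 0%R by apply: contraTneq h0 => e0; rewrite he e0 mulmx0 mxE ltxx.
pose N := ((e^T *m e) 0 0)%R.
have N0 : (0 < N)%R.
  by rewrite lt0r dot_ge0 andbT; apply: contra e0 => /eqP/dot_eq0 ->.
have r20 : (0 < r ^+ 2)%R by rewrite exprn_gt0.
have ue : ((u^T *m e) 0 0 = N + r ^+ 2 * h)%R.
  by rewrite -ec linearD/= mulmxDl mxE /c trmx_scale -scalemxAl [X in (_ + X)%R]mxE -he.
pose uu := ((u^T *m u) 0 0)%R.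
have uu0 : uu != 0%R by apply: contra u0 => /eqP/dot_eq0 ->.
(* Since [ST = u u^T], only [u^T C] enters. This [C] makes it [c^T], so the bias functional is
   [- e^T] and its squared norm [N] is a feasible [tau] by Cauchy-Schwarz. *)
pose C := (uu^-1 *: (u *m c^T))%R.
have uC : u^T *m C = c^T.
  rewrite /C -scalemxAr mulmxA [u^T *m u]mx11_scalar -/uu mul_scalar_mx scalerA mulVf// scale1r//.
have obj : (prog_obj nS sigma r SS ST C N = r ^+ 2 * (N + r ^+ 2 * h))%R.
  rewrite /prog_obj mulrDr; congr (_ + _)%R.
  have -> : \tr (C *m invmx SS *m C^T *m ST) = qform (invmx SS) c.
    have cE : c = C^T *m u by rewrite -[c]trmxK -uC trmx_mul trmxK.
    by rewrite STE mulmxA mxtrace_mulC trace_mx11 /qform -uC cE !mulmxA.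
  rewrite /c qform_scale mulrCA -/s2 -qformZ -/V -/h; ring.
exists C, N; split.
  move=> v; rewrite qform_scalar qform_congr STE qform_outer.
  rewrite mulmxA mulmxBr mulmx1 uC -linearB/= -ec opprD addrA addrAC subrr sub0r.
  by rewrite linearN/= mulNmx mxE sqrrN dot_cauchy.
move=> g mg; rewrite obj.
have ne0 : (0 < l2norm e)%R.
  rewrite lt0r l2norm_ge0 andbT; apply/eqP => n0.
  by move: N0; rewrite /N -l2norm_sq n0 expr0n ltxx.
(* The prior sits on multiples of [e], the direction of largest bias, scaled to reach the sphere of
   radius [r]. Its signal-to-noise ratio is [r ^ 2 * h / N], which makes the Bayes bound equal to
   4/5 of the program value. *)
pose t := (r / l2norm e)%R; pose w := (t *: e)%R.
have t0 : (0 < t)%R by rewrite divr_gt0.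
have t2 : (t ^+ 2 = r ^+ 2 / N)%R by rewrite expr_div_n l2norm_sq.
have w0 : w != 0%R.
  by apply: contra e0 => /eqP w0; rewrite -[e]scale1r -(mulVf (lt0r_neq0 t0)) -scalerA -/w w0 scaler0.
have wSS : (nS%:R * qform SS w / sigma ^+ 2 = r ^+ 2 * h / N)%R.
  have SSe : SS *m e = (s2 *: q)%R by rewrite /e /V -(scalemxAl s2) -(scalemxAr s2) mulmxA mulmxV// mul1mx.
  rewrite /w qform_scale /qform -mulmxA SSe -scalemxAr mxE dotC -he t2 /s2.
  by field; rewrite !gt_eqF.
pose a := ((u^T *m w) 0 0)%R.
have aE : (a = t * (N + r ^+ 2 * h))%R by rewrite /a /w -scalemxAr mxE ue.
have Nh : (0 < N + r ^+ 2 * h)%R by rewrite addr_gt0// mulr_gt0.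
have a0 : (0 < a)%R by rewrite aE mulr_gt0.
have [wt [th [wt0 wt1 thb H]]] := direction_prior w0 ler01.
have br i : (l2norm (th i *: w) <= r)%R.
  rewrite dot_le ?(ltW r0)// dot_scale dot_scale -/N t2 divfK ?gt_eqF//.
  rewrite ler_piMl ?sqr_ge0// -(real_normK (num_real (th i))) expr_le1//.
apply: le_trans (LB_ge_bayes g wt0 wt1 br).
have qa v : (qform ST v = \sum_(i < 1) a ^+ 2 * (((a^-1 *: u)^T *m v) 0 0) ^+ 2)%R.
  rewrite big_ord_recl big_ord0 addr0 STE qform_outer dotZl exprMn mulrA -exprMn divff ?gt_eqF//.
  by rewrite expr1n mul1r.
have a2 : (0 <= (a ^+ 2)%:E) by rewrite lee_fin sqr_ge0.
have lw i : (((a^-1 *: u)^T *m (th i *: w)) 0 0 = th i)%R.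
  by rewrite dotZl -scalemxAr mxE -/a mulrCA mulVf ?mulr1// gt_eqF.
pose I i := \int[Q]_v ((((a^-1 *: u)^T *m g (XS *m (0 + th i *: w) + \col_j z j v)) 0 0 - th i) ^+ 2)%:E.
rewrite (eq_bigr (fun i => (a ^+ 2)%:E * ((wt i)%:E * I i))) => [|i _]; last first.
  rewrite (@risk_forms g _ 'I_1 (fun=> a ^+ 2)%R (fun=> (a^-1 *: u)%R) mg)//.
  by rewrite big_ord_recl big_ord0 adde0 /I lw add0r muleCA.
rewrite -ge0_sume_distrr => [|i _]; last first.
  by apply: mule_ge0; rewrite ?lee_fin//; apply: integral_ge0 => v _; rewrite lee_fin sqr_ge0.
apply: le_trans (lee_wpmul2l a2 (H 0%R (a^-1 *: u)%R g mg)).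
rewrite -EFinM lee_fin wSS expr1n !mulr1 aE exprMn t2.
rewrite le_eqVlt; apply/orP; left; apply/eqP; field.
by rewrite !gt_eqF.
Qed.

Lemma commuting_lower_bound : ST *m SS = SS *m ST -> exists C tau, prog_feasible ST C tau /\
  forall g, measurable_estimator g ->
    (4 / 5 * prog_obj nS sigma r SS ST C tau)%:E <= LB Q z XS ST r g.
Proof.
move=> comm.
have [U [t [s [UU STE SSE]]]] := simultaneous_diagonalization STpsd.1 (emp_cov_psd XS).1 comm.
rewrite -/SS -/(spectral_psd U s) in SSE; rewrite -/(spectral_psd U t) in STE.
have nR : (0 < nS%:R :> R)%R by rewrite ltr0n.
pose u i : 'cV[R]_d := U^T *m delta_mx i 0%R.
have uE i (v : 'cV[R]_d) : (((u i)^T *m v) 0 0 = (U *m v) i 0)%R.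
  by rewrite /u trmx_mul trmxK trmx_delta -mulmxA -rowE mxE.
have Uu i : U *m u i = delta_mx i 0%R by rewrite /u mulmxA UU mul1mx.
have qu a i : (qform (spectral_psd U a) (u i) = a 0 i)%R.
  rewrite spectral_qform (bigD1 i)//= big1 ?addr0; first by rewrite Uu mxE !eqxx expr1n mulr1.
  by move=> j ji; rewrite Uu mxE (negPf ji) expr0n mulr0.
have u0 i : u i != 0%R.
  apply/eqP => ui; have := Uu i; rewrite ui mulmx0 => /matrixP/(_ i 0%R).
  by rewrite !mxE !eqxx => /eqP; rewrite eq_sym oner_eq0.
have t0 i : (0 <= t 0 i)%R by rewrite -qu -STE STpsd.2.
have s0 i : (0 < s 0 i)%R by rewrite -qu -SSE SS_pos.
have [[i0 ti0]|tn] := pselect (exists i, t 0 i != 0)%R; last first.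
  have ST0 v : (qform ST v = 0)%R.
    rewrite STE spectral_qform big1// => i _; have [->|ti] := eqVneq (t 0 i)%R 0%R.
      by rewrite mul0r.
    by case: tn; exists i.
  exists 0%R, 0%R; split=> [v|g mg].
    by rewrite qform_congr ST0 qform_scalar mul0r.
  rewrite /prog_obj !mul0mx mxtrace0 !mulr0 addr0 mulr0.
  exact: LB_ge0.
(* The variance of the least squares estimate of the [i]th coordinate in the common eigenbasis. *)
pose v i := (sigma ^+ 2 / (nS%:R * s 0 i))%R.
have v0 i : (0 < v i)%R by rewrite divr_gt0 ?exprn_gt0 ?mulr_gt0.
pose a i := Num.sqrt (t 0 i)%R.
have a2 i : (a i ^+ 2 = t 0 i)%R by rewrite sqr_sqrtr.
have ai0 : (0 < a i0)%R by rewrite sqrtr_gt0 lt0r ti0 t0.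
(* The level [k] distributes the budget [r ^ 2] as squared radii [v i * p i]; coordinates with
   [k * a i <= 1] receive none. *)
have [k k0 kE] := water_filling v0 (fun j => sqrtr_ge0 (t 0 j)%R) ai0 (exprn_gt0 2 r0).
pose p i := Num.max 0%R (k * a i - 1)%R.
have p0 i : (0 <= p i)%R by rewrite le_max lexx.
have p1 i : (0 < 1 + p i)%R by rewrite ltr_pwDl.
have pa i : (k * a i <= 1 + p i)%R by rewrite -lerBlDl le_max lexx orbT.
pose c i := (p i / (1 + p i))%R.
pose C := spectral_psd U (\row_i c i); pose tau := (k ^-2)%R.
(* The share of [r ^ 2 * tau] carried by coordinate [i] plus its variance equals [t i] times the
   linear minimax risk [v i * c i]. On active coordinates this uses [a i = (1 + p i) / k]. *)
have term i : (v i * p i * k ^- 2 + v i * (t 0 i * c i ^+ 2) = v i * (t 0 i * c i))%R.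
  have [pi0|pin] := eqVneq (p i) 0%R; first by rewrite /c pi0 mul0r !(mulr0, mul0r) expr0n !(mulr0, addr0).
  have pE : (1 + p i = k * a i)%R.
    move: pin; rewrite /p /Num.max; case: ifP => _ pn; last by rewrite eqxx in pn.
    by rewrite addrC subrK.
  have aE : (a i = (1 + p i) / k)%R by rewrite pE mulrAC divff ?mul1r// gt_eqF.
  by rewrite -a2 aE /c; field; rewrite !gt_eqF.
have obj : (prog_obj nS sigma r SS ST C tau = \sum_i v i * (t 0 i * c i))%R.
  rewrite /prog_obj /tau -kE mulr_suml.
  have SSi : invmx SS = spectral_psd U (\row_i (s 0 i)^-1)%R.
    apply: (can_inj (mulKmx SSu)); rewrite mulmxV// SSE spectral_mul//.
    rewrite /spectral_psd (_ : \row_i _ = const_mx 1%R); last first.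
      by apply/rowP => j; rewrite !mxE mulfV// gt_eqF.
    by rewrite diag_const_mx mulmx1 (mulmx1C UU).
  rewrite SSi STE /C spectral_sym !spectral_mul// /spectral_psd mxtrace_mulC mulmxA UU mul1mx mxtrace_diag.
  rewrite mulr_sumr -big_split/=; apply: eq_bigr => j _; rewrite -term !mxE; congr (_ + _)%R.
  by rewrite /v; field; rewrite !gt_eqF.
exists C, tau; split.
  move=> x; rewrite qform_scalar qform_congr STE spectral_qform.
  have CE : U *m ((C - 1%:M) *m x) = \col_i ((c i - 1) * (U *m x) i 0)%R.
    rewrite mulmxBl mul1mx mulmxBr /C /spectral_psd !mulmxA UU mul1mx.
    by apply/colP => j; rewrite mx_subE -mulmxA mul_diag_mx !mxE mulrBl mul1r.
  rewrite CE -(orthogonal_dot x x UU) dotE mulr_sumr; apply: ler_sum => j _.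
  rewrite mxE exprMn -[X in (_ <= _ * X)%R]expr2 mulrA ler_wpM2r ?sqr_ge0//.
  have -> : (c j - 1 = - (1 + p j)^-1)%R by rewrite /c; field; rewrite gt_eqF.
  rewrite sqrrN exprVn ler_pdivrMr ?exprn_gt0// /tau mulrC ler_pdivlMr ?exprn_gt0//.
  by rewrite -a2 -exprMn mulrC ler_sqr ?nnegrE ?mulr_ge0 ?sqrtr_ge0 ?(ltW k0) ?(ltW (p1 j)).
move=> g mg.
(* Half-sides of a box inscribed in the ball, since their squares sum to [r ^ 2]. A product prior on
   the box is supported in the ball and its risks add over coordinates. *)
pose b i := Num.sqrt (v i * p i)%R.
have b2 i : (b i ^+ 2 = v i * p i)%R by rewrite sqr_sqrtr// mulr_ge0// ltW.
have /choice [wt Hwt] i : exists wt : ('I_5 -> R) * ('I_5 -> R),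
   [/\ forall j, (0 <= wt.1 j)%R, (\sum_j wt.1 j = 1)%R, forall j, (`|wt.2 j| <= b i)%R &
    forall (beta0 l : 'cV[R]_d),
      (4 / 5 * (v i * c i))%:E <=
      \sum_j (wt.1 j)%:E * \int[Q]_x (((l^T *m g (XS *m (beta0 + wt.2 j *: u i) + \col_j z j x)) 0 0 - wt.2 j) ^+ 2)%:E].
  have [w [th [w0 w1 thb H]]] := direction_prior (u0 i) (sqrtr_ge0 (v i * p i)%R).
  exists (w, th); split=> //= beta0 l; apply: le_trans (H beta0 l g mg); rewrite -/(b i) b2 SSE qu.
  rewrite lee_fin le_eqVlt; apply/orP; left; apply/eqP; rewrite /c /v.
  field; rewrite !gt_eqF//=.
pose w i j := (wt i).1 j; pose th i j := (wt i).2 j.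
have w0 i j : (0 <= w i j)%R by have [/(_ j)] := Hwt i.
have w1 i : (\sum_j w i j = 1)%R by have [_ +] := Hwt i.
have thb i j : (`|th i j| <= b i)%R by have [_ _ /(_ j)] := Hwt i.
pose beta (q : {ffun 'I_d -> 'I_5}) : 'cV[R]_d := U^T *m \col_i th i (q i).
have UTU : U^T *m U^T^T = 1%:M by rewrite trmxK (mulmx1C UU).
have ubeta q j : (((u j)^T *m beta q) 0 0 = th j (q j))%R by rewrite uE /beta mulmxA UU mul1mx mxE.
have betar q : (l2norm (beta q) <= r)%R.
  rewrite dot_le ?(ltW r0)// /beta orthogonal_dot// dotE -kE; apply: ler_sum => j _.
  rewrite mxE -expr2 -/(p j) -b2 -[leLHS]real_normK ?num_real//.
  by rewrite ler_sqr ?nnegrE ?normr_ge0 ?sqrtr_ge0.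
apply: le_trans (LB_ge_bayes g (prior_ge0 w0) (prior_sum1 w1) betar).
pose I q j := \int[Q]_x ((((u j)^T *m g (XS *m beta q + \col_j z j x)) 0 0 - th j (q j)) ^+ 2)%:E.
have I0 q j : 0 <= I q j by apply: integral_ge0 => x _; rewrite lee_fin sqr_ge0.
have STf x : (qform ST x = \sum_j t 0 j * (((u j)^T *m x) 0 0) ^+ 2)%R.
  by rewrite STE spectral_qform; apply: eq_bigr => j _; rewrite uE.
have -> : \sum_q (prior w q)%:E * risk Q z XS ST g (beta q) =
    \sum_j (t 0%R j)%:E * \sum_q (prior w q)%:E * I q j.
  transitivity (\sum_q \sum_j (t 0%R j)%:E * ((prior w q)%:E * I q j)).
    apply: eq_bigr => q _; rewrite (risk_forms (beta q) mg t0 STf) ge0_sume_distrr.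
      by apply: eq_bigr => j _; rewrite ubeta muleCA.
    by move=> j _; rewrite mule_ge0 ?lee_fin// ubeta; exact: I0.
  rewrite exchange_big/=; apply: eq_bigr => j _; rewrite ge0_sume_distrr// => q _.
  by rewrite mule_ge0 ?lee_fin ?prior_ge0.
rewrite obj mulr_sumr -sumEFin; apply: lee_sum => j _.
rewrite (_ : (4 / 5 * (v j * (t 0 j * c j)) = t 0 j * (4 / 5 * (v j * c j)))%R); last by ring.
rewrite EFinM; apply: lee_wpmul2l; first by rewrite lee_fin.
apply: (product_prior_ge w0 w1 (i := j)) => // q.
have [_ _ _ H] := Hwt j.
(* The other coordinates are frozen and form the offset [beta0], so the one-dimensional bound holds
   conditionally on them. *)
apply: (le_trans (H (U^T *m \col_l (if l == j then 0 else th l (q l)))%R (u j))).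
apply: lee_sum => m _; rewrite le_eqVlt; apply/orP; left; apply/eqP; congr (_ * _).
apply: eq_integral => x _; rewrite ffunE eqxx; congr ((((_ *m g (XS *m _ + _)) 0 0 - _) ^+ 2)%:E)%R.
rewrite /beta /u scalemxAr -mulmxDr; congr (_ *m _); apply/colP => l; rewrite !mxE ffunE.
by case: eqVneq => [->|_]; rewrite ?mulr1 ?add0r ?mulr0 ?addr0.
Qed.

End minimax_lower_bound.

(** * Guarantees for the plug-in rule *)

Section guarantees.
Local Open Scope ereal_scope.
Context (R : realType) (dO : measure_display) (O : measurableType dO) (Q : probability O R)
  (nS d : nat) (sigma r : R) (z : 'I_nS -> O -> R) (XS : 'M[R]_(nS, d)) (ST SU : 'M[R]_d).
Hypothesis sigma0 : (0 < sigma)%R.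
Hypothesis r0 : (0 < r)%R.
Hypothesis zQ : iid_gaussian_noise Q sigma z.
Hypothesis STpsd : psd ST.
Hypothesis nS0 : (0 < nS)%N.
Hypothesis d0 : (0 < d)%N.
Hypothesis SSu : emp_cov XS \in unitmx.
Variable u : R.
Hypothesis u01 : (0 <= u <= 1 / 2)%R.
Hypothesis dev : forall v, (`|qform SU v - qform ST v| <= u * qform ST v)%R.
Variables (C : 'M[R]_d) (tau : R).
Hypothesis Copt : prog_optimal nS sigma r (emp_cov XS) SU C tau.

(** Common end of both inequalities: [a] is 1 against linear rules and [5 / 4] against all rules,
    and [L] is the worst-case risk of one competitor, possibly infinite. *)
Lemma feasible_guarantee C1 tau1 (a K : R) (L : \bar R) : prog_feasible ST C1 tau1 ->
  (0 < a)%R -> (a * (1 + 4 * u) <= K)%R -> 0 <= L ->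
  (prog_obj nS sigma r (emp_cov XS) ST C1 tau1 <= a * fine L)%R ->
  LB Q z XS ST r (fun y => est XS C *m y) <= K%:E * L.
Proof.
have [u0 u1] := andP u01 => feas a0 aK.
have u12 : (0 <= u < 1)%R by rewrite u0/=; lra.
have K0 : (0 < K)%R by apply: lt_le_trans aK; rewrite mulr_gt0//; lra.
have H := deviation_transfer sigma0 zQ STpsd nS0 d0 r0 SSu u12 dev Copt feas.
case: L => [L|_ _|]//; last by rewrite gt0_muley ?lte_fin// leey.
rewrite lee_fin /= => L0 objL; apply: le_trans H _; rewrite -EFinM lee_fin.
(* After clearing the denominator the slack is [2 * u * (1 - 2 * u)], which is where [u <= 1 / 2]
   enters. *)
have q4 : ((1 + u) / (1 - u) <= 1 + 4 * u)%R by rewrite ler_pdivrMr; [nra|lra].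
have q0 : (0 <= (1 + u) / (1 - u))%R by rewrite divr_ge0//; lra.
apply: (le_trans (ler_wpM2l q0 objL)); rewrite mulrA ler_wpM2r//.
by apply: le_trans aK; rewrite mulrC ler_wpM2l// ltW.
Qed.

Lemma linear_guarantee (K : R) : (1 + 4 * u <= K)%R ->
  LB Q z XS ST r (fun y => est XS C *m y) <= K%:E * RL Q z XS ST r.
Proof.
move=> uK; have [u0 u1] := andP u01; apply: lee_mul_inf; first by apply: lt_le_trans uK; lra.
move=> _ [A _ <-]; have := LB_ge0 Q z XS ST r0 (fun y => A *m y).
case LE: (LB Q z XS ST r (fun y => A *m y)) => [L||]// L0.
  have [t [feas objL]] := prog_le_LB sigma0 zQ STpsd nS0 r0 SSu LE.
  by apply: feasible_guarantee feas ltr01 _ _ _ => //; rewrite ?mul1r.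
by rewrite gt0_muley ?leey// lte_fin; apply: lt_le_trans uK; lra.
Qed.

Lemma minimax_guarantee (K : R) : (5 / 4 * (1 + 4 * u) <= K)%R ->
  ST *m emp_cov XS = emp_cov XS *m ST \/ \rank ST = 1%N ->
  LB Q z XS ST r (fun y => est XS C *m y) <= K%:E * RN Q z XS ST r.
Proof.
move=> uK cases; have [u0 u1] := andP u01.
have [C1 [tau1 [feas H]]] : exists C tau, prog_feasible ST C tau /\
    forall g, measurable_estimator g ->
    (4 / 5 * prog_obj nS sigma r (emp_cov XS) ST C tau)%:E <= LB Q z XS ST r g.
  by case: cases; [exact: commuting_lower_bound|exact: rank1_lower_bound].
have K0 : (0 < K)%R by apply: lt_le_trans uK; lra.
apply: lee_mul_inf => // _ [g mg <-].
have := LB_ge0 Q z XS ST r0 g; have := H g mg.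
case: (LB Q z XS ST r g) => [L|_ _|]//; last by rewrite gt0_muley ?leey.
rewrite lee_fin => objL L0.
have a0 : (0 < 5 / 4 :> R)%R by lra.
apply: (feasible_guarantee feas a0 uK L0); rewrite -ler_pdivrMl//; apply: le_trans objL.
by rewrite invf_div.
Qed.

End guarantees.

Theorem theorem3 :
  exists c0 C : nat,
  forall (R : realType) (d nS nU : nat) (sigma r rho delta : R),
  (0 < d)%N -> (0 < nS)%N -> (0 < nU)%N ->
  0 < sigma -> 0 < r -> 0 < rho -> 0 < delta < 1 ->
  forall (XS : 'M[R]_(nS, d)),
  emp_cov XS \in unitmx ->
  (* the target distribution p_T *)
  forall (pT : probability (d.-tuple R) R) (ST : 'M[R]_d),
  mean_zero_with_second_moment pT ST ->
  subgaussian pT ST rho ->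
  (* the noise z ~ N(0, sigma^2 I_{nS}) on its own probability space *)
  forall (dz : measure_display) (Oz : measurableType dz) (Q : probability Oz R)
    (z : 'I_nS -> Oz -> R),
  iid_gaussian_noise Q sigma z ->
  (* the unlabeled sample X_U with i.i.d. rows from p_T *)
  forall (dx : measure_display) (Ox : measurableType dx) (P : probability Ox R)
    (x : 'I_nU -> Ox -> d.-tuple R),
  iid_sample P pT x ->
  let SS := emp_cov XS in
  let SU := fun w : Ox => emp_cov (\matrix_(i < nU, j < d) tnth (x i w) j) in
  (* C-hat: an optimal solution of the program, whenever one exists *)
  forall Chat : Ox -> 'M[R]_d,
  (forall w, (exists C0 tau0, prog_optimal nS sigma r SS (SU w) C0 tau0) ->
     exists tau, prog_optimal nS sigma r SS (SU w) (Chat w) tau) ->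
  let betahat := fun w (y : 'cV[R]_nS) =>
    (nS%:R^-1 *: (Chat w *m invmx SS *m XS^T *m y)) in
  let eps := Num.sqrt (rho ^+ 4 * (d%:R + ln delta^-1) / nU%:R) in
  nU%:R >= c0%:R * rho ^+ 4 * (d%:R + ln delta^-1) ->
  exists E : set Ox, measurable E /\ (P E >= (1 - delta)%:E)%E /\
    forall w, E w ->
      (LB Q z XS ST r (betahat w) <= (1 + C%:R * eps)%:E * RL Q z XS ST r)%E /\
      (ST *m SS = SS *m ST \/ \rank ST = 1%N ->
       (LB Q z XS ST r (betahat w) <= (5 / 4 + C%:R * eps)%:E * RN Q z XS ST r)%E).

Proof.
(* With [c0 = 900^2] the hypothesis gives [eps <= 1/900], so that the relative
   deviation [u = 16/7 * 192 * eps] is at most [1/2], and [5 * u <= 2500 * eps]. *)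
exists ((30 ^ 2) ^ 2)%N, (50 ^ 2)%N.
move=> R d nS nU sigma r rho delta d0 nS0 nU0 sigma0 r0 rho0 delta01 XS SSu pT ST mom subg
  dz Oz Q z zQ dx Ox P x xiid SS SU Chat ChatE betahat eps nUge.
have STpsd := second_moment_psd mom.
have [W [WT WS SWS _ SWle]] := psd_pinv (psd_msqrt STpsd).1.
have nR : 0 < nU%:R :> R by rewrite ltr0n.
have dL : 0 < d%:R + ln delta^-1.
  by case/andP: delta01 => de0 de1; rewrite ltr_wpDl// ln_gt0// invf_gt1.
have eps0 : 0 <= eps by exact: sqrtr_ge0.
have eps1 : eps <= (30 * 30)^-1.
  rewrite -[leRHS]ger0_norm ?invr_ge0 ?mulr_ge0// -sqrtr_sqr; apply: ler_wsqrtr.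
  rewrite exprVn ler_pdivrMr// ler_pdivlMl ?exprn_gt0 ?mulr_gt0//.
  by apply: le_trans nUge; rewrite !natrX -expr2 mulrA.
have eps18 : eps <= 1 / 8 by apply: le_trans eps1 _; lra.
have [E [mE PE H]] := sample_covariance mom subg rho0 WT WS SWS SWle xiid nU0 delta01 d0 erefl eps18.
exists E; split=> //; split=> // w Ew.
pose u := 16 / 7 * (12 * 16 * eps).
have u01 : 0 <= u <= 1 / 2 by apply/andP; rewrite /u; split; lra.
have [tau Copt] := ChatE w (prog_optimal_exists d0 nS0 sigma0 r0 (emp_cov_psd XS) SSu (emp_cov_psd _)).
have -> : betahat w = (fun y => est XS (Chat w) *m y).
  by apply/funext => y; rewrite /betahat /est scalemxAl.
have CE : (50 ^ 2)%N%:R = 50 * 50 :> R by rewrite natrX expr2.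
split.
  apply: (linear_guarantee sigma0 r0 zQ STpsd nS0 d0 SSu u01 (H w Ew) Copt).
  by rewrite CE /u; lra.
move=> cases; apply: (minimax_guarantee sigma0 r0 zQ STpsd nS0 d0 SSu u01 (H w Ew) Copt _ cases).
by rewrite CE /u; lra.
Qed.
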